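(* Let $k$ be an algebraically closed field of characteristic $0$, $m\ge n$, and let $\mathcal T_+\subset\mathcal T_{m|n}=Rep(GL(m|n))$ be the full subcategory of modules with a filtration by Kac modules. Each $M\in\mathcal T_+$ has a canonical degree filtration, i.e. a filtration by submodules $F_i(M)\in\mathcal T_+$ such that $$\cdots\subseteq F_{i-1}(M)\subseteq F_i(M)\subseteq F_{i+1}(M)\subseteq\cdots$$ and $$F_i(M)/F_{i-1}(M)=\bigoplus_\lambda V(\lambda)$$ holds for certain Kac modules $V(\lambda)\in\mathcal T_+$ of degree $\deg(\lambda)=i$. This filtration is inherited to retracts $N$ of $M$, so that $F_i(N)=N\cap F_i(M)$. The filtration is functorial with respect to morphisms.
   Context: $\mathcal T_{m|n}$ is the category of finite dimensional algebraic representations of $GL(m|n)$ over $k$ with parity preserving morphisms. Weights are $\lambda=(\lambda_1,\dots,\lambda_m\,|\,\lambda_{m+1},\dots,\lambda_{m+n})$ with integer entries, $\lambda_1\ge\dots\ge\lambda_m$ and $\lambda_{m+1}\ge\dots\ge\lambda_{m+n}$ (highest weights with respect to the Borel subalgebra of upper triangular matrices); for each weight there is the irreducible representation $L(\lambda)$ and its parity shift. The Kac module $V(\lambda)=\mathrm{Ind}_{P(m|n)^+}^{GL(m|n)}L_P(\lambda)$ is obtained from the irreducible representation of $GL(m)\times GL(n)$ of highest weight $\lambda$, extended trivially to the parabolic subgroup $P(m|n)^+$ of upper triangular block matrices, by parabolic induction (it is the universal highest weight module, with simple cosocle $L(\lambda)$); parity shifts of Kac modules are also regarded as Kac modules. The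 degree of $\lambda$ is $\deg(\lambda)=\sum_{i=1}^m\lambda_i$. As usual for filtrations of finite dimensional modules, $F_i(M)=0$ for $i\ll0$ and $F_i(M)=M$ for $i\gg0$.
   Formalization: The formal statement takes the Kac modules V(λ) in F_i(M)/F_{i-1}(M) to have degree deg(λ) = -i instead of i, since Kac modules of larger degree occur as submodules; as printed, the claim fails already for GL(1|1). *)

(* Defs.v *)
From HB Require Import structures.
From mathcomp Require Import all_boot all_order all_algebra.
From mathcomp Require Import mpoly.

Set Implicit Arguments.
Unset Strict Implicit.
Unset Printing Implicit Defensive.

Import GRing.Theory.
Local Open Scope ring_scope.

(* Matrices of size m + n are read as the super matrices of gl(m|n);           *)
(* false stands for even and true for odd.                                     *)
Section SuperMatrices.
Variables (k : fieldType) (m n : nat).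
Implicit Types X Y a : 'M[k]_(m + n).

Definition parity_mx (p : bool) X : bool :=
  if p then (ulsubmx X == 0) && (drsubmx X == 0)
  else (ursubmx X == 0) && (dlsubmx X == 0).

(* [X, Y] for X of parity p and Y of parity q *)
Definition sbracket (p q : bool) X Y : 'M[k]_(m + n) :=
  X *m Y - (-1) ^+ (p && q) *: (Y *m X).

(* G_0 = GL(m) x GL(n), the even part of GL(m|n) *)
Definition G0 : pred 'M[k]_(m + n) :=
  [pred a | (a \in unitmx) && parity_mx false a].

(* Lie algebra of the parabolic P(m|n)^+ of upper triangular block matrices,   *)
(* and its odd part, the abelian ideal g_1.                                    *)
Definition upper_block : pred 'M[k]_(m + n) := [pred X | dlsubmx X == 0].
Definition odd_upper_block : pred 'M[k]_(m + n) :=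
  [pred X | parity_mx true X && (dlsubmx X == 0)].

(* The regular functions on G_0 are the restrictions of the polynomials in the *)
(* entries of a and of a^-1.                                                   *)
Definition regfun : Type :=
  {mpoly k[(m + n) * (m + n) + (m + n) * (m + n)]}.

Definition regpoint (A B : 'M[k]_(m + n)) :
    'I_((m + n) * (m + n) + (m + n) * (m + n)) -> k :=
  fun i => row_mx (mxvec A) (mxvec B) 0 i.

Definition regeval (P : regfun) a : k := P.@[regpoint a (invmx a)].

(* Differential at the identity: the tangent vector X of G_0 moves a in the    *)
(* direction X and a^-1 in the direction - X.                                  *)
Definition regdiff1 (P : regfun) X : k :=
  \sum_i regpoint X (- X) i * (P^`M(i)).@[regpoint 1%:M 1%:M].

End SuperMatrices.

Arguments G0 : clear implicits.
Arguments upper_block : clear implicits.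
Arguments odd_upper_block : clear implicits.

(* Finite dimensional algebraic representations of GL(m|n), as representations *)
(* of the Harish-Chandra pair (G_0, gl(m|n)) on a superspace                   *)
(* V = par false (+) par true. The values of grp outside G_0 are irrelevant.   *)
Record glmod_axioms (k : fieldType) (m n : nat) (V : vectType k)
    (par : bool -> {vspace V}) (grp : 'M[k]_(m + n) -> 'End(V))
    (lie : {linear 'M[k]_(m + n) -> 'End(V)}) : Prop := GLModAxioms {
  glmod_par_cap : (par false :&: par true = 0)%VS;
  glmod_par_add : (par false + par true = fullv)%VS;
  glmod_grp1 : grp 1%:M = \1%VF;
  glmod_grpM : forall a b, a \in G0 k m n -> b \in G0 k m n ->
    grp (a *m b) = (grp a \o grp b)%VF;
  glmod_grp_par : forall a p v, a \in G0 k m n ->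
    v \in par p -> grp a v \in par p;
  glmod_lie_par : forall X p q v, parity_mx p X ->
    v \in par q -> lie X v \in par (p (+) q);
  glmod_bracket : forall X Y p q v, parity_mx p X -> parity_mx q Y ->
    lie (sbracket p q X Y) v =
    lie X (lie Y v) - (-1) ^+ (p && q) *: lie Y (lie X v);
  glmod_Ad : forall a X v, a \in G0 k m n ->
    grp a (lie X v) = lie (a *m X *m invmx a) (grp a v);
  (* The matrix coefficients of grp are regular functions on G_0, and the      *)
  (* differential of grp is the restriction of lie to the even part.           *)
  glmod_alg : forall (phi : {linear V -> k^o}) (v : V),
    exists P : regfun k m n,
      (forall a, a \in G0 k m n -> phi (grp a v) = regeval P a) /\
      (forall X, parity_mx false X -> phi (lie X v) = regdiff1 P X)
}.

Record glmod (k : fieldType) (m n : nat) : Type := GLMod {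
  glmod_sort :> vectType k;
  par : bool -> {vspace glmod_sort};
  grp : 'M[k]_(m + n) -> 'End(glmod_sort);
  lie : {linear 'M[k]_(m + n) -> 'End(glmod_sort)};
  glmodP : glmod_axioms par grp lie
}.

Section GLModTheory.
Variables (k : fieldType) (m n : nat).
Notation T := (glmod k m n).

Definition grp_stable (M : T) (U : {vspace M}) : Prop :=
  forall a u, a \in G0 k m n -> u \in U -> grp M a u \in U.

Definition submod (M : T) (U : {vspace M}) : Prop :=
  [/\ (U = U :&: par M false + U :&: par M true)%VS,
      grp_stable U &
      forall X u, u \in U -> lie M X u \in U].

(* The restriction of f to U preserves parity and commutes with G_0 and with   *)
(* the elements of S.                                                          *)
Definition hom_on (S : pred 'M[k]_(m + n)) (M N : T) (U : {vspace M})
    (f : 'Hom(M, N)) : Prop :=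
  [/\ forall p u, u \in U -> u \in par M p -> f u \in par N p,
      forall a u, a \in G0 k m n -> u \in U -> f (grp M a u) = grp N a (f u) &
      forall X u, S X -> u \in U -> f (lie M X u) = lie N X (f u)].

Definition is_hom (M N : T) (f : 'Hom(M, N)) : Prop := hom_on predT fullv f.

(* U / W is isomorphic to the direct sum of the K j: the maps q j on U induce  *)
(* a surjection from U onto the (finite) direct sum of the K j, of kernel W.   *)
Definition quotient_iso_sum (M : T) (U W : {vspace M})
    (J : finType) (K : J -> T) : Prop :=
  exists q : forall j, 'Hom(M, K j),
    [/\ forall j, hom_on predT U (q j),
        forall y : (forall j, K j),
          exists2 u, u \in U & forall j, q j u = y j &
        forall u, u \in W <-> u \in U /\ forall j, q j u = 0].

Definition weight : Type := 'I_(m + n) -> int.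

Definition dominant (lam : weight) : Prop :=
  (forall i j : 'I_m, (i <= j)%N -> lam (lshift n j) <= lam (lshift n i)) /\
  (forall i j : 'I_n, (i <= j)%N -> lam (rshift m j) <= lam (rshift m i)).

Definition deg (lam : weight) : int := \sum_(i < m) lam (lshift n i).

Definition highest_weight_vector (M : T) (lam : weight) (v : M) : Prop :=
  [/\ v != 0,
      forall i, lie M (delta_mx i i) v = (lam i)%:~R *: v &
      forall i j : 'I_(m + n), (i < j)%N -> lie M (delta_mx i j) v = 0].

Definition grp_irreducible (M : T) (L : {vspace M}) : Prop :=
  [/\ L <> 0%VS, grp_stable L &
      forall U : {vspace M}, (U <= L)%VS -> grp_stable U -> U = 0%VS \/ U = L].

(* K = Ind_P^GL(m|n) L for a P-submodule L of K, where P = P(m|n)^+ and Ind is *)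
(* the left adjoint of the restriction from GL(m|n) to P. A P-linear map on L  *)
(* is given by any linear map f on K whose restriction to L is P-linear.       *)
Definition induced_from (K : T) (L : {vspace K}) : Prop :=
  forall (W : T) (f : 'Hom(K, W)), hom_on (upper_block k m n) L f ->
    exists! g : 'Hom(K, W), is_hom g /\ {in L, g =1 f}.

(* K is isomorphic to V(lam) or to its parity shift: L is the irreducible      *)
(* G_0-module L_P(lam), placed in parity p, on which g_1 acts trivially.       *)
Definition is_kac (lam : weight) (K : T) : Prop :=
  dominant lam /\
  exists (L : {vspace K}) (p : bool),
    [/\ (L <= par K p)%VS,
        grp_irreducible L,
        exists2 v, v \in L & highest_weight_vector lam v,
        forall X v, odd_upper_block k m n X -> v \in L -> lie K X v = 0 &
        induced_from L].

(* The submodule U of M has a finite filtration with Kac modules as quotients. *)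
Definition kac_flag (M : T) (U : {vspace M}) : Prop :=
  exists (r : nat) (E : nat -> {vspace M}),
    [/\ E 0%N = 0%VS, E r = U,
        forall i, (i <= r)%N -> submod (E i) &
        forall i, (i < r)%N -> (E i <= E i.+1)%VS /\
          exists lam K, is_kac lam K /\
            quotient_iso_sum (E i.+1) (E i) (fun _ : unit => K)].

Definition in_Tplus (M : T) : Prop := kac_flag (fullv : {vspace M}).

(* The i-th graded piece is a sum of Kac modules of degree - i, not i: Kac     *)
(* modules V(lam) of larger degree occur as submodules, not as quotients. For  *)
(* gl(1|1), the module induced from the trivial representation of G_0 has a    *)
(* submodule V(1|-1), of quotient V(0|0), and no submodule V(0|0), so that it  *)
(* has no increasing filtration with i-th graded piece of degree i.            *)
Definition degree_filtration (M : T) (F : int -> {vspace M}) : Prop :=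
  [/\ forall i, submod (F i) /\ kac_flag (F i),
      forall i : int, (F (i - 1) <= F i)%VS,
      exists i0 : int, forall i : int, i <= i0 -> F i = 0%VS,
      exists i1 : int, forall i : int, i1 <= i -> F i = fullv &
      forall i : int, exists (r : nat) (lam : 'I_r -> weight) (K : 'I_r -> T),
        (forall j, is_kac (lam j) (K j) /\ deg (lam j) = - i) /\
        quotient_iso_sum (F i) (F (i - 1)) K].

(* s identifies N with a retract of M. *)
Definition retract (M N : T) (s : 'Hom(N, M)) (t : 'Hom(M, N)) : Prop :=
  [/\ is_hom s, is_hom t & (t \o s)%VF = \1%VF].

End GLModTheory.

(* Main.v *)
Require Import Defs.
From HB Require Import structures.
From mathcomp Require Import all_boot all_order all_algebra.
From mathcomp Require Import mpoly zify ring.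
From Stdlib Require Import ClassicalEpsilon.

Set Implicit Arguments.
Unset Strict Implicit.
Unset Printing Implicit Defensive.

Import Order.TTheory GRing.Theory Num.Theory.
Local Open Scope ring_scope.

(* For an integer d, let F_d(M) be the submodule generated by the eigenvectors *)
(* of z = E_11 + ... + E_mm of integer eigenvalue at least d; the filtration   *)
(* is i |-> F_{-i}(M), so that functoriality and compatibility with retracts   *)
(* are formal. As z is central in the even part and the odd lower matrices     *)
(* decrease its eigenvalues by 1, a Kac module of degree d is induced from its *)
(* eigenspace of eigenvalue d and has no larger eigenvalue. Let M / E be a Kac *)
(* module of degree c. By complete reducibility over G_0 its top lifts to M,   *)
(* where g_1 maps it to F_{c+1}(M) = F_{c+1}(E), and by the universal property *)
(* M / F_{c+1}(M) -> M / E splits. Thus F_d(M) / F_{d+1}(M) is, by induction   *)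
(* on a Kac flag, a sum of Kac modules of degree d. Conversely, a module which *)
(* is induced from its part of degree d, with g_1 acting trivially on that     *)
(* part, is a sum of Kac modules of degree d, again by complete reducibility;  *)
(* this property passes to retracts. Complete reducibility is proved with the  *)
(* Casimir operator, and G_0-stability is compared with stability under the    *)
(* Lie algebra on the one-parameter subgroups that generate G_0.               *)

(** The filtration is not read off a Kac flag: [degfil] depends only on the eigenvalues of z, so
    homomorphisms respect it ([degfil_hom]), and only the shape of its graded pieces depends on
    membership in T_+.

    Those pieces are described in two ways. [kac_graded] exhibits them as sums of Kac modules; it is
    proved along a Kac flag by [kac_graded_insert], where [pure_split] detaches the Kac module on
    top from everything of smaller or equal degree below it. [pure] is intrinsic: a module is
    induced from its degree d part, on which g_1 acts by zero. Purity passes to retracts by a formal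
    argument ([pure_retract]), with no appeal to uniqueness of decompositions, and [pure_decomp]
    turns it back into a sum of Kac modules. Hence M lies in T_+ exactly when [pure_graded M] holds
    ([Tplus_graded], [graded_Tplus]), and [graded_retract] settles retracts. Uniqueness
    ([filtration_unique]) holds because a pure piece is generated in its degree and vanishes in
    larger degrees.

    Underneath lie complete reducibility over the even part ([hw_generate], [complement_exists]),
    the passage between G_0 and its Lie algebra ([G0_ind], [ev_stable_grp], [grp_stable_ev]), and
    the triangularity of induced modules ([induced_low]). *)

Section LfunLinear.
Variables (k : fieldType) (V W : vectType k) (f : 'Hom(V, W)).

Lemma lfunZ a v : f (a *: v) = a *: f v. Proof. exact: linearZ. Qed.
Lemma lfunD u v : f (u + v) = f u + f v. Proof. exact: linearD. Qed.
Lemma lfunB u v : f (u - v) = f u - f v. Proof. exact: linearB. Qed.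
Lemma lfun0 : f 0 = 0. Proof. exact: linear0. Qed.

Lemma lfun_sum (I : Type) (r : seq I) (P : pred I) (F : I -> V) :
  f (\sum_(i <- r | P i) F i) = \sum_(i <- r | P i) f (F i).
Proof. exact: linear_sum. Qed.

End LfunLinear.

(** * Subspaces generated by predicates *)

Section Generated.
Variables (k : fieldType) (V : vectType k).
Implicit Types (X P : V -> Prop) (U W : {vspace V}).

(** A subspace of maximal dimension inside [P] exhausts [P]; the induction is on codimension. It
    lets subspaces be defined by arbitrary linear conditions. *)
Lemma vspace_of_pred P : P 0 -> (forall a u v, P u -> P v -> P (a *: u + v)) ->
  exists U, forall v, v \in U <-> P v.
Proof.
move=> P0 Plin.
suff H : forall d U, (\dim {:V} - \dim U <= d)%N -> (forall v, v \in U -> P v) ->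
    exists U', forall v, v \in U' <-> P v.
  apply: (H _ 0%VS (leqnn _)) => v; rewrite memv0 => /eqP ->; exact: P0.
elim=> [|d IHd] U dU UP; last first.
  case: (classic (exists2 v, P v & v \notin U)) => [[v Pv vU]|nex]; last first.
    exists U => v; split; first exact: UP.
    by move=> Pv; apply/negPn/negP => vU; apply: nex; exists v.
  apply: (IHd (<[v]> + U)%VS).
    have : (\dim U < \dim (<[v]> + U))%N.
      have /dimv_leqif_sup E : (U <= <[v]> + U)%VS by apply: addvSr.
      rewrite (ltn_leqif E); apply: contra vU => /subvP; apply.
      by apply: (subvP (addvSl _ _)); apply: memv_line.
    have : (\dim (<[v]> + U) <= \dim {:V})%N by apply: dimvS; apply: subvf.
    by lia.
  by move=> w /memv_addP [x /vlineP [a ->]] [y yU ->]; apply: Plin => //; apply: UP.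
exists U => v; split; first exact: UP.
move=> _; have /dimv_leqif_sup E := subvf U.
have : (\dim {:V} <= \dim U)%N by rewrite -subn_eq0 -leqn0.
by rewrite (geq_leqif E) => /subvP; apply; apply: memvf.
Qed.

Lemma least_vspace (C : {vspace V} -> Prop) : C fullv ->
    (forall U W, C U -> C W -> C (U :&: W)%VS) ->
  exists U, C U /\ forall W, C W -> (U <= W)%VS.
Proof.
move=> Cf CI.
suff H : forall d U, (\dim U <= d)%N -> C U ->
    exists U', C U' /\ forall W, C W -> (U' <= W)%VS by apply: (H _ fullv (leqnn _)).
elim=> [|d IHd] U dU CU.
  exists U; split=> // W _; move: dU; rewrite leqn0 dimv_eq0 => /eqP ->; exact: sub0v.
case: (classic (exists2 W, C W & ~~ (U <= W)%VS)) => [[W CW nUW]|nex]; last first.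
  by exists U; split=> // W CW; apply/negPn/negP => nUW; apply: nex; exists W.
apply: (IHd (U :&: W)%VS); last exact: CI.
rewrite -ltnS; apply: leq_trans dU.
have /dimv_leqif_sup E := capvSl U W.
by rewrite (ltn_leqif E) subv_cap subvv.
Qed.

Definition op_closed (I : Type) (op : I -> 'End(V)) (S : I -> Prop) U :=
  forall i, S i -> forall v, v \in U -> op i v \in U.

Definition contains X U := forall v, X v -> v \in U.

Lemma clos_exists (I : Type) (op : I -> 'End(V)) (S : I -> Prop) X :
  exists U, (contains X U /\ op_closed op S U) /\
    forall W, contains X W /\ op_closed op S W -> (U <= W)%VS.
Proof.
apply: least_vspace => [|U W [XU SU] [XW SW]].
  by split=> [v _|i _ v _]; apply: memvf.
split=> [v Xv|i Si v]; first by rewrite memv_cap XU ?XW.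
by rewrite !memv_cap => /andP [vU vW]; rewrite SU ?SW.
Qed.

Definition clos (I : Type) (op : I -> 'End(V)) (S : I -> Prop) X : {vspace V} :=
  sval (constructive_indefinite_description _ (clos_exists op S X)).

Section Clos.
Variables (I : Type) (op : I -> 'End(V)) (S : I -> Prop) (X : V -> Prop).

Let closP := proj2_sig (constructive_indefinite_description _ (clos_exists op S X)).

Lemma clos_in v : X v -> v \in clos op S X.
Proof. by case: closP => -[XU _] _; apply: XU. Qed.

Lemma clos_op i v : S i -> v \in clos op S X -> op i v \in clos op S X.
Proof. by case: closP => -[_ SU] _ Si; apply: SU. Qed.

Lemma clos_sub U : contains X U -> op_closed op S U -> (clos op S X <= U)%VS.
Proof. by move=> XU SU; case: closP => _; apply. Qed.

End Clos.

(** A closure under an empty family of operators. [X] is an arbitrary predicate, possibly infinite,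
    so the span of a sequence would not do. *)
Definition spanv X : {vspace V} := clos (fun i : void => match i with end) (fun=> True) X.

Lemma spanv_in X v : X v -> v \in spanv X.
Proof. exact: clos_in. Qed.

Lemma spanv_sub X U : contains X U -> (spanv X <= U)%VS.
Proof. by move=> XU; apply: clos_sub => // -[]. Qed.

Lemma spanv_ind X P : P 0 -> (forall a u v, P u -> P v -> P (a *: u + v)) ->
  (forall v, X v -> P v) -> forall v, v \in spanv X -> P v.
Proof.
move=> P0 Plin XP v vX; have [U UP] := vspace_of_pred P0 Plin.
by apply/UP; apply: (subvP (spanv_sub _) _ vX) => w /XP /UP.
Qed.

Lemma spanvS X Y : (forall v, X v -> Y v) -> (spanv X <= spanv Y)%VS.
Proof. by move=> XY; apply: spanv_sub => v /XY; apply: spanv_in. Qed.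

Lemma spanv_img X (W : vectType k) (f : 'Hom(V, W)) (U : {vspace W}) :
  (forall v, X v -> f v \in U) -> forall v, v \in spanv X -> f v \in U.
Proof.
move=> H v vX; rewrite memv_preim; apply: (subvP (spanv_sub _) _ vX) => w Xw.
by rewrite -memv_preim; apply: H.
Qed.

(* A triangularity argument in the style of Poincare-Birkhoff-Witt: the        *)
(* operators not in low are moved to the right through those in low.           *)
Lemma clos_low_stable (I : Type) (op : I -> 'End(V)) (low : pred I) X :
    (forall x v, ~~ low x -> X v -> op x v \in clos op low X) ->
    (forall x y v, ~~ low x -> low y ->
      exists b (z : I) (c : k) (w : I) (d : k), op x (op y v) =
        b *: op y (op x v) + c *: op z v + d *: op w v) ->
  op_closed op (fun=> True) (clos op low X).
Proof.
set N := clos op low X => HX Hc.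
(* [Y] collects the vectors of [N] that every operator keeps in [N]; minimality of the closure will
   give [N <= Y]. *)
have [Y HY] : exists Y : {vspace V}, forall v, v \in Y <->
    v \in N /\ forall x, op x v \in N.
  apply: vspace_of_pred => [|a u v [uN uS] [vN vS]].
    by split=> [|x]; rewrite ?linear0 mem0v.
  split=> [|x]; first by rewrite memvD ?memvZ.
  by rewrite linearP memvD ?memvZ ?uS ?vS.
suff /subvP NY : (N <= Y)%VS by move=> x _ v /NY /HY [].
apply: clos_sub => [v Xv|y ly v /HY [vN vS]].
  apply/HY; split=> [|x]; first exact: clos_in.
  by case: (boolP (low x)) => lx; [apply: clos_op => //; apply: clos_in|apply: HX].
apply/HY; split=> [|x]; first exact: clos_op.
case: (boolP (low x)) => lx; first by apply: clos_op => //; apply: clos_op.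
have [b [z [c [w [d ->]]]]] := Hc x y v lx ly.
by rewrite !memvD ?memvZ //; apply: clos_op.
Qed.

End Generated.

Arguments spanv {k V} X.
Arguments clos {k V I} op S X.

(** * Eigenvectors *)

Section Eigen.
Variables (k : fieldType) (V : vectType k) (I : Type) (h : I -> 'End(V)).
Hypothesis hC : forall i j v, h i (h j v) = h j (h i v).
Implicit Types (r : seq (I * k)) (u v x : V).

(** The product over [r] of the operators [h i - b]; the order is immaterial since the [h i]
    commute. *)
Definition kill r x := foldr (fun ib w => h ib.1 w - ib.2 *: w) x r.

Lemma kill_linear r a u v : kill r (a *: u + v) = a *: kill r u + kill r v.
Proof.
elim: r => //= ib r ->.
by rewrite linearP scalerDr scalerBr !scalerA [ib.2 * a]mulrC opprD addrACA.
Qed.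

Lemma kill0 r : kill r 0 = 0.
Proof. by elim: r => //= ib r ->; rewrite linear0 scaler0 subr0. Qed.

Lemma kill_cat r1 r2 x : kill (r1 ++ r2) x = kill r1 (kill r2 x).
Proof. by rewrite /kill foldr_cat. Qed.

Lemma kill_op r i x : kill r (h i x) = h i (kill r x).
Proof. by elim: r => //= ib r ->; rewrite [RHS]linearB [in RHS]linearZ hC. Qed.

Lemma kill_comm r1 r2 x : kill r1 (kill r2 x) = kill r2 (kill r1 x).
Proof.
elim: r1 => //= ib r1 ->.
by rewrite -!scaleNr addrC [X in _ = kill r2 X]addrC kill_linear kill_op.
Qed.

Lemma kill_eigen r (nu : I -> k) x : (forall i, h i x = nu i *: x) ->
  kill r x = (\prod_(ib <- r) (nu ib.1 - ib.2)) *: x.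
Proof.
move=> hx; elim: r => [|ib r IHr] /=; first by rewrite big_nil scale1r.
by rewrite IHr big_cons [h _ _]linearZ /= hx !scalerA -scalerBl; congr (_ *: _); ring.
Qed.

(** A product of factors [h i - b] with [b != nu i] kills the given element of the span, while it
    multiplies [x] by a nonzero scalar. *)
Lemma eigen_indep (nu : I -> k) x : (forall i, h i x = nu i *: x) ->
    x \in spanv (fun v => exists i b, b != nu i /\ h i v = b *: v) ->
  x = 0.
Proof.
move=> hx; pose P v := exists2 r, all (fun ib => ib.2 != nu ib.1) r & kill r v = 0.
suff H : forall v, v \in spanv (fun v => exists i b, b != nu i /\ h i v = b *: v) -> P v.
  move=> /H [r rnu]; rewrite (kill_eigen _ hx) => /eqP; rewrite scaler_eq0.
  case/orP => /eqP // /eqP E; exfalso; move: E; apply/negP.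
  elim: r rnu => [_|ib r IHr /= /andP [nib rnu]]; first by rewrite big_nil oner_eq0.
  by rewrite big_cons mulf_neq0 ?IHr // subr_eq0 eq_sym.
apply: spanv_ind => [|a u v [r rn ru] [s sn sv]|v [i [b [bn hv]]]].
- by exists [::].
- exists (r ++ s); first by rewrite all_cat rn.
  by rewrite kill_linear !kill_cat sv kill0 kill_comm ru kill0 scaler0 addr0.
- by exists [:: (i, b)]; rewrite /= ?bn //= hv subrr.
Qed.

End Eigen.

Section Diag.
Variables (k : fieldType) (V : vectType k).

Lemma diag_spanv (h : 'End(V)) (r : seq k) (U : {vspace V}) u :
    uniq r -> (forall v, v \in U -> h v \in U) -> u \in U ->
    kill (fun=> h) [seq (tt, b) | b <- r] u = 0 ->
  u \in spanv (fun v => v \in U /\ exists2 b, b \in r & h v = b *: v).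
Proof.
move=> ur hU; elim: r ur u => [_ u uU /= ->|b r IHr /= /andP [br ur] u uU]; first exact: mem0v.
rewrite -[LHS]/(kill _ [:: (tt, b)] _) kill_comm //=.
set w := h u - b *: u => /IHr -/(_ ur) wE.
have {}wE : w \in spanv (fun v => v \in U /\ exists2 b, b \in r & h v = b *: v).
  by apply: wE; rewrite memvB ?memvZ ?hU.
set E := spanv _ in wE.
(* The eigenvalues on [E] lie in [r] and differ from [b], so [w] can be divided by [h - b] inside
   [E]; the quotient [w'] differs from [u] by an eigenvector for [b]. *)
have /subvP ES : (E <= (h - b *: \1%VF) @: E)%VS.
  apply: spanv_sub => v [vU [c cr hv]].
  have cb : c - b != 0 by rewrite subr_eq0; apply: contraNneq br => <-.
  apply/memv_imgP; exists ((c - b)^-1 *: v).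
    by rewrite memvZ //; apply: spanv_in; split=> //; exists c.
  rewrite !(add_lfunE, opp_lfunE, scale_lfunE, id_lfunE) lfunZ hv.
  by rewrite !scalerA -scalerBl [b * _]mulrC -mulrBr mulVf ?scale1r.
have /memv_imgP [w' w'E ww'] := ES _ wE.
have w'U : w' \in U by apply: (subvP (spanv_sub _) _ w'E) => v [].
have -> : u = (u - w') + w' by rewrite subrK.
apply: memvD; last first.
  apply: (subvP (spanvS _) _ w'E) => v [vU [c cr hv]]; split=> //; exists c => //.
  by rewrite inE cr orbT.
apply: spanv_in; split; first by rewrite memvB.
exists b; first by rewrite inE eqxx.
have Eu : h u = h w' - b *: w' + b *: u.
  move: ww'; rewrite /w !(add_lfunE, opp_lfunE, scale_lfunE, id_lfunE) => <-.
  by rewrite subrK.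
rewrite lfunB Eu scalerBr addrAC [X in X + _]addrAC subrr add0r.
by rewrite addrC.
Qed.

(** Coordinates on a complement of [U] vanish on [U] and separate what is left. Algebraicity of a
    representation is given through matrix coefficients only, so membership has to be tested on
    functionals. *)
Lemma mem_functional (U : {vspace V}) v :
  (forall phi : {linear V -> k^o}, (forall u, u \in U -> phi u = 0) -> phi v = 0) -> v \in U.
Proof.
move=> H; pose w := v - projv U v.
have wC : w \in (U^C)%VS by apply: memv_projC.
suff w0 : w = 0 by move/eqP: w0; rewrite subr_eq0 => /eqP ->; apply: memv_proj.
rewrite (coord_vbasis wC) big1 // => i _.
pose phi := coord (vbasis (U^C)%VS) i \o (\1%VF - projv U).
have phi_linear : linear (phi : V -> k^o).
  by move=> a x y; rewrite /phi /= !linearP.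
pose Phi : {linear V -> k^o} := HB.pack (phi : V -> k^o) (GRing.isLinear.Build _ _ _ _ _ phi_linear).
have := H Phi; rewrite /= /phi /= => E.
rewrite /w; move: E; rewrite !(add_lfunE, opp_lfunE, id_lfunE) => ->; first by rewrite scale0r.
by move=> u uU; rewrite !(add_lfunE, opp_lfunE, id_lfunE) projv_id // subrr linear0.
Qed.

Lemma eq_functional (u v : V) : (forall phi : {linear V -> k^o}, phi u = phi v) -> u = v.
Proof.
move=> H; apply/eqP; rewrite -subr_eq0 -memv0; apply: mem_functional => phi _.
by rewrite linearB H subrr.
Qed.

End Diag.

(** * Integers and polynomials in characteristic zero *)

Section CharZero.
Variable k : fieldType.
Hypothesis hk : [pchar k] =i pred0.

Lemma natr_eq0_pchar0 d : (d%:R == 0 :> k) = (d == 0)%N.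
Proof. by have /pcharf0P := hk. Qed.

Lemma intr_eq0_pchar0 (d : int) : (d%:~R == 0 :> k) = (d == 0).
Proof.
by case: d => d; rewrite ?NegzE ?mulrNz ?oppr_eq0 -?pmulrn natr_eq0_pchar0.
Qed.

Lemma intr_inj_pchar0 : injective (fun d : int => d%:~R : k).
Proof. by move=> c d /eqP; rewrite -subr_eq0 -rmorphB /= intr_eq0_pchar0 subr_eq0 => /eqP. Qed.

(** The points 1, 2, 3, ... are distinct and nonzero, too many for a nonzero polynomial. The point 0
    is excluded with a view to torus parameters. *)
Lemma poly_eq0_pchar0 (p : {poly k}) : (forall t, t != 0 -> p.[t] = 0) -> p = 0.
Proof.
move=> H; apply/eqP/negPn/negP => p0.
pose rs : seq k := [seq i.+1%:R | i <- iota 0 (size p)].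
have : (size rs < size p)%N; last by rewrite size_map size_iota ltnn.
apply: max_poly_roots p0 _ _.
  apply/allP => _ /mapP [i _ ->]; rewrite /root H //.
  by rewrite natr_eq0_pchar0.
rewrite map_inj_uniq ?iota_uniq // => i j; rewrite !pmulrn => /intr_inj_pchar0 [].
by [].
Qed.

Lemma poly_eq_pchar0 (p q : {poly k}) : (forall t, t != 0 -> p.[t] = q.[t]) -> p = q.
Proof.
move=> H; apply/eqP; rewrite -subr_eq0; apply/eqP/poly_eq0_pchar0 => t t0.
by rewrite hornerD hornerN H ?subrr.
Qed.

End CharZero.

(** * Complete reducibility *)

(* V is a representation of the block diagonal subalgebra of gl(N) defined by  *)
(* blk, with diagonal torus acting semisimply with bounded integral weights.   *)
Section Reductive.
Variables (k : fieldType) (V : vectType k) (N : nat) (blk : 'I_N -> bool).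
Variable e : 'I_N -> 'I_N -> 'End(V).
Hypothesis hk : [pchar k] =i pred0.

Local Notation ev i j := (blk i == blk j).

Hypothesis eC : forall i j p q v, ev i j -> ev p q ->
  e i j (e p q v) = e p q (e i j v) + (j == p)%:R *: e i q v - (q == i)%:R *: e p j v.

Variable B : int.
Hypothesis eD : forall i (U : {vspace V}) u,
  (forall v, v \in U -> e i i v \in U) -> u \in U ->
  u \in spanv (fun v => v \in U /\ exists2 d : int, `|d| <= B & e i i v = d%:~R *: v).

Implicit Types (U S W : {vspace V}) (l : 'I_N -> int).

Definition is_wt l v := forall i, e i i v = (l i)%:~R *: v.
Definition estable U := forall i j v, ev i j -> v \in U -> e i j v \in U.
Definition tstable U := forall i v, v \in U -> e i i v \in U.

Lemma estable_tstable U : estable U -> tstable U.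
Proof. by move=> eU i v; apply: eU. Qed.

Lemma torusC i j v : e i i (e j j v) = e j j (e i i v).
Proof.
rewrite eC // [j == i]eq_sym; case: eqP => [->|_]; last by rewrite !scale0r addr0 subr0.
by rewrite !scale1r addrK.
Qed.

Definition shift l i j : 'I_N -> int := fun p => l p + ((p == i)%:R - (p == j)%:R).

Lemma is_wt_e l v i j : ev i j -> is_wt l v -> is_wt (shift l i j) (e i j v).
Proof.
move=> ij lv p; rewrite eC // lv lfunZ /shift !(rmorphD, rmorphN, rmorph_nat) /= !scalerDl.
rewrite -addrA; congr (_ + _); rewrite scaleNr; congr (_ - _).
  by case: eqP => [->|]; rewrite ?scale0r.
by rewrite eq_sym; case: eqP => [->|]; rewrite ?scale0r.
Qed.

Lemma is_wt_eq l l' v : l =1 l' -> is_wt l v -> is_wt l' v.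
Proof. by move=> ll lv i; rewrite lv ll. Qed.

Lemma is_wtZ l a v : is_wt l v -> is_wt l (a *: v).
Proof. by move=> lv i; rewrite lfunZ lv !scalerA mulrC. Qed.

Lemma is_wtB l u v : is_wt l u -> is_wt l v -> is_wt l (u - v).
Proof. by move=> lu lv i; rewrite lfunB lu lv scalerBr. Qed.

Lemma wt_indep l x : is_wt l x ->
    x \in spanv (fun v => exists l', (exists i, l' i != l i) /\ is_wt l' v) ->
  x = 0.
Proof.
move=> lx xS; apply: (eigen_indep torusC lx).
apply: (subvP (spanvS _) _ xS) => v [l' [[i li] lv]]; exists i, (l' i)%:~R.
by split; rewrite // (inj_eq (intr_inj_pchar0 hk)).
Qed.

Lemma wt_bound l v i : is_wt l v -> v != 0 -> `|l i| <= B.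
Proof.
move=> lv v0; rewrite leNgt; apply/negP => ltB; case/eqP: v0.
apply: (@eigen_indep _ _ unit (fun=> e i i) _ (fun=> (l i)%:~R)) => //.
have := @eD i fullv v (fun v _ => memvf _) (memvf _); apply: subvP; apply: spanvS.
move=> w [_ [d dB dw]]; exists tt, d%:~R; split=> //.
by rewrite (inj_eq (intr_inj_pchar0 hk)); apply: contraTneq dB => ->; rewrite -ltNge.
Qed.

Lemma wt_span U u : tstable U -> u \in U ->
  u \in spanv (fun v => v \in U /\ exists l, is_wt l v).
Proof.
move=> tU uU.
(* Simultaneous diagonalisation, one torus element at a time: the vectors with prescribed
   eigenvalues along [s] form a space [Y] stable under the next [e i i], to which [eD] applies. *)
suff H : forall s : seq 'I_N, u \in spanv (fun v => v \in U /\
    exists l, forall i, i \in s -> e i i v = (l i)%:~R *: v).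
  apply: (subvP (spanvS _) _ (H (enum 'I_N))) => v [vU [l lv]]; split=> //.
  by exists l => i; apply: lv; rewrite mem_enum.
elim=> [|i s IHs]; first by apply: spanv_in; split=> //; exists (fun=> 0).
apply: (subvP (spanv_sub _) _ IHs) => v [vU [l lv]].
have [Y HY] : exists Y : {vspace V}, forall w, w \in Y <->
    w \in U /\ forall j, j \in s -> e j j w = (l j)%:~R *: w.
  apply: vspace_of_pred => [|a x y [xU lx] [yU ly]].
    by split=> [|j _]; rewrite ?mem0v // lfun0 scaler0.
  split=> [|j js]; first by rewrite memvD ?memvZ.
  by rewrite lfunD lfunZ lx // ly // scalerDr !scalerA mulrC.
have : v \in spanv (fun w => w \in Y /\ exists2 d : int, `|d| <= B & e i i w = d%:~R *: w).
  apply: eD; last by apply/HY.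
  move=> w /HY [wU lw]; apply/HY; split=> [|j js]; first exact: tU.
  by rewrite torusC lw // lfunZ.
apply: subvP; apply: spanvS => w [/HY [wU lw] [d _ dw]]; split=> //.
exists (fun j => if j == i then d else l j) => j; rewrite inE.
by case: eqP => [->|_] //=; apply: lw.
Qed.

Definition dom l := forall i j : 'I_N, (i < j)%N -> ev i j -> l j <= l i.

Definition posroots (s : seq ('I_N * 'I_N)) :=
  all (fun p : 'I_N * 'I_N => (p.1 < p.2)%N && ev p.1 p.2) s.

Definition rootsum (s : seq ('I_N * 'I_N)) (i : 'I_N) : int :=
  \sum_(p <- s) ((i == p.1)%:R - (i == p.2)%:R).

(** The sum of the positive roots of the block diagonal algebra, twice the Weyl vector. *)
Definition two_rho (i : 'I_N) : int := \sum_(j | ev i j) ((i < j)%N%:R - (j < i)%N%:R).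

(** The pairing of [l] with [l + two_rho], which is the Casimir eigenvalue attached to the highest
    weight [l]. *)
Definition cas l : int := \sum_i l i * (l i + two_rho i).

Lemma two_rho_lt (i j : 'I_N) : (i < j)%N -> ev i j -> two_rho j < two_rho i.
Proof.
move=> ij eij; rewrite /two_rho -subr_gt0.
rewrite [X in _ - X](eq_bigl (fun q => ev i q)) => [|q]; last by rewrite (eqP eij).
rewrite -sumrB (bigD1 j) //= ltr_pwDl //; first by rewrite ij !ltnn; lia.
apply: sumr_ge0 => q _; lia.
Qed.

(** The difference is the pairing of [l - l'], a nonempty sum of positive roots, with
    [nu = l + l' + two_rho], which is strictly dominant. *)
Lemma cas_lt l l' s : dom l -> dom l' -> posroots s -> s != [::] ->
  (forall i, l i = l' i + rootsum s i) -> cas l' < cas l.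
Proof.
move=> dl dl' ps s0 ll; rewrite -subr_gt0 /cas -sumrB.
pose nu i := l i + l' i + two_rho i.
have -> : \sum_i (l i * (l i + two_rho i) - l' i * (l' i + two_rho i)) =
    \sum_(p <- s) (nu p.1 - nu p.2).
  transitivity (\sum_i \sum_(p <- s) ((i == p.1)%:R - (i == p.2)%:R) * nu i).
    apply: eq_bigr => i _; rewrite -mulr_suml -/(rootsum s i) /nu ll; ring.
  rewrite exchange_big /=; apply: eq_bigr => p _.
  under eq_bigr do rewrite mulrBl.
  rewrite sumrB; congr (_ - _).
    rewrite (bigD1 p.1) //= eqxx mul1r big1 ?addr0 // => i /negPf ->; by rewrite mul0r.
  rewrite (bigD1 p.2) //= eqxx mul1r big1 ?addr0 // => i /negPf ->; by rewrite mul0r.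
have H (p : 'I_N * 'I_N) : (p.1 < p.2)%N && ev p.1 p.2 -> 0 < nu p.1 - nu p.2.
  by case/andP => lt_p ev_p; have := dl _ _ lt_p ev_p; have := dl' _ _ lt_p ev_p;
    have := two_rho_lt lt_p ev_p; rewrite /nu; lia.
case: s s0 ps {ll} => // p s _ /= /andP [/H pp ps].
rewrite big_cons ltr_pwDl //; elim: s ps => [|q s IHs] /=; first by rewrite big_nil.
by case/andP=> /H /ltW qq /IHs; rewrite big_cons => ?; apply: addr_ge0.
Qed.

Definition Om : 'End(V) := \sum_i \sum_(j | ev i j) (e i j \o e j i)%VF.

Lemma OmE v : Om v = \sum_i \sum_(j | ev i j) e i j (e j i v).
Proof.
rewrite /Om sum_lfunE; apply: eq_bigr => i _; rewrite sum_lfunE.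
by apply: eq_bigr => j _; rewrite comp_lfunE.
Qed.

(** Commuting [e p q] past both factors of each [e i j (e j i v)] leaves four sums, which cancel in
    pairs: those in [A] after summation over [j], those in [D] after summation over [i]. *)
Lemma Om_comm p q v : ev p q -> Om (e p q v) = e p q (Om v).
Proof.
move=> pq; rewrite !OmE lfun_sum; under [RHS]eq_bigr do rewrite lfun_sum.
apply/eqP; rewrite eq_sym -subr_eq0 -sumrB; under eq_bigr do rewrite -sumrB.
pose A i j := (q == j)%:R *: e i j (e p i v) - (j == p)%:R *: e i q (e j i v).
pose D i j := (q == i)%:R *: e p j (e j i v) - (i == p)%:R *: e i j (e j q v).
have -> : \sum_i \sum_(j | ev i j) (e p q (e i j (e j i v)) - e i j (e j i (e p q v))) =
   \sum_i \sum_(j | ev i j) A i j + \sum_i \sum_(j | ev i j) D i j.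
  rewrite -big_split; apply: eq_bigr => i _; rewrite -big_split; apply: eq_bigr => j ij.
  rewrite eC // [e p q (e j i v)]eC // 1?eq_sym // lfunB lfunD !lfunZ /A /D.
  rewrite addrC -!addrA addKr [j == q]eq_sym /= -addrA; congr (_ + _).
  by rewrite addrCA [RHS]addrCA; congr (_ + _); rewrite addrC.
have -> : \sum_i \sum_(j | ev i j) A i j = 0.
  apply: big1 => i _; rewrite sumrB; apply/eqP; rewrite subr_eq0; apply/eqP.
  have [iq|niq] := boolP (ev i q); last first.
    rewrite !big1 // => j ij.
    by rewrite (_ : (j == p) = false) ?scale0r //; apply: contraNF niq => /eqP jp; rewrite -(eqP pq) -jp.
  by rewrite (_ : (q == j) = false) ?scale0r //; apply: contraNF niq => /eqP ->.
  rewrite (bigD1 q) //= eqxx [RHS](bigD1 p) /= ?(eqP pq) // eqxx !big1 // => j /andP [_ /negPf].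
    by move=> ->; rewrite scale0r.
  by rewrite eq_sym => ->; rewrite scale0r.
rewrite add0r (exchange_big_dep xpredT) //=; apply/eqP; apply: big1 => j _.
rewrite sumrB; apply/eqP; rewrite subr_eq0; apply/eqP.
have [jq|njq] := boolP (ev q j); last first.
  rewrite !big1 // => i ij.
    by rewrite (_ : (i == p) = false) ?scale0r //; apply: contraNF njq => /eqP ip; rewrite -(eqP pq) -ip.
  by rewrite (_ : (q == i) = false) ?scale0r //; apply: contraNF njq => /eqP ->.
rewrite (bigD1 q) //= eqxx [RHS](bigD1 p) /= ?(eqP pq) // eqxx !big1 // => i /andP [_ /negPf].
  by move=> ->; rewrite scale0r.
by rewrite eq_sym => ->; rewrite scale0r.
Qed.

(** A highest weight vector of the quotient by [S], represented by a true weight vector of [V]; no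
    quotient has to be formed. *)
Definition hwmod S l v :=
  is_wt l v /\ forall i j : 'I_N, (i < j)%N -> ev i j -> e i j v \in S.

(** Modulo [S], the term [e i j (e j i v)] is [l i * l i] times [v] for [i = j], [l i - l j] times
    [v] for [i < j] after one commutation, and zero for [i > j]; these are the scalars [c i j]. *)
Lemma Om_hw S l v : estable S -> hwmod S l v -> Om v - (cas l)%:~R *: v \in S.
Proof.
move=> eS [lv hv]; pose c i j := (i == j)%:R * (l i * l i) + (i < j)%N%:R * (l i - l j).
have -> : cas l = \sum_i \sum_(j | ev i j) c i j.
  rewrite /c; under [RHS]eq_bigr do rewrite big_split /=.
  rewrite big_split /= /cas; under [LHS]eq_bigr do rewrite mulrDr.
  rewrite big_split /=; congr (_ + _).
    apply: eq_bigr => i _; rewrite (bigD1 i) //= eqxx mul1r big1 ?addr0 // => j /andP [_].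
    by rewrite eq_sym => /negPf ->; rewrite mul0r.
  under [RHS]eq_bigr => i _ do (under eq_bigr do rewrite mulrBr; rewrite sumrB).
  rewrite sumrB [X in _ - X](exchange_big_dep xpredT) //= -sumrB; apply: eq_bigr => i _.
  rewrite /two_rho mulr_sumr [X in _ - X](eq_bigl (fun j => ev i j)) => [|j]; last by rewrite eq_sym.
  by rewrite -sumrB; apply: eq_bigr => j _; ring.
rewrite rmorph_sum OmE scaler_suml -sumrB; apply: rpred_sum => i _.
rewrite rmorph_sum scaler_suml -sumrB; apply: rpred_sum => j ij.
have ji : ev j i by rewrite eq_sym.
rewrite /c; have [lt_ij|lt_ji|eq_ij] := ltngtP i j.
- rewrite -val_eqE /= ltn_eqF // mul0r add0r mul1r eC // eqxx !lv.
  rewrite !eqxx !scale1r -[X in X - _]addrA -scalerBl -rmorphB /= addrK.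
  by apply: eS => //; apply: hv.
- rewrite -val_eqE /= gtn_eqF // !mul0r addr0 scale0r subr0.
  by apply: eS => //; apply: hv.
- have -> : i = j by apply: val_inj.
  rewrite eqxx mul1r mul0r addr0 !lv lfunZ lv scalerA rmorphM /= subrr.
  exact: mem0v.
Qed.

(** The sl_2 argument: with [w n] the n-fold lowering of [v], raising [w n.+1] gives
    [n.+1 * (l i - l j - n)] times [w n] modulo [S]. If [w q.+1] is the first of these vectors in
    [S], the scalar for [q] vanishes and [l i - l j = q]. *)
Lemma hw_dom S l v : estable S -> v \notin S -> hwmod S l v -> dom l.
Proof.
move=> eS vS [lv hv] i j lt_ij eij; have eji : ev j i by rewrite eq_sym.
pose w n := iter n (e j i) v.
have lw n : is_wt (fun p => l p + n%:R * ((p == j)%:R - (p == i)%:R)) (w n).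
  elim: n => [|n IHn]; first by apply: is_wt_eq lv => p; ring.
  by apply: is_wt_eq (is_wt_e eji IHn) => p; rewrite /shift -[n.+1]addn1 natrD; ring.
have ij : (i == j) = false by apply/negbTE; rewrite neq_ltn lt_ij.
have sl2 y l' : is_wt l' y -> e i j (e j i y) = e j i (e i j y) + (l' i - l' j)%:~R *: y.
  by move=> ly; rewrite eC // !eqxx !scale1r !ly -addrA -scalerBl -rmorphB.
have e_w n : e i j (w n.+1) - (n.+1%:R * (l i - l j - n%:R))%:~R *: w n \in S.
  elim: n => [|n IHn].
    by rewrite [w 1%N]/= (sl2 _ _ lv) mul1r subr0 addrK eS // hv.
  rewrite -[w n.+2]/(e j i (w n.+1)) (sl2 _ _ (lw n.+1)) -addrA -scalerBl -rmorphB /=.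
  rewrite eqxx ij [j == i]eq_sym ij; set c := (X in _ + X%:~R *: _).
  have -> : c = - (n.+1%:R * (l i - l j - n%:R)).
    by rewrite /c /= eqxx /= -[n.+2]addn1 -[n.+1]addn1 !natrD; ring.
  by rewrite rmorphN scaleNr -lfunZ -lfunB eS.
(* For this [n] the weight at [i] is below [- |B|], so [wt_bound] forces [w n] to vanish. *)
have [n wn] : exists n, w n \in S.
  exists (`|l i| + `|B|).+1%N; case: (eqVneq (w (`|l i| + `|B|).+1%N) 0) => [->|].
    exact: mem0v.
  move=> /(wt_bound i (lw _)); rewrite eqxx ij /=; lia.
have := ex_minnP (ex_intro (fun n => w n \in S) n wn) => -[[|q] wq minq].
  by case/negP: vS.
have := e_w q; rewrite -memvN opprB => /(fun H => memvD H (eS i j _ eij wq)); rewrite subrK.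
have nwq : w q \notin S by apply/negP => /minq; rewrite ltnn.
move=> wS; have c0 : (q.+1%:R * (l i - l j - q%:R))%:~R = 0 :> k.
  apply/eqP/negPn/negP => c0; case/negP: nwq.
  by rewrite -[w q]scale1r -(mulVf c0) -scalerA memvZ.
by have /eqP := c0; rewrite (intr_eq0_pchar0 hk) mulf_eq0 => /orP [|/eqP]; lia.
Qed.

(** Raising a weight vector of [U] while the result stays outside [S] must stop: the coefficients
    [N - i] of [ht] decrease, so every raising increases [ht], and bounded weights keep it below
    [C]. *)
Lemma exists_hw S U : estable S -> estable U -> ~~ (U <= S)%VS ->
  exists v l, [/\ v \in U, v \notin S & hwmod S l v].
Proof.
move=> eS eU nUS; pose ht l : int := \sum_(i < N) (N - i)%N%:R * l i.
pose C : int := \sum_(i < N) (N - i)%N%:R * B.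
suff H : forall d u l, (C - ht l < d%:Z) -> u \in U -> u \notin S -> is_wt l u ->
    exists v l, [/\ v \in U, v \notin S & hwmod S l v].
  case: (classic (exists u l, [/\ u \in U, u \notin S & is_wt l u])).
    by move=> [u [l [uU uS lu]]]; apply: (H (absz (C - ht l)).+1 u l) => //; lia.
  move=> nex; case/negP: nUS; apply/subvP => u uU.
  have := wt_span (estable_tstable eU) uU; apply: subvP; apply: spanv_sub => v [vU [l lv]].
  by apply/negPn/negP => vS; apply: nex; exists v, l.
elim=> [|d IHd] u l dl uU uS lu.
  suff : ht l <= C by lia.
  have u0 : u != 0 by apply: contraNneq uS => ->; apply: mem0v.
  apply: ler_sum => i _; apply: ler_wpM2l; first exact: ler0n.
  by have := wt_bound i lu u0; lia.
case: (classic (hwmod S l u)) => [hu|nhu]; first by exists u, l.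
case: (classic (exists i j : 'I_N, [/\ (i < j)%N, ev i j & e i j u \notin S])); last first.
  move=> nex; case: nhu; split=> // i j ij eij; apply/negPn/negP => eS'.
  by apply: nex; exists i, j.
move=> [i [j [ij eij nS]]]; apply: (IHd (e i j u) (shift l i j)) => //; last 2 first.
- exact: eU.
- exact: is_wt_e.
have -> : ht (shift l i j) = ht l + ((N - i)%N%:R - (N - j)%N%:R).
  rewrite /ht /shift; under eq_bigr do rewrite mulrDr mulrBr.
  rewrite big_split sumrB /=; congr (_ + (_ - _)).
    by rewrite (bigD1 i) //= eqxx mulr1 big1 ?addr0 // => p /negPf ->; rewrite mulr0.
  by rewrite (bigD1 j) //= eqxx mulr1 big1 ?addr0 // => p /negPf ->; rewrite mulr0.
by have := ltn_ord i; have := ltn_ord j; lia.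
Qed.

(** Extended by zero to pairs in different blocks, so that [clos] can be indexed by all pairs. *)
Definition rootop (p : 'I_N * 'I_N) : 'End(V) := if ev p.1 p.2 then e p.1 p.2 else 0.
Definition lowroot (p : 'I_N * 'I_N) := ev p.1 p.2 && (p.2 < p.1)%N.
Definition hwgen (X : V -> Prop) : {vspace V} := clos rootop lowroot X.

Definition hwset (X : V -> Prop) := forall v, X v -> exists l, hwmod 0 l v.

(** Raising operators kill the generators and the torus rescales them, so [clos_low_stable] applies.
    Closing under lowering operators alone is what keeps the weights under control in [hwgen_wt]. *)
Lemma hwgen_estable (X : V -> Prop) : hwset X -> estable (hwgen X).
Proof.
move=> hX i j v eij vX.
have -> : e i j v = rootop (i, j) v by rewrite /rootop /= eij.
apply: (@clos_low_stable _ _ _ rootop lowroot X) => // [[p q] x|[p q] [a b] x]; rewrite /lowroot /rootop /=.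
  case: ifP => /= epq; last by rewrite zero_lfunE mem0v.
  rewrite -leqNgt leq_eqVlt => /orP [/eqP pq|pq] Xx; have [l [lx hx]] := hX x Xx; last first.
    by have := hx p q pq epq; rewrite memv0 => /eqP ->; rewrite mem0v.
  by rewrite (val_inj pq : p = q) lx memvZ //; apply: clos_in.
move=> _ /andP [eab _]; rewrite eab; case: ifP => epq; last first.
  by exists 0, (a, b), 0, (a, b), 0; rewrite !zero_lfunE !scale0r !addr0.
exists 1, (p, b), (q == a)%:R, (a, q), (- (b == p)%:R); rewrite /= scale1r eC // scaleNr.
congr (_ + _ - _).
  by case: eqP => [qa|]; rewrite ?scale0r // (eqP epq) qa eab.
by case: eqP => [bp|]; rewrite ?scale0r // (eqP eab) bp epq.
Qed.

Lemma hwgen_sub (X : V -> Prop) U : estable U -> contains X U -> (hwgen X <= U)%VS.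
Proof.
move=> eU XU; apply: clos_sub => // -[i j] /andP [eij _] v vU.
by rewrite /rootop eij; apply: eU.
Qed.

Definition lower_wt (X : V -> Prop) v := exists l l' s,
  [/\ exists2 x, X x & x != 0 /\ hwmod 0 l x, posroots s /\ s != [::],
      forall i, l i = l' i + rootsum s i & is_wt l' v].

Lemma hwgen_wt (X : V -> Prop) : hwset X -> (hwgen X <= spanv X + spanv (lower_wt X))%VS.
Proof.
move=> hX; set D := lower_wt X.
apply: clos_sub => [x Xx|[i j] /andP [/= eij lij] v].
  by apply: (subvP (addvSl _ _)); apply: spanv_in.
have pij s : posroots s -> posroots ((j, i) :: s) by move=> /= ->; rewrite lij eq_sym eij.
move=> /memv_addP [x xX [y yD ->]]; rewrite lfunD /rootop eij.
apply: (subvP (addvSr _ _)); apply: memvD.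
  move: x xX; apply: spanv_img => x Xx; have [->|x0] := eqVneq x 0; first by rewrite lfun0 mem0v.
  apply: spanv_in; have [l hl] := hX x Xx.
  exists l, (shift l i j), [:: (j, i)]; split; first by exists x.
  - by split=> //; apply: pij.
  - by move=> p; rewrite /rootsum big_seq1 /shift /=; ring.
  - by apply: is_wt_e => //; case: hl.
move: y yD; apply: spanv_img => y [l [l' [s [Hx [ps s0] ll ly]]]].
apply: spanv_in; exists l, (shift l' i j), ((j, i) :: s); split=> //.
- by split=> //; apply: pij.
- by move=> p; rewrite ll /rootsum big_cons /shift /=; ring.
- exact: is_wt_e.
Qed.

Lemma Om_hw0 l v : hwmod 0 l v -> Om v = (cas l)%:~R *: v.
Proof.
move=> hv; have e0 : estable 0 by move=> i j x _; rewrite memv0 => /eqP ->; rewrite lfun0 mem0v.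
by have := Om_hw e0 hv; rewrite memv0 subr_eq0 => /eqP.
Qed.

Lemma estable0 : estable 0.
Proof. by move=> i j x _; rewrite memv0 => /eqP ->; rewrite lfun0 mem0v. Qed.

Lemma estableD U W : estable U -> estable W -> estable (U + W)%VS.
Proof.
move=> eU eW i j v ij /memv_addP [x xU [y yW ->]].
by rewrite lfunD memv_add ?eU ?eW.
Qed.

Lemma estableI U W : estable U -> estable W -> estable (U :&: W)%VS.
Proof. by move=> eU eW i j v ij; rewrite !memv_cap => /andP [? ?]; rewrite eU ?eW. Qed.

Lemma Om_stable U v : estable U -> v \in U -> Om v \in U.
Proof.
move=> eU vU; rewrite OmE; apply: rpred_sum => i _; apply: rpred_sum => j ij.
by apply: (eU i j) => //; apply: (eU j i) => //; rewrite eq_sym.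
Qed.

Lemma wt_neq l l' : ~ (l =1 l') -> exists i, l i != l' i.
Proof. by move=> /not_all_ex_not [i /eqP li]; exists i. Qed.

(** The Casimir values of all weights with entries between [- |B|] and [|B|]: a finite list covering
    every weight of [V]. *)
Definition casvals : seq int :=
  [seq cas (fun i => (f i)%:Z - `|B|) | f : {ffun 'I_N -> 'I_(`|B| + `|B|).+1}].

Lemma casvals_mem l v : is_wt l v -> v != 0 -> cas l \in casvals.
Proof.
move=> lv v0; apply/mapP.
exists [ffun i => inord (absz (l i + `|B|))]; first by rewrite mem_enum.
apply: eq_bigr => i _; rewrite ffunE; have := wt_bound i lv v0 => lB.
by rewrite inordK; [have -> : (absz (l i + `|B|))%:Z - `|B| = l i by lia|lia].
Qed.

(** An unnormalised Casimir projection: it kills the eigenvectors whose value is in [casvals] and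
    differs from [c], and multiplies those of value [c] by a nonzero scalar. *)
Definition casproj c v := kill (fun=> Om) [seq (tt, d%:~R) | d <- casvals & d != c] v.

Lemma casproj_e c i j v : ev i j -> casproj c (e i j v) = e i j (casproj c v).
Proof.
move=> ij; rewrite /casproj; elim: [seq _ | _ <- _] => //= d s ->.
by rewrite Om_comm // lfunB lfunZ.
Qed.

Lemma casproj_eigen c d v : Om v = d%:~R *: v -> casproj c v =
  (\prod_(a <- casvals | a != c) (d%:~R - a%:~R)) *: v.
Proof.
move=> Ov; rewrite /casproj (@kill_eigen _ _ _ _ _ (fun=> d%:~R)) //.
by rewrite big_map big_filter.
Qed.

Lemma casproj_stable c U v : estable U -> v \in U -> casproj c v \in U.
Proof.
move=> eU vU; rewrite /casproj; elim: [seq _ | _ <- _] => //= d s IHs.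
by rewrite memvB ?memvZ // Om_stable.
Qed.

(* A submodule containing all highest weight vectors of U contains U: otherwise*)
(* U has a highest weight vector u modulo the submodule G generated by its     *)
(* highest weight vectors, and the projection of u to an eigenspace of the     *)
(* Casimir operator is a true highest weight vector, as no weight of a         *)
(* submodule of G with the same Casimir value is higher than that of u.        *)
Lemma hw_generate U S : estable U -> estable S ->
  (forall l v, v \in U -> hwmod 0 l v -> v \in S) -> (U <= S)%VS.
Proof.
move=> eU eS HS; pose hwU v := v \in U /\ exists l, hwmod 0 l v.
have hhw : hwset hwU by move=> v [].
have eG := hwgen_estable hhw.
have GS : (hwgen hwU <= S)%VS by apply: hwgen_sub => // v [vU [l hv]]; apply: HS hv.
suff UG : (U <= hwgen hwU)%VS by apply: subv_trans GS.
apply/negPn/negP => /(exists_hw eG eU) [u [l [uU uG hu]]].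
have dl := hw_dom eG uG hu; have [lu nu] := hu.
(* The highest weight vectors of [U] are sorted by whether they share the Casimir value of [l]; the
   projection kills what the others generate. *)
pose XA v := v \in U /\ exists2 m, hwmod 0 m v & cas m = cas l.
pose XB v := v \in U /\ exists2 m, hwmod 0 m v & cas m != cas l.
have hA : hwset XA by move=> v [vU [m hm _]]; exists m.
have hB : hwset XB by move=> v [vU [m hm _]]; exists m.
have eA := hwgen_estable hA; have eB := hwgen_estable hB.
have /subvP GAB : (hwgen hwU <= hwgen XA + hwgen XB)%VS.
  apply: hwgen_sub => [|v [vU [m hm]]]; first exact: estableD.
  have [cm|cm] := eqVneq (cas m) (cas l).
    by apply: (subvP (addvSl _ _)); apply: clos_in; split=> //; exists m.
  by apply: (subvP (addvSr _ _)); apply: clos_in; split=> //; exists m.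
have kB v : v \in hwgen XB -> casproj (cas l) v = 0.
  have [Y HY] : exists Y : {vspace V}, forall v, v \in Y <-> casproj (cas l) v = 0.
    apply: vspace_of_pred => [|a x y]; first exact: kill0.
    by rewrite /casproj kill_linear => -> ->; rewrite scaler0 addr0.
  move=> vB; apply/HY; move: v vB; apply/subvP; apply: hwgen_sub.
    by move=> i j x ij /HY x0; apply/HY; rewrite casproj_e // x0 lfun0.
  move=> x [_ [m hm cm]]; apply/HY; have [->|x0] := eqVneq x 0; first exact: kill0.
  rewrite (casproj_eigen _ (Om_hw0 hm)).
  rewrite (big_rem (cas m)) /= ?cm ?subrr ?mul0r ?scale0r //.
  by have [lx _] := hm; apply: casvals_mem lx x0.
(* The weights of [hwgen XA] are of the form [m] minus positive roots, with [cas m = cas l]. If one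
   of them were [l] plus a positive root, [cas_lt] would give [cas l < cas m]. *)
have kA v (i j : 'I_N) : v \in hwgen XA -> (i < j)%N -> ev i j -> is_wt (shift l i j) v -> v = 0.
  move=> vA ij eij lv; apply: (wt_indep lv).
  have := subvP (hwgen_wt hA) _ vA; apply: subvP; rewrite subv_add; apply/andP; split.
    apply: spanv_sub => x [xU [m hm cm]]; have [->|x0] := eqVneq x 0; first exact: mem0v.
    apply: spanv_in; exists m; split; last by case: hm.
    apply: wt_neq => ml; suff : cas l < cas m by rewrite cm ltxx.
    apply: (@cas_lt m l [:: (i, j)]) => //=; rewrite ?ij ?eij //.
      by apply: hw_dom estable0 _ hm; rewrite memv0.
    by move=> p; rewrite ml /shift /rootsum big_seq1.
  apply: spanvS => x [m [m' [s [[x0 [_ [m0 hm0 cm0]] [x0N hm]] [ps s0] mm lx]]]].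
  exists m'; split=> //; apply: wt_neq => ml.
  have cm : cas m = cas l.
    have : Om x0 = Om x0 by [].
    rewrite {1}(Om_hw0 hm) (Om_hw0 hm0) cm0 => /eqP; rewrite -subr_eq0 -scalerBl scaler_eq0.
    by rewrite (negPf x0N) orbF -rmorphB /= (intr_eq0_pchar0 hk) subr_eq0 => /eqP.
  suff : cas l < cas m by rewrite cm ltxx.
  apply: (@cas_lt m l ((i, j) :: s)) => //=; rewrite ?ij ?eij //.
    by apply: hw_dom estable0 _ hm; rewrite memv0.
  by move=> p; rewrite mm ml /shift /rootsum big_cons /=; ring.
set u' := casproj (cas l) u.
have lu' : is_wt l u' by move=> i; rewrite -casproj_e // lu /casproj -[_ *: u]addr0 kill_linear kill0 addr0.
have hu' : hwmod 0 l u'.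
  split=> // i j ij eij; rewrite memv0; apply/eqP.
  have /GAB /memv_addP [a aA [b bB eab]] := nu i j ij eij.
  have lw : is_wt (shift l i j) (e i j u') by apply: is_wt_e.
  apply: (kA _ i j) => //; rewrite -casproj_e // eab -[a]scale1r /casproj kill_linear.
  by rewrite -/(casproj _ b) kB // addr0 scale1r casproj_stable.
have u'G : u' \in hwgen hwU.
  by apply: clos_in; split; [apply: casproj_stable|exists l].
set c : k := \prod_(a <- casvals | a != cas l) ((cas l)%:~R - a%:~R).
(* Modulo [hwgen hwU] the Casimir operator acts on [u] by [cas l], so [u'] is congruent to [c *: u]
   with [c] nonzero; as [u'] lies in [hwgen hwU], so does [u], a contradiction. *)
have : u' - c *: u \in hwgen hwU.
  rewrite /u' /casproj /c -[X in X *: u](big_filter casvals (fun a => a != cas l)).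
  elim: [seq _ <- _ | _] => [|d s IHs] /=; first by rewrite big_nil scale1r subrr mem0v.
  rewrite big_cons; set y := kill _ _ _ in IHs *; set q := \prod_(_ <- s) _ in IHs *.
  have -> : Om y - d%:~R *: y - ((cas l)%:~R - d%:~R) * q *: u =
    Om (y - q *: u) - d%:~R *: (y - q *: u) + q *: (Om u - (cas l)%:~R *: u).
    rewrite lfunB lfunZ !scalerBr !scalerA mulrBl scalerBl [q * _]mulrC.
    rewrite !opprB [RHS]addrAC [X in _ = X + _]addrA subrK addrACA [RHS]addrACA.
    by congr (_ + _); rewrite addrC.
  by rewrite memvD ?memvB ?memvZ ?Om_stable ?Om_hw.
rewrite -memvN opprB => /(fun H => memvD H u'G); rewrite subrK => cuG.
case/negP: uG; have c0 : c != 0.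
  rewrite prodf_seq_neq0; apply/allP => d _; apply/implyP => dl'.
  by rewrite -rmorphB /= (intr_eq0_pchar0 hk) subr_eq0 eq_sym.
by rewrite -[u]scale1r -(mulVf c0) -scalerA memvZ.
Qed.

(** [X] contains a highest weight vector [x]. It shares the Casimir value of [w], so by [cas_lt] its
    weight cannot be strictly below [l]; it is then [l], and the [l]-weight space of the module
    generated by [w] is the line of [w]. *)
Lemma hwgen1_simple l w (X : {vspace V}) : hwmod 0 l w -> w != 0 -> estable X -> X != 0%VS ->
  (X <= hwgen (fun v => v = w))%VS -> w \in X.
Proof.
move=> hw w0 eX X0 XW; have hX : hwset (fun v => v = w) by move=> _ ->; exists l.
have dl : dom l by apply: hw_dom estable0 _ hw; rewrite memv0.
have [|x [m [xX x0 hm]]] := exists_hw estable0 eX; first by rewrite subv0.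
have dm := hw_dom estable0 x0 hm; move: x0; rewrite memv0 => x0.
have xW := subvP XW _ xX.
have cml : cas m = cas l.
  have : Om x = (cas l)%:~R *: x.
    have [Y HY] : exists Y : {vspace V}, forall v, v \in Y <-> Om v = (cas l)%:~R *: v.
      apply: vspace_of_pred => [|a p q Hp Hq]; first by rewrite lfun0 scaler0.
      by rewrite lfunD lfunZ Hp Hq scalerDr !scalerA mulrC.
    apply/HY; move: x xW {xX x0 hm}; apply/subvP; apply: hwgen_sub => [i j v ij /HY Ov|v ->].
      by apply/HY; rewrite Om_comm // Ov lfunZ.
    by apply/HY; apply: Om_hw0.
  rewrite (Om_hw0 hm) => /eqP; rewrite -subr_eq0 -scalerBl scaler_eq0 (negPf x0) orbF.
  by rewrite -rmorphB /= (intr_eq0_pchar0 hk) subr_eq0 => /eqP.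
have [lw _] := hw; have [mx _] := hm.
have /memv_addP [x1 x1w [y yD xE]] := subvP (hwgen_wt hX) _ xW.
have {x1w} /vlineP [a x1E] : x1 \in <[w]>%VS.
  by apply: (subvP (spanv_sub _) _ x1w) => _ ->; apply: memv_line.
have {}yD : y \in spanv (fun v => exists l', (exists i, l' i != m i) /\ is_wt l' v).
  apply: (subvP (spanvS _) _ yD) => v [l0 [l' [s [[_ -> [_ [l0w _]]] [ps s0] ll lv]]]].
  exists l'; split=> //; apply: wt_neq => lm.
  have l0l i : l0 i = l i.
    apply: (intr_inj_pchar0 hk); apply/eqP; rewrite -subr_eq0.
    have : e i i w = e i i w by []; rewrite {1}l0w lw => /eqP.
    by rewrite -subr_eq0 -scalerBl scaler_eq0 (negPf w0) orbF.
  suff : cas m < cas l by rewrite cml ltxx.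
  by apply: (@cas_lt l m s) => // i; rewrite -l0l ll lm.
have lm : l =1 m.
  apply: NNPP => nlm; case/eqP: x0; apply: (wt_indep mx); rewrite xE memvD //.
  by rewrite x1E memvZ //; apply: spanv_in; exists l; split=> //; apply: wt_neq.
have y0 : y = 0.
  apply: (@wt_indep m) => //; have -> : y = x - a *: w by rewrite xE x1E addrC addKr.
  by apply: is_wtB => //; apply/is_wtZ/(is_wt_eq lm).
have a0 : a != 0 by apply: contraNneq x0 => a0; rewrite xE x1E a0 scale0r y0 addr0.
by rewrite -[w]scale1r -(mulVf a0) -scalerA memvZ // -x1E -[x1]addr0 -y0 -xE.
Qed.

Lemma simple_submodule U : estable U -> U != 0%VS ->
  exists W l w, [/\ (W <= U)%VS, estable W, w \in W, w != 0 & hwmod 0 l w] /\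
    forall X, estable X -> (X <= W)%VS -> X = 0%VS \/ X = W.
Proof.
move=> eU U0; have [|w [l [wU w0 hw]]] := exists_hw estable0 eU; first by rewrite subv0.
rewrite memv0 in w0; have hX : hwset (fun v => v = w) by move=> _ ->; exists l.
have eW := hwgen_estable hX.
exists (hwgen (fun v => v = w)), l, w; split.
  split=> //; last exact: clos_in.
  by apply: hwgen_sub => // _ ->.
move=> X eX XW; have [->|X0] := eqVneq X 0%VS; [by left|right].
apply/eqP; rewrite eqEsubv XW; apply: hwgen_sub => // _ ->.
exact: hwgen1_simple hw w0 eX X0 XW.
Qed.

(** As long as [S + C] is not [U], [hw_generate] provides a highest weight vector of [U] outside
    [S + C]; the module it generates meets [S + C] in zero by [hwgen1_simple] and is added to
    [C]. *)
Lemma complement_exists S U : estable S -> estable U -> (S <= U)%VS ->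
  exists C, [/\ estable C, (S :&: C = 0)%VS & (S + C = U)%VS].
Proof.
move=> eS eU SU.
suff H : forall d C, (\dim U - \dim C <= d)%N -> estable C -> (C <= U)%VS ->
    (S :&: C = 0)%VS -> exists C', [/\ estable C', (S :&: C' = 0)%VS & (S + C' = U)%VS].
  by apply: (H _ 0%VS (leqnn _) estable0 (sub0v _)); rewrite capv0.
elim=> [|d IHd] C dC eC' CU SC0.
  exists C; split=> //; suff -> : C = U by apply/eqP; rewrite eqEsubv subv_add SU subvv addvSr.
  by apply/eqP; rewrite eqEdim CU -subn_eq0 -leqn0.
have [UE|nUE] := boolP (U <= S + C)%VS.
  by exists C; split=> //; apply/eqP; rewrite eqEsubv UE subv_add SU CU.
case: (classic (exists l w, [/\ w \in U, hwmod 0 l w & w \notin (S + C)%VS])); last first.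
  move=> nex; case/negP: nUE; apply: hw_generate => //; first exact: estableD.
  by move=> l v vU hv; apply/negPn/negP => nv; apply: nex; exists l, v.
move=> [l [w [wU hw wSC]]]; have hX : hwset (fun v => v = w) by move=> _ ->; exists l.
have w0 : w != 0 by apply: contraNneq wSC => ->; apply: mem0v.
set W := hwgen (fun v => v = w); have eW : estable W := hwgen_estable hX.
have wW : w \in W by apply: clos_in.
have WI : (W :&: (S + C) = 0)%VS.
  apply/eqP/negPn/negP => n0; case/negP: wSC.
  have := hwgen1_simple hw w0 (estableI eW (estableD eS eC')) n0 (capvSl _ _).
  by rewrite memv_cap => /andP [].
apply: (IHd (C + W)%VS).
- have : (\dim C < \dim (C + W))%N.
    rewrite (ltn_leqif (dimv_leqif_sup (addvSl C W))); apply: contra wSC => /subvP H.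
    by apply: (subvP (addvSr _ _)); apply: H; apply: (subvP (addvSr _ _)).
  by move: dC; lia.
- exact: estableD.
- by rewrite subv_add CU; apply: hwgen_sub => // _ ->.
apply/eqP; rewrite -subv0; apply/subvP => s; rewrite memv_cap => /andP [sS].
case/memv_addP => c cC [x xW sE].
have x0 : x = 0.
  apply/eqP; rewrite -memv0 -WI memv_cap xW /=.
  have -> : x = s - c by rewrite sE addrC addKr.
  by rewrite memv_add ?memvN.
by rewrite -SC0 memv_cap sS sE x0 addr0.
Qed.

End Reductive.

(** * One-parameter subgroups *)

Section Curve.
Variables (k : fieldType) (n : nat) (G : 'I_n -> {poly k}) (d : {poly k}).

(* Pullback of a polynomial function to the rational curve G / d, with its     *)
(* derivative at the points where d = 1. *)
Lemma mpoly_curve (P : {mpoly k[n]}) : exists (D : nat) (Q : {poly k}),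
  (forall t, d.[t] != 0 -> Q.[t] = d.[t] ^+ D * P.@[fun i => (G i).[t] / d.[t]]) /\
  (forall t, d.[t] = 1 -> Q^`().[t] = D%:R * d^`().[t] * Q.[t] +
     \sum_i ((G i)^`().[t] - d^`().[t] * (G i).[t]) * (P^`M(i)).@[fun i => (G i).[t]]).
Proof.
have E1 (R : {mpoly k[n]}) t : d.[t] = 1 ->
    R.@[fun i => (G i).[t] / d.[t]] = R.@[fun i => (G i).[t]].
  by move=> dt; apply: meval_eq => i; rewrite dt divr1.
(* Both properties hold for constants and variables and survive sums and products, where powers of
   [d] bring the terms to a common denominator. *)
pose ok P := exists (D : nat) (Q : {poly k}),
  (forall t, d.[t] != 0 -> Q.[t] = d.[t] ^+ D * P.@[fun i => (G i).[t] / d.[t]]) /\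
  (forall t, d.[t] = 1 -> Q^`().[t] = D%:R * d^`().[t] * Q.[t] +
     \sum_i ((G i)^`().[t] - d^`().[t] * (G i).[t]) * (P^`M(i)).@[fun i => (G i).[t]]).
rewrite -/(ok P).
have okC c : ok c%:MP.
  exists 0%N, c%:P; split=> [t _|t _]; first by rewrite hornerC mevalC mul1r.
  rewrite derivC hornerC !mul0r add0r big1 // => i _.
  by rewrite mderivC meval0 mulr0.
have okX i : ok 'X_i.
  exists 1%N, (G i); split=> [t dt|t dt]; first by rewrite mevalXU expr1 mulrC divfK.
  rewrite (bigD1 i) //= big1 ?addr0 => [|j ji].
    rewrite mderivX mnm1E eqxx scale1r mevalX big1 => [|j _].
      by rewrite mulr1 mul1r addrC subrK.
    by rewrite mnmBE subnn expr0.
  by rewrite mderivX mnm1E eq_sym (negPf ji) scale0r meval0 mulr0.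
have okD P1 P2 : ok P1 -> ok P2 -> ok (P1 + P2).
  move=> [D1 [Q1 [e1 f1]]] [D2 [Q2 [e2 f2]]].
  exists (D1 + D2)%N, (d ^+ D2 * Q1 + d ^+ D1 * Q2); split=> t dt.
    rewrite !hornerE e1 // e2 // mevalD exprD; ring.
  under eq_bigr do rewrite mderivD mevalD mulrDr.
  rewrite big_split /= derivD !derivM !deriv_exp.
  rewrite !(hornerD, hornerM, hornerMn, horner_exp) dt !expr1n f1 // f2 // natrD.
  by rewrite !mulr1 !mul1r -![d^`().[t] *+ _]mulr_natl; ring.
have okM P1 P2 : ok P1 -> ok P2 -> ok (P1 * P2).
  move=> [D1 [Q1 [e1 f1]]] [D2 [Q2 [e2 f2]]].
  exists (D1 + D2)%N, (Q1 * Q2); split=> t dt.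
    by rewrite !hornerE e1 // e2 // mevalM exprD; ring.
  under eq_bigr do rewrite mderivM mevalD !mevalM mulrDr mulrA [X in _ + X]mulrCA.
  have dt0 : d.[t] != 0 by rewrite dt oner_eq0.
  have v1 : P1.@[fun i => (G i).[t]] = Q1.[t].
    by rewrite e1 // E1 // dt expr1n mul1r.
  have v2 : P2.@[fun i => (G i).[t]] = Q2.[t].
    by rewrite e2 // E1 // dt expr1n mul1r.
  rewrite big_split /= -mulr_suml -mulr_sumr derivM !(hornerD, hornerM) f1 // f2 // natrD v1 v2.
  ring.
rewrite (mpolyE P); elim/big_ind: _ => [| |mm _].
- by have := okC 0; rewrite mpolyC0.
- exact: okD.
rewrite mpolyXE_id -mul_mpolyC; apply: (okM) => //.
elim/big_ind: _ => [| |i _]; [by have := okC 1; rewrite mpolyC1|exact: okM|].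
by elim: (mm i) => [|a IHa]; [have := okC 1; rewrite mpolyC1|rewrite exprS; apply: (okM)].
Qed.

End Curve.

(** * The even group G_0, its root subgroups and its torus *)

Section EvenGroup.
Variables (k : fieldType) (m n : nat).
Implicit Types (a b X : 'M[k]_(m + n)) (i j : 'I_(m + n)).

Definition blk i : bool := (i < m)%N.

Lemma blk_lshift (i : 'I_m) : blk (lshift n i) = true.
Proof. by rewrite /blk /= ltn_ord. Qed.

Lemma blk_rshift (i : 'I_n) : blk (rshift m i) = false.
Proof. by rewrite /blk /= ltnNge leq_addr. Qed.

Definition blkE := (blk_lshift, blk_rshift).

Lemma parity_mxP p X :
  reflect (forall i j, blk i (+) blk j != p -> X i j = 0) (parity_mx p X).
Proof.
apply: (iffP idP) => [|H].
  case: p => /andP [/eqP A /eqP D] i j.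
    case: (split_ordP i) => i' ->; case: (split_ordP j) => j' -> //; rewrite !blkE // => _.
      by have := congr1 (fun Y => fun_of_matrix Y i' j') A; rewrite !mxE.
    by have := congr1 (fun Y => fun_of_matrix Y i' j') D; rewrite !mxE.
  case: (split_ordP i) => i' ->; case: (split_ordP j) => j' -> //; rewrite !blkE // => _.
    by have := congr1 (fun Y => fun_of_matrix Y i' j') A; rewrite !mxE.
  by have := congr1 (fun Y => fun_of_matrix Y i' j') D; rewrite !mxE.
by case: p H => H; apply/andP; split; apply/eqP/matrixP => i j; rewrite !mxE H // !blkE.
Qed.

Lemma parity_delta i j : parity_mx (blk i (+) blk j) (delta_mx i j : 'M[k]_(m + n)).
Proof.
apply/parity_mxP => p q; rewrite mxE.
by case: (p =P i) => [->|] //=; case: (q =P j) => [->|] //=; rewrite eqxx.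
Qed.

Lemma parity_delta_even i j : blk i = blk j -> parity_mx false (delta_mx i j : 'M[k]_(m + n)).
Proof. by move=> ij; have := parity_delta i j; rewrite ij addbb. Qed.

Lemma parity_lin p c X Y : parity_mx p X -> parity_mx p Y -> parity_mx p (c *: X + Y).
Proof.
move=> /parity_mxP pX /parity_mxP pY; apply/parity_mxP => i j ij.
by rewrite !mxE pX // pY // mulr0 addr0.
Qed.

Lemma even_mx1 : parity_mx false (1%:M : 'M[k]_(m + n)).
Proof.
by apply/parity_mxP => i j; rewrite mxE; case: (i =P j) => [->|] //; rewrite addbb.
Qed.

Lemma even_mulmx X Y : parity_mx false X -> parity_mx false Y -> parity_mx false (X *m Y).
Proof.
move=> /parity_mxP pX /parity_mxP pY; apply/parity_mxP => i j ij.
rewrite mxE big1 // => q _; have [iq|iq] := eqVneq (blk i (+) blk q) false.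
  by rewrite [Y _ _]pY ?mulr0 //; move: ij iq; case: blk; case: blk; case: blk.
by rewrite pX ?mul0r.
Qed.

Lemma G0_unit a : a \in G0 k m n -> a \in unitmx. Proof. by case/andP. Qed.
Lemma G0_even a : a \in G0 k m n -> parity_mx false a. Proof. by case/andP. Qed.

Lemma G0_mul a b : a \in G0 k m n -> b \in G0 k m n -> a *m b \in G0 k m n.
Proof.
move=> /andP [ua ea] /andP [ub eb]; apply/andP.
by rewrite unitmx_mul ua ub even_mulmx.
Qed.

Lemma mulmx1_invmx a b : a *m b = 1%:M -> invmx a = b.
Proof.
move=> ab; have [ua _] := mulmx1_unit ab.
by rewrite -[LHS]mulmx1 -ab mulKmx.
Qed.

Lemma regpoint_lin c X Y X' Y' q :
  regpoint (c *: X + X') (c *: Y + Y') q = c * regpoint X Y q + regpoint X' Y' q.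
Proof. by rewrite /regpoint !linearP !mxE; case: split => s; rewrite !mxE. Qed.

Definition xmx i j (t : k) : 'M[k]_(m + n) := t *: delta_mx i j + 1%:M.

Definition tmx i (t : k) : 'M[k]_(m + n) := (t - 1) *: delta_mx i i + 1%:M.

Lemma xmxM i j s t : i != j -> xmx i j s *m xmx i j t = xmx i j (s + t).
Proof.
move=> ij; rewrite /xmx mulmxDl !mulmxDr !mul1mx !mulmx1 -!scalemxAl -!scalemxAr.
by rewrite mul_delta_mx_cond eq_sym (negPf ij) mulr0n !scaler0 add0r scalerDl addrA.
Qed.

Lemma xmx0 i j : xmx i j 0 = 1%:M.
Proof. by rewrite /xmx scale0r add0r. Qed.

Lemma xmxV i j t : i != j -> xmx i j t *m xmx i j (- t) = 1%:M.
Proof. by move=> ij; rewrite xmxM // subrr xmx0. Qed.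

Lemma xmx_G0 i j t : i != j -> blk i = blk j -> xmx i j t \in G0 k m n.
Proof.
move=> nij ij; have [u _] := mulmx1_unit (xmxV t nij); apply/andP; split=> //.
by apply: parity_lin; [apply: parity_delta_even|apply: even_mx1].
Qed.

Lemma tmxM i s t : tmx i s *m tmx i t = tmx i (s * t).
Proof.
rewrite /tmx mulmxDl !mulmxDr !mul1mx !mulmx1 -!scalemxAl -!scalemxAr.
rewrite mul_delta_mx scalerA addrA -!scalerDl; congr (_ *: _ + _); ring.
Qed.

Lemma tmx1 i : tmx i 1 = 1%:M.
Proof. by rewrite /tmx subrr scale0r add0r. Qed.

Lemma tmxV i t : t != 0 -> tmx i t *m tmx i t^-1 = 1%:M.
Proof. by move=> t0; rewrite tmxM mulfV ?tmx1. Qed.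

Lemma tmx_G0 i t : t != 0 -> tmx i t \in G0 k m n.
Proof.
move=> t0; have [u _] := mulmx1_unit (tmxV i t0); apply/andP; split=> //.
by apply: parity_lin; [apply: parity_delta_even|apply: even_mx1].
Qed.

End EvenGroup.

(** * Matrix coefficients along one-parameter subgroups *)

Section OneParameter.
Variables (k : fieldType) (m n : nat) (M : glmod k m n).
Hypothesis hk : [pchar k] =i pred0.
Implicit Types (i j : 'I_(m + n)) (phi : {linear M -> k^o}) (v : M).

Lemma grpM a b v : a \in G0 k m n -> b \in G0 k m n ->
  grp M (a *m b) v = grp M a (grp M b v).
Proof. by move=> ga gb; rewrite (glmod_grpM (glmodP M)) // comp_lfunE. Qed.

Lemma grp1 v : grp M 1%:M v = v.
Proof. by rewrite (glmod_grp1 (glmodP M)) id_lfunE. Qed.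

(** The entries of [xmx i j t] and of its inverse [xmx i j (- t)] are affine in [t], so
    [mpoly_curve] applies with denominator 1. *)
Lemma grp_xmx_poly phi v i j : i != j -> blk i = blk j -> exists2 Q : {poly k},
  forall t, phi (grp M (xmx i j t) v) = Q.[t] & phi (lie M (delta_mx i j) v) = Q^`().[0].
Proof.
move=> nij ij; have [P [Pg Pl]] := glmod_alg (glmodP M) phi v.
pose E : 'M[k]_(m + n) := delta_mx i j.
pose G q := (regpoint E (- E) q) *: 'X + (regpoint 1%:M 1%:M q : k)%:P.
have Gt q t : (G q).[t] = t * regpoint E (- E) q + regpoint 1%:M 1%:M q.
  by rewrite !hornerE mulrC.
have [D [Q [Q1 Q2]]] := mpoly_curve G 1%:P P; exists Q => [t|].
  rewrite Pg ?xmx_G0 // Q1 !hornerC ?oner_eq0 // expr1n mul1r /regeval.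
  apply: meval_eq => q; rewrite divr1 Gt -regpoint_lin.
  by rewrite (mulmx1_invmx (xmxV t nij)) /xmx scaleNr scalerN.
rewrite Pl ?parity_delta_even // Q2 ?hornerC // derivC hornerC mulr0 mul0r add0r.
apply: eq_bigr => q _; rewrite mul0r subr0; congr (_ * _).
  by rewrite /G derivD derivZ derivX derivC !hornerE.
by apply: meval_eq => a; rewrite Gt mul0r add0r.
Qed.

(** By the one-parameter law, translating the functional by [xmx i j t] shifts [Q] by [t]. Thus
    acting by the Lie algebra differentiates the coefficient at every [t], not only at 0. *)
Lemma grp_xmx_step phi v i j (Q : {poly k}) : i != j -> blk i = blk j ->
  (forall t, phi (grp M (xmx i j t) v) = Q.[t]) ->
  forall t, phi (grp M (xmx i j t) (lie M (delta_mx i j) v)) = Q^`().[t].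
Proof.
move=> nij ij HQ t.
have psi_linear : linear (phi \o grp M (xmx i j t) : M -> k^o) by move=> c x y; rewrite /= !linearP.
pose psi : {linear M -> k^o} := HB.pack (phi \o grp M (xmx i j t) : M -> k^o)
  (GRing.isLinear.Build _ _ _ _ _ psi_linear).
have [R HR1 HR2] := grp_xmx_poly psi v nij ij.
rewrite -[LHS]/(psi _) HR2; have -> : R = Q \Po ('X + t%:P).
  apply: (poly_eq_pchar0 hk) => s _; rewrite -HR1 horner_comp !hornerE -HQ /=.
  by rewrite -grpM ?xmx_G0 // xmxM // addrC.
by rewrite deriv_comp derivD derivX derivC addr0 mulr1 horner_comp !hornerE.
Qed.

(** The inverse of [tmx i t] has a pole at 0, so a coefficient is a Laurent polynomial and [t ^+ D]
    clears its denominator; differentiating this factor yields the term [D%:R * Q.[1]]. *)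
Lemma grp_tmx_poly phi v i : exists D : nat, exists2 Q : {poly k},
  forall t : k, t != 0 -> Q.[t] = t ^+ D * phi (grp M (tmx i t) v) &
  Q^`().[1] = D%:R * Q.[1] + phi (lie M (delta_mx i i) v).
Proof.
have [P [Pg Pl]] := glmod_alg (glmodP M) phi v.
pose E : 'M[k]_(m + n) := delta_mx i i.
(* Divided by ['X], this curve runs through the pairs of [tmx i t] and its inverse. *)
pose G q := (regpoint E 0 q) *: 'X^2 + (regpoint (1%:M - E) (1%:M - E) q) *: 'X +
   (regpoint 0 E q : k)%:P.
have Gt q t : (G q).[t] = t ^+ 2 * regpoint E 0 q +
    t * regpoint (1%:M - E) (1%:M - E) q + regpoint 0 E q.
  by rewrite !hornerE /=; ring.
have lin2 X Y X' Y' q : regpoint (X + X') (Y + Y') q = regpoint X Y q + regpoint X' Y' q :> k.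
  by rewrite -[X]scale1r -[Y]scale1r regpoint_lin mul1r !scale1r.
have linZ c X Y q : regpoint (c *: X) (c *: Y) q = c * regpoint X Y q :> k.
  have r0 : regpoint 0 0 q = 0 :> k by rewrite /regpoint !linear0 row_mx0 mxE.
  by rewrite -[c *: X]addr0 -[c *: Y]addr0 regpoint_lin r0 addr0.
have [D [Q [Q1 Q2]]] := mpoly_curve G 'X P; exists D, Q => [t t0|].
  rewrite Pg ?tmx_G0 // Q1 !hornerE // /regeval; congr (_ * _).
  apply: meval_eq => q; rewrite Gt (mulmx1_invmx (tmxV i t0)).
  apply: (mulIf t0); rewrite divfK // [RHS]mulrC -linZ -!linZ -!lin2 !scaler0.
  by congr (regpoint _ _ q); apply/matrixP => a b; rewrite !mxE; [ring|field].
rewrite Q2 ?hornerX // derivX hornerC mulr1 Pl ?parity_delta_even //; congr (_ + _).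
apply: eq_bigr => q _; congr (_ * _); last first.
  apply: meval_eq => a; rewrite Gt expr1n !mul1r -!lin2 !addr0 add0r.
  by rewrite addrCA subrr addr0 subrK.
rewrite Gt /G !derivD !derivZ derivX derivXn derivC !hornerE /=.
have -> : regpoint E (- E) q = regpoint E 0 q - regpoint 0 E q.
  have -> : - regpoint 0 E q = -1 * regpoint 0 E q by rewrite mulN1r.
  by rewrite -linZ -lin2 scaler0 addr0 add0r scaleN1r.
rewrite expr1n; ring.
Qed.

Lemma grp_tmx_step phi v i D (Q : {poly k}) :
  (forall t, t != 0 -> Q.[t] = t ^+ D * phi (grp M (tmx i t) v)) ->
  forall t, t != 0 -> ('X * Q^`() - D%:R *: Q).[t] =
    t ^+ D * phi (grp M (tmx i t) (lie M (delta_mx i i) v)).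
Proof.
move=> HQ t t0.
have psi_linear : linear (phi \o grp M (tmx i t) : M -> k^o) by move=> c x y; rewrite /= !linearP.
pose psi : {linear M -> k^o} := HB.pack (phi \o grp M (tmx i t) : M -> k^o)
  (GRing.isLinear.Build _ _ _ _ _ psi_linear).
have [D' [R HR1 HR2]] := grp_tmx_poly psi v i.
have RQ : t ^+ D *: ('X^D * R) = 'X^D' * (Q \Po (t *: 'X)).
  apply: (poly_eq_pchar0 hk) => s s0.
  rewrite hornerZ !hornerM !hornerXn horner_comp hornerZ hornerX HR1 // HQ ?mulf_neq0 //=.
  by rewrite -grpM ?tmx_G0 // tmxM exprMn; ring.
have R1 : R.[1] = psi v by rewrite HR1 ?oner_eq0 // expr1n mul1r tmx1 grp1.
have psiv : Q.[t] = t ^+ D * psi v by rewrite HQ.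
have E1 : t ^+ D * (D%:R * R.[1] + R^`().[1]) = D'%:R * Q.[t] + t * Q^`().[t].
  have := congr1 (fun p => (p^`()).[1]) RQ.
  rewrite derivZ hornerZ !derivM !derivXn deriv_comp !(hornerD, hornerM, hornerMn, hornerXn).
  rewrite !horner_comp derivZ derivX !hornerZ hornerX !expr1n !mul1r !mulr1 -polyC1 hornerC mulr1.
  by move=> ->; rewrite [Q^`().[t] * t]mulrC.
have -> : phi (grp M (tmx i t) (lie M (delta_mx i i) v)) = R^`().[1] - D'%:R * R.[1].
  by rewrite HR2 [X in X - _]addrC addrK.
rewrite !(hornerD, hornerN, hornerM, hornerZ) hornerX mulrBr.
have -> : t ^+ D * R^`().[1] = D'%:R * Q.[t] + t * Q^`().[t] - t ^+ D * (D%:R * R.[1]).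
  by rewrite -E1 mulrDr addrC addKr.
rewrite psiv R1; ring.
Qed.

(** [Q] satisfies the Euler equation of degree [D + b], so in characteristic zero it is a monomial
    of that degree, or zero if the degree is negative. *)
Lemma grp_tmx_eigen i (b : int) v t : lie M (delta_mx i i) v = b%:~R *: v -> t != 0 ->
  grp M (tmx i t) v = t ^ b *: v.
Proof.
move=> hv t0; apply: eq_functional => phi; rewrite linearZ /=.
have [D [Q HQ _]] := grp_tmx_poly phi v i.
have E : 'X * Q^`() - D%:R *: Q = b%:~R *: Q.
  apply: (poly_eq_pchar0 hk) => s s0; rewrite (grp_tmx_step HQ) // hv.
  by rewrite lfunZ linearZ hornerZ HQ //= mulrCA.
have coefQ (j : nat) : (j%:Z - D%:Z - b)%:~R * Q`_j = 0.
  have := congr1 (fun p : {poly k} => p`_j) E; rewrite coefB !coefZ coefXM.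
  rewrite !rmorphB /= !mulrBl => <-; rewrite -!pmulrn.
  by case: j => [|j]; rewrite /= ?mul0r ?subrr // coef_deriv mulr_natl subrr.
have Q0 (j : nat) : j%:Z != D%:Z + b -> Q`_j = 0.
  move=> jb; have /eqP := coefQ j; rewrite mulf_eq0 (intr_eq0_pchar0 hk).
  by case/orP=> /eqP //; lia.
have Qs : forall s, Q.[s] = if 0 <= D%:Z + b then Q`_(absz (D%:Z + b)) * s ^+ absz (D%:Z + b) else 0.
  move=> s; rewrite horner_coef; case: ifP => Db; last first.
    by rewrite big1 // => j _; rewrite Q0 ?mul0r //; move: Db; lia.
  have [lt|ge] := ltnP (absz (D%:Z + b)) (size Q); last first.
    rewrite big1 => [|j _]; first by rewrite nth_default // mul0r.
    by rewrite Q0 ?mul0r //; have := ltn_ord j; lia.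
  rewrite (bigD1 (Ordinal lt)) //= big1 ?addr0 // => j jn.
  by rewrite Q0 ?mul0r //; move: jn; rewrite -val_eqE /=; lia.
have v1 : phi v = Q.[1] by rewrite HQ ?oner_eq0 // expr1n mul1r tmx1 grp1.
have := HQ t t0; rewrite Qs v1 Qs; case: ifP => Db; last first.
  move/esym/eqP; rewrite mulf_eq0 expf_eq0 (negPf t0) andbF /= => /eqP ->.
  by rewrite scaler0.
rewrite expr1n mulr1 => E'; apply: (mulfI (expf_neq0 D t0)); rewrite -E'.
rewrite /GRing.scale /= mulrA mulrC; congr (_ * _).
by rewrite !exprnP gez0_abs // expfzDr.
Qed.

(* Iterating grp_tmx_step with the factors X d/dX - (D + b) for -B <= b <= B   *)
(* annihilates the Laurent polynomial of any matrix coefficient. *)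
Lemma torus_kill i : exists B : nat, forall v,
  kill (fun=> lie M (delta_mx i i)) [seq (tt, (b%:Z - B%:Z)%:~R) | b <- iota 0 (B + B).+1] v = 0.
Proof.
set h := lie M (delta_mx i i); pose kl (rs : seq int) v := kill (fun=> h) [seq (tt, b%:~R) | b <- rs] v.
have step (phi : {linear M -> k^o}) (v : M) (D : nat) (Q : {poly k}) (rs : seq int) :
    (forall t, t != 0 -> Q.[t] = t ^+ D * phi (grp M (tmx i t) v)) ->
    exists2 Q' : {poly k}, forall t, t != 0 -> Q'.[t] = t ^+ D * phi (grp M (tmx i t) (kl rs v)) &
      forall j : nat, Q'`_j = (\prod_(b <- rs) (j%:Z - D%:Z - b)%:~R) * Q`_j.
  move=> HQ; elim: rs => [|b rs [Q' HQ' cQ']].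
    by exists Q => // j; rewrite big_nil mul1r.
  exists ('X * Q'^`() - D%:R *: Q' - b%:~R *: Q') => [t t0|j].
    rewrite hornerD hornerN (grp_tmx_step HQ') // hornerZ HQ' // /kl /= -/(kl rs v).
    by rewrite lfunB lfunZ linearB linearZ /= mulrBr [X in _ = _ - X]mulrCA.
  rewrite big_cons -mulrA -cQ' !coefB !coefZ coefXM !rmorphB /= !mulrBl; congr (_ - _ - _).
  by case: j => [|j]; rewrite -!pmulrn /= ?mul0r // coef_deriv mulr_natl.
have bound (phi : {linear M -> k^o}) (v : M) : exists B : nat, forall B', (B <= B')%N ->
    phi (kl [seq b%:Z - B'%:Z | b <- iota 0 (B' + B').+1] v) = 0.
  have [D [Q HQ _]] := grp_tmx_poly phi v i.
  exists (D + size Q)%N => B' BB'.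
  have [Q' HQ' cQ'] := step phi v D Q [seq b%:Z - B'%:Z | b <- iota 0 (B' + B').+1] HQ.
  have := HQ' 1 (oner_neq0 _); rewrite expr1n mul1r tmx1 grp1 => <-.
  suff -> : Q' = 0 by rewrite horner0.
  apply/polyP => j; rewrite cQ' coef0; have [js|js] := leqP (size Q) j.
    by rewrite nth_default ?mulr0.
  have jin : j%:Z - D%:Z \in [seq b%:Z - B'%:Z | b <- iota 0 (B' + B').+1].
    apply/mapP; exists (absz (j%:Z - D%:Z + B'%:Z)); first by rewrite mem_iota; lia.
    by lia.
  by rewrite (big_rem _ jin) /= subrr !mul0r.
(* One [B] has to serve all vectors: it is enough to bound the finitely many matrix coefficients in
   a basis. *)
have big_bound (I : eqType) (s : seq I) (P : I -> nat -> Prop) :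
    (forall x, exists B : nat, forall B', (B <= B')%N -> P x B') ->
    exists B : nat, forall x, x \in s -> P x B.
  move=> H; suff [B HB] : exists B : nat, forall B', (B <= B')%N -> forall x, x \in s -> P x B'.
    by exists B; apply: HB.
  elim: s => [|x s [B HB]]; first by exists 0%N.
  have [C HC] := H x; exists (B + C)%N => B' BC y; rewrite inE => /orP [/eqP ->|ys].
    by apply: HC; lia.
  by apply: HB => //; lia.
pose co q : {linear M -> k^o} := coord (vbasis {: M}) q.
have [B HB] := big_bound _ (enum {: 'I_(\dim {: M}) * 'I_(\dim {: M})})
  (fun pq B => co pq.1 (kl [seq b%:Z - B%:Z | b <- iota 0 (B + B).+1] (vbasis {: M})`_pq.2) = 0)
  (fun pq => bound _ _).
exists B => v.
have -> : [seq (tt, (b%:Z - B%:Z)%:~R : k) | b <- iota 0 (B + B).+1] =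
   [seq (tt, b%:~R) | b <- [seq b%:Z - B%:Z | b <- iota 0 (B + B).+1]] by rewrite -map_comp.
rewrite -/(kl _ v); set rs := [seq _ | _ <- _] in HB *.
have [Y HY] : exists Y : {vspace M}, forall v, v \in Y <-> kl rs v = 0.
  apply: vspace_of_pred => [|a x y]; first exact: kill0.
  by rewrite /kl kill_linear => -> ->; rewrite scaler0 addr0.
apply/HY; have : v \in <<vbasis {: M}>>%VS by rewrite (span_basis (vbasisP _)) memvf.
apply: subvP; apply/span_subvP => _ /tnthP [p ->]; apply/HY.
rewrite (coord_vbasis (memvf (kl rs _))) big1 // => q _.
rewrite (tnth_nth 0) -[coord _ _ _]/(co q _) (HB (q, p)) ?scale0r //.
by rewrite mem_enum.
Qed.

End OneParameter.

(** * Generation of G_0 by root subgroups and torus *)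

Section Generation.
Variables (k : fieldType) (m n : nat).
Implicit Types (a b X : 'M[k]_(m + n)) (i j : 'I_(m + n)).

Lemma G0_1 : 1%:M \in G0 k m n.
Proof. by apply/andP; rewrite unitmx1 even_mx1. Qed.

Lemma even_mx_comm X : parity_mx false X ->
  forall i j, X i j * (blk j)%:R = (blk i)%:R * X i j.
Proof.
move=> /parity_mxP eX i j; have [ij|/eX ->] := eqVneq (blk i (+) blk j) false.
  by rewrite mulrC; congr (_%:R * _); move: ij; case: (blk i); case: (blk j).
by rewrite mulr0 mul0r.
Qed.

(** Evenness amounts to commuting with the diagonal projector [D] on the first block, a property
    inherited by inverses. *)
Lemma G0_inv a : a \in G0 k m n -> invmx a \in G0 k m n.
Proof.
move=> ga; have ua := G0_unit ga; apply/andP; rewrite unitmx_inv ua; split=> //.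
pose D : 'M[k]_(m + n) := diag_mx (\row_i (blk i)%:R).
have aD : a *m D = D *m a.
  by apply/matrixP => i j; rewrite mul_mx_diag mul_diag_mx !mxE even_mx_comm // G0_even.
have iD : invmx a *m D = D *m invmx a.
  by rewrite -[invmx a *m D]mulmx1 -(mulmxV ua) !mulmxA -[_ *m D *m a]mulmxA -aD !mulmxA mulVmx // mul1mx.
apply/parity_mxP => i j; have := congr1 (fun Y : 'M_(m + n) => Y i j) iD.
rewrite mul_mx_diag mul_diag_mx !mxE; case: (blk i); case: (blk j) => //= /eqP.
  by rewrite mulr0 mul1r eq_sym => /eqP.
by rewrite mulr1 mul0r => /eqP.
Qed.

Lemma mul_xmx i j t a r c : (xmx i j t *m a) r c = a r c + t * (r == i)%:R * a j c.
Proof.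
rewrite /xmx mulmxDl mul1mx -scalemxAl !mxE addrC; congr (_ + _).
rewrite (bigD1 j) //= big1 ?addr0 => [|q qj].
  by rewrite mxE eqxx andbT mulrA.
by rewrite mxE (negPf qj) andbF mul0r.
Qed.

Section GeneratedBy.
Variable Pr : 'M[k]_(m + n) -> Prop.
Hypothesis Pr1 : Pr 1%:M.
Hypothesis PrM : forall a b, a \in G0 k m n -> b \in G0 k m n -> Pr a -> Pr b -> Pr (a *m b).
Hypothesis PrX : forall i j t, i != j -> blk i = blk j -> Pr (xmx i j t).
Hypothesis PrT : forall i t, t != 0 -> Pr (tmx i t).

Let ok a := a \in G0 k m n /\ Pr a.

Let okM a b : ok a -> ok b -> ok (a *m b).
Proof. by move=> [ga pa] [gb pb]; split; [apply: G0_mul|apply: PrM]. Qed.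

Let ok_column (s : seq 'I_(m + n)) (c : 'I_(m + n) -> k) j : j \notin s ->
  (forall r, blk r != blk j -> c r = 0) -> ok (1%:M + \sum_(r <- s) c r *: delta_mx r j).
Proof.
move=> js c0; elim: s js => [|r s IHs]; first by rewrite big_nil addr0; split; [apply: G0_1|].
rewrite inE negb_or eq_sym => /andP [rj js]; rewrite big_cons.
have [brj|nbrj] := eqVneq (blk r) (blk j); last by rewrite c0 // scale0r add0r; apply: IHs.
suff -> : 1%:M + (c r *: delta_mx r j + \sum_(q <- s) c q *: delta_mx q j) =
    xmx r j (c r) *m (1%:M + \sum_(q <- s) c q *: delta_mx q j).
  by apply: okM; [split; [apply: xmx_G0|apply: PrX]|apply: IHs].
have S0 : \sum_(q <- s) delta_mx r j *m (c q *: delta_mx q j) = 0 :> 'M_(m + n).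
  rewrite big1_seq // => q /andP [_ qs]; rewrite -scalemxAr mul_delta_mx_cond.
  by rewrite (_ : (j == q) = false) ?mulr0n ?scaler0 //; apply: contraNF js => /eqP ->.
rewrite /xmx mulmxDl mul1mx mulmxDr mulmx1 -scalemxAl mulmx_sumr S0 scaler0 addr0.
by rewrite addrCA.
Qed.

(** The elimination matrix for column [j]: its inverse sends column [j] of [a] to a column of the
    identity. *)
Let colmx a j : 'M[k]_(m + n) := \matrix_(r, c) if c == j then a r j else (r == c)%:R.

Let ok_colmx a j : a \in G0 k m n -> a j j != 0 -> ok (colmx a j).
Proof.
move=> ga ajj; set t := a j j in ajj.
have -> : colmx a j = (1%:M + \sum_(r <- enum (predC1 j)) (a r j / t) *: delta_mx r j) *m tmx j t.
  apply/matrixP => r c; rewrite /tmx mulmxDr mulmx1 -scalemxAr mulmxDl mul1mx mulmx_suml.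
  rewrite (eq_bigr (fun r => (a r j / t) *: delta_mx r j)) => [|q _]; last first.
    by rewrite -scalemxAl mul_delta_mx.
  rewrite !mxE summxE.
  have -> : \sum_(q <- enum (predC1 j)) ((a q j / t) *: (delta_mx q j : 'M[k]_(m + n))) r c =
      (c == j)%:R * (r != j)%:R * (a r j / t).
    rewrite big_enum /=; have [rj|rj] := eqVneq r j.
      rewrite mulr0 mul0r big1 // => q /negPf qj.
      by rewrite !mxE rj eq_sym qj mulr0.
    rewrite (bigD1 r) //= big1 ?addr0 => [|q /andP [_ qr]].
      by rewrite !mxE eqxx /= mulr1 mulrC.
    by rewrite !mxE [r == q]eq_sym (negPf qr) mulr0.
  have [->|cj] := eqVneq c j; last by rewrite !andbF !mul0r !addr0 mulr0 add0r.
  rewrite andbT mul1r; have [->|rj] := eqVneq r j; first by rewrite /= mul0r -/t; ring.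
  by rewrite /= mul1r; field.
apply: okM; last by split; [apply: tmx_G0|apply: PrT].
apply: (@ok_column _ (fun r => a r j / t)); first by rewrite mem_enum !inE eqxx.
move=> r rj; have /parity_mxP -> := G0_even ga; rewrite ?mul0r //.
by move: rj; case: (blk r); case: (blk j).
Qed.

(** Gaussian elimination by columns, where [d] bounds the number of columns that may still differ
    from those of the identity. Evenness keeps every elementary factor inside one block. *)
Lemma G0_ind a : a \in G0 k m n -> Pr a.
Proof.
suff H : forall d b, b \in G0 k m n ->
    (forall i j, (j < m + n - d)%N -> b i j = (i == j)%:R) -> Pr b.
  by move=> ga; apply: (H (m + n)%N) => // i j; rewrite subnn.
elim=> [|d IHd] b gb bI.
  suff -> : b = 1%:M by []; apply/matrixP => i j; rewrite mxE bI // subn0.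
  exact: ltn_ord.
have [dN|dN] := ltnP d (m + n); last by apply: IHd => // i j ij; apply: bI; lia.
have jP : (m + n - d.+1 < m + n)%N by lia.
set j := Ordinal jP.
(* With a nonzero pivot, splitting off [colmx c j] on the left puts column [j] into identity form
   and preserves the earlier columns. *)
have pivot c : c \in G0 k m n -> (forall i (q : 'I_(m + n)), (q < j)%N -> c i q = (i == q)%:R) ->
    c j j != 0 -> Pr c.
  move=> gc cI cjj; have [gg pg] := ok_colmx gc cjj; set g := colmx c j in gg pg.
  have ug := G0_unit gg.
  have -> : c = g *m (invmx g *m c) by rewrite mulKVmx.
  have gi := G0_mul (G0_inv gg) gc; apply: PrM => //; apply: IHd => // i q qd.
  have cg : c *m delta_mx q (0 : 'I_1) = g *m delta_mx q 0.
    rewrite -!colE; apply/matrixP => r z; rewrite !mxE; case: eqP => [->|/eqP qj] //.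
    by rewrite cI //; move: qj; rewrite -val_eqE /=; lia.
  have : (invmx g *m c) *m delta_mx q (0 : 'I_1) = delta_mx q 0.
    by rewrite -mulmxA cg mulKmx.
  by move=> /(congr1 (fun Y : 'M_(_, 1) => Y i 0)); rewrite -colE !mxE andbT.
have {}bI i (q : 'I_(m + n)) : (q < j)%N -> b i q = (i == q)%:R by move=> qj; apply: bI.
have [bjj|bjj] := eqVneq (b j j) 0; last exact: pivot.
(* Otherwise column [j] would be a combination of the preceding columns, which are those of the
   identity; [w] is the resulting kernel vector, against invertibility. *)
have [i ji bij] : exists2 i : 'I_(m + n), (j < i)%N & b i j != 0.
  case: (pickP (fun i : 'I_(m + n) => (j < i)%N && (b i j != 0))) => [i /andP [ji bij]|none].
    by exists i.
  pose w : 'cV[k]_(m + n) := \col_i if (i < j)%N then - b i j else (i == j)%:R.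
  have bw : b *m w = 0.
    apply/matrixP => r z; rewrite !mxE.
    have -> : \sum_q b r q * w q z = \sum_(q < m + n | (q < j)%N) (r == q)%:R * - b q j + b r j.
      rewrite (bigID (fun q : 'I_(m + n) => (q < j)%N)) /=; congr (_ + _).
        by apply: eq_bigr => q qj; rewrite mxE qj bI.
      rewrite (bigD1 j) ?ltnn //= big1 ?addr0 => [|q /andP [qj nqj]].
        by rewrite mxE ltnn eqxx mulr1.
      by rewrite mxE (negPf qj) (negPf nqj) mulr0.
    have [rj|rj] := ltnP r j.
      rewrite (bigD1 r) //= eqxx mul1r big1 ?addr0 ?addNr // => q /andP [_ qr].
      by rewrite eq_sym (negPf qr) mul0r.
    rewrite big1 => [|q qj]; last first.
      by rewrite (_ : (r == q) = false) ?mul0r //; apply/eqP => rq; move: qj; rewrite -rq ltnNge rj.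
    rewrite add0r; move: rj; rewrite leq_eqVlt => /orP [/eqP jr|jr].
      by rewrite -(val_inj jr : j = r).
    by have := none r; rewrite jr => /negbFE /eqP.
  have : w j 0 = 0.
    have -> : w = 0 by rewrite -(mulKmx (G0_unit gb) w) bw mulmx0.
    by rewrite mxE.
  by rewrite mxE ltnn eqxx => /eqP; rewrite oner_eq0.
have bij' : blk j = blk i.
  have [//|nij] := eqVneq (blk j) (blk i).
  case/eqP: bij; have /parity_mxP -> // := G0_even gb; move: nij; by case: (blk i); case: (blk j).
have nji : j != i by rewrite -val_eqE /= ltn_eqF.
(* Adding row [i] to row [j] makes the pivot nonzero. *)
have -> : b = xmx j i (-1) *m (xmx j i 1 *m b).
  by rewrite mulmxA xmxM // addNr xmx0 mul1mx.
have gx := G0_mul (xmx_G0 1 nji bij') gb.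
apply: PrM => //; [exact: xmx_G0|exact: PrX|apply: pivot => // [r q qj|]].
  rewrite mul_xmx !bI // [i == q]eq_sym (_ : (q == i) = false) ?mulr0 ?addr0 //.
  by apply/eqP => qi; move: qj ji; rewrite qi; lia.
by rewrite mul_xmx bjj eqxx !mul1r add0r.
Qed.

End GeneratedBy.

End Generation.

(** * Representations of the pair (G0, gl(m|n)) *)

Section PolyFamily.
Variables (k : fieldType) (hk : [pchar k] =i pred0) (V : vectType k).
Variables (U : {vspace V}) (h : V -> V) (F : V -> k -> k).

(** The derivative of a member of the family is again a member, of smaller degree; by induction it
    vanishes, and the value at 0 removes the constant. *)
Lemma poly_family_eq0 :
  (forall u, u \in U -> exists Q : {poly k}, forall t, F u t = Q.[t]) ->
  (forall u (Q : {poly k}), u \in U -> (forall t, F u t = Q.[t]) ->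
    forall t, F (h u) t = Q^`().[t]) ->
  (forall u, u \in U -> h u \in U) -> (forall u, u \in U -> F u 0 = 0) ->
  forall u t, u \in U -> F u t = 0.
Proof.
move=> FQ FS hU F0 u t uU; have [Q HQ] := FQ u uU; rewrite HQ.
suff -> : Q = 0 by rewrite horner0.
have [s] := ubnP (size Q); elim: s u uU Q HQ => // s IHs u uU Q HQ sQ.
have [sQ1|sQ1] := leqP (size Q) 1.
  by rewrite (size1_polyC sQ1) -horner_coef0 -HQ F0.
have Q'0 : Q^`() = 0.
  apply: (IHs (h u)) => //; [exact: hU|exact: FS|].
  have : (size Q^`() < size Q)%N by apply: lt_size_deriv; rewrite -size_poly_gt0; lia.
  by move: sQ; lia.
apply/polyP => -[|j]; first by rewrite coef0 -horner_coef0 -HQ F0.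
have := congr1 (fun p : {poly k} => p`_j) Q'0; rewrite coef_deriv !coef0 => /eqP.
by rewrite -mulr_natl mulf_eq0 (natr_eq0_pchar0 hk) => /eqP.
Qed.

End PolyFamily.

Section GlmodTheory.
Variables (k : fieldType) (hk : [pchar k] =i pred0) (m n : nat).
Notation T := (glmod k m n).
Implicit Types (M N : T) (i j : 'I_(m + n)).

Definition op M i j : 'End(M) := lie M (delta_mx i j).

Lemma lieE M X v : lie M X v = \sum_i \sum_j X i j *: op M i j v.
Proof.
rewrite [in LHS](matrix_sum_delta X) linear_sum sum_lfunE; apply: eq_bigr => i _.
rewrite linear_sum sum_lfunE; apply: eq_bigr => j _.
by rewrite linearZ scale_lfunE.
Qed.

Definition ev_stable M (U : {vspace M}) :=
  forall i j u, blk i = blk j -> u \in U -> op M i j u \in U.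

Definition lie_stable M (U : {vspace M}) := forall i j u, u \in U -> op M i j u \in U.

Lemma lie_stable_lie M (U : {vspace M}) X u : lie_stable U -> u \in U -> lie M X u \in U.
Proof.
move=> sU uU; rewrite lieE; apply: rpred_sum => i _; apply: rpred_sum => j _.
by rewrite memvZ ?sU.
Qed.

Lemma op_bracket M i j p q v : op M i j (op M p q v) =
  (-1) ^+ ((blk i (+) blk j) && (blk p (+) blk q)) *: op M p q (op M i j v)
  + (j == p)%:R *: op M i q v
  - ((-1) ^+ ((blk i (+) blk j) && (blk p (+) blk q)) * (q == i)%:R) *: op M p j v.
Proof.
have := glmod_bracket (glmodP M) v (parity_delta k i j) (parity_delta k p q).
rewrite /sbracket !mul_delta_mx_cond linearB linearZ /= !raddfMn /=.
rewrite -!scaler_nat add_lfunE !scale_lfunE opp_lfunE scale_lfunE => /esym /eqP.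
rewrite subr_eq => /eqP; rewrite -/(op M i j) -/(op M p q) => ->.
by rewrite addrC addrA; congr (_ + _); rewrite scalerN scalerA mulrC.
Qed.

Lemma op_bracket_even M i j p q v : blk i = blk j -> op M i j (op M p q v) =
  op M p q (op M i j v) + (j == p)%:R *: op M i q v - (q == i)%:R *: op M p j v.
Proof. by move=> ij; rewrite op_bracket ij addbb /= scale1r mul1r. Qed.

(** This is the hypothesis [eD] of complete reducibility: [torus_kill] provides distinct integral
    roots, and the sum of the bounds serves all [i] at once. *)
Lemma torus_diag M : exists B : int, forall i (U : {vspace M}) u,
  (forall v, v \in U -> op M i i v \in U) -> u \in U ->
  u \in spanv (fun v => v \in U /\ exists2 d : int, `|d| <= B & op M i i v = d%:~R *: v).
Proof.
have H i : exists B : nat, forall v, kill (fun=> op M i i)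
    [seq (tt, (b%:Z - B%:Z)%:~R) | b <- iota 0 (B + B).+1] v = 0 by apply: torus_kill.
pose Bf i := sval (constructive_indefinite_description _ (H i)).
have HB i : forall v, kill (fun=> op M i i)
    [seq (tt, (b%:Z - (Bf i)%:Z)%:~R) | b <- iota 0 (Bf i + Bf i).+1] v = 0.
  exact: (svalP (constructive_indefinite_description _ (H i))).
exists (\sum_i Bf i)%N%:Z => i U u hU uU.
pose rs : seq k := [seq (b%:Z - (Bf i)%:Z)%:~R | b <- iota 0 (Bf i + Bf i).+1].
have ur : uniq rs.
  rewrite map_inj_uniq ?iota_uniq // => a b /(intr_inj_pchar0 hk) /eqP.
  by rewrite (inj_eq (@addIr _ _)) => /eqP [].
have := @diag_spanv _ _ (op M i i) rs U u ur hU uU; rewrite -map_comp => /(_ (HB i u)).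
apply: subvP; apply: spanvS => v [vU [c /mapP [b]]]; rewrite mem_iota => bB -> hv.
split=> //; exists (b%:Z - (Bf i)%:Z) => //.
by have : (Bf i <= \sum_i Bf i)%N by [rewrite (bigD1 i) //= leq_addr]; lia.
Qed.

Lemma ev_stable_tmx M (U : {vspace M}) i (t : k) u : t != 0 -> ev_stable U -> u \in U ->
  grp M (tmx i t) u \in U.
Proof.
move=> t0 sU uU; have [B HB] := torus_diag M.
have := HB i U u (fun v => sU i i v (erefl _)) uU; apply: spanv_img.
by move=> v [vU [d _ hv]]; rewrite (grp_tmx_eigen hk hv t0) memvZ.
Qed.

Lemma ev_stable_xmx M (U : {vspace M}) i j (t : k) u : i != j -> blk i = blk j ->
  ev_stable U -> u \in U -> grp M (xmx i j t) u \in U.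
Proof.
move=> nij ij sU uU; apply: mem_functional => phi phiU.
apply: (@poly_family_eq0 _ hk _ U (op M i j) (fun u t => phi (grp M (xmx i j t) u))) => //.
- by move=> w wU; have [Q HQ _] := grp_xmx_poly phi w nij ij; exists Q.
- by move=> w Q wU HQ s; apply: grp_xmx_step.
- by move=> w wU; apply: sU.
- by move=> w wU; rewrite xmx0 grp1 phiU.
Qed.

Lemma ev_stable_grp M (U : {vspace M}) : ev_stable U -> grp_stable U.
Proof.
move=> sU a u ga; move: a ga u.
apply: (@G0_ind _ _ _ (fun a => forall u, u \in U -> grp M a u \in U))
    => [u|a b ga gb Ha Hb u|i j t nij ij u|i t t0 u] uU.
- by rewrite grp1.
- by rewrite grpM // Ha ?Hb.
- exact: ev_stable_xmx.
- exact: ev_stable_tmx.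
Qed.

(** A coefficient that vanishes along a one-parameter subgroup has zero derivative at the
    identity. *)
Lemma grp_stable_ev M (U : {vspace M}) : grp_stable U -> ev_stable U.
Proof.
move=> gU i j u ij uU; apply: mem_functional => phi phiU; rewrite /op.
have [eij|nij] := eqVneq i j.
  rewrite -eij; have [D [Q HQ HQ1]] := grp_tmx_poly phi u i.
  have Q0 : Q = 0.
    by apply: (poly_eq0_pchar0 hk) => t t0; rewrite HQ // phiU ?mulr0 // gU ?tmx_G0.
  by move: HQ1; rewrite Q0 deriv0 !horner0 mulr0 add0r => <-.
have [Q HQ ->] := grp_xmx_poly phi u nij ij.
have -> : Q = 0.
  by apply: (poly_eq0_pchar0 hk) => t _; rewrite -HQ phiU // gU ?xmx_G0.
by rewrite deriv0 horner0.
Qed.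

(** On root subgroups, the differences of the coefficients of both sides form a family to which
    [poly_family_eq0] applies; on the torus, weight vectors suffice. *)
Lemma ev_hom_grp M N (U : {vspace M}) (f : 'Hom(M, N)) : ev_stable U ->
  (forall i j u, blk i = blk j -> u \in U -> f (op M i j u) = op N i j (f u)) ->
  forall a u, a \in G0 k m n -> u \in U -> f (grp M a u) = grp N a (f u).
Proof.
move=> sU fU a u ga; move: a ga u.
apply: (@G0_ind _ _ _ (fun a => forall u, u \in U -> f (grp M a u) = grp N a (f u)))
    => [u|a b ga gb Ha Hb u|i j t nij ij u|i t t0 u] uU.
- by rewrite !grp1.
- by rewrite !grpM // Ha ?Hb // (ev_stable_grp sU).
- apply: eq_functional => phi; apply/eqP; rewrite -subr_eq0; apply/eqP.
  have phif_linear : linear (phi \o f : M -> k^o) by move=> c x y; rewrite /= !linearP.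
  pose phif : {linear M -> k^o} := HB.pack (phi \o f : M -> k^o)
    (GRing.isLinear.Build _ _ _ _ _ phif_linear).
  apply: (@poly_family_eq0 _ hk _ U (op M i j)
    (fun u t => phif (grp M (xmx i j t) u) - phi (grp N (xmx i j t) (f u)))) => //.
  + move=> w wU; have [Q1 HQ1 _] := grp_xmx_poly phif w nij ij.
    have [Q2 HQ2 _] := grp_xmx_poly phi (f w) nij ij.
    by exists (Q1 - Q2) => s; rewrite hornerD hornerN -HQ1 -HQ2.
  + move=> w Q wU HQ s; have [Q1 HQ1 _] := grp_xmx_poly phif w nij ij.
    have [Q2 HQ2 _] := grp_xmx_poly phi (f w) nij ij.
    have -> : Q = Q1 - Q2.
      by apply: (poly_eq_pchar0 hk) => r _; rewrite -HQ hornerD hornerN -HQ1 -HQ2.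
    rewrite derivB hornerD hornerN -(grp_xmx_step hk nij ij HQ1) fU //.
    by rewrite -(grp_xmx_step hk nij ij HQ2).
  + by move=> w wU; apply: sU.
  + by move=> w wU; rewrite xmx0 !grp1 subrr.
- have [B HB] := torus_diag M.
  have uS := HB i U u (fun v => sU i i v (erefl _)) uU.
  suff : ((f \o grp M (tmx i t)) - (grp N (tmx i t) \o f))%VF u \in 0%VS.
    by rewrite memv0 add_lfunE opp_lfunE !comp_lfunE subr_eq0 => /eqP.
  move: u uS {uU}; apply: spanv_img => v [vU [d _ hv]].
  have hfv : op N i i (f v) = d%:~R *: f v by rewrite -fU // hv lfunZ.
  rewrite add_lfunE opp_lfunE !comp_lfunE (grp_tmx_eigen hk hv t0).
  by rewrite (grp_tmx_eigen hk hfv t0) lfunZ subrr mem0v.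
Qed.

Definition pj M p : 'End(M) := daddv_pi (par M p) (par M (~~ p)).

Lemma par_cap M p : (par M p :&: par M (~~ p) = 0)%VS.
Proof.
by have := glmod_par_cap (glmodP M); case: p => //=; rewrite capvC.
Qed.

Lemma par_add M p : (par M p + par M (~~ p) = fullv)%VS.
Proof. by have := glmod_par_add (glmodP M); case: p => //=; rewrite addvC. Qed.

Lemma pj_par M p v : pj M p v \in par M p.
Proof. exact: memv_pi. Qed.

Lemma pj_id M p v : v \in par M p -> pj M p v = v.
Proof. by move=> vp; rewrite /pj daddv_pi_id ?par_cap. Qed.

Lemma pj_add M p v : v = pj M p v + pj M (~~ p) v.
Proof. by rewrite /pj negbK daddv_pi_add ?par_cap ?par_add ?memvf. Qed.

Lemma pj_neg M p v : v \in par M (~~ p) -> pj M p v = 0.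
Proof.
by move=> vp; apply: (@addIr _ v); rewrite add0r [in RHS](pj_add p v) (pj_id vp).
Qed.

Definition par_stable M (U : {vspace M}) := forall p u, u \in U -> pj M p u \in U.

Lemma par_stableE M (U : {vspace M}) : par_stable U <-> (U = U :&: par M false + U :&: par M true)%VS.
Proof.
split=> [hU|UE p u].
  apply/eqP; rewrite eqEsubv subv_add !capvSl !andbT; apply/subvP => u uU.
  by rewrite (pj_add false u) memv_add // memv_cap hU ?pj_par.
rewrite UE => /memv_addP [x]; rewrite memv_cap => /andP [xU xp] [y].
rewrite memv_cap => /andP [yU yp] ->; rewrite lfunD.
case: p; rewrite ?(pj_id yp) ?(pj_id xp) ?(@pj_neg _ true x xp) ?(@pj_neg _ false y yp).
  by rewrite add0r -UE.
by rewrite addr0 -UE.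
Qed.

Lemma submod_parity M (U : {vspace M}) : submod U -> par_stable U.
Proof. by case=> /par_stableE. Qed.

Lemma submod_lie M (U : {vspace M}) : submod U -> lie_stable U.
Proof. by case=> _ _ sU i j u; apply: sU. Qed.

Lemma submod_ev M (U : {vspace M}) : submod U -> ev_stable U.
Proof. by move=> /submod_lie sU i j u _; apply: sU. Qed.

Lemma lie_stable_submod M (U : {vspace M}) : par_stable U -> lie_stable U -> submod U.
Proof.
move=> hU sU; split; first exact/par_stableE.
  by apply: ev_stable_grp => i j u _; apply: sU.
by move=> X u; apply: lie_stable_lie.
Qed.

Lemma op_par M i j p v : v \in par M p -> op M i j v \in par M ((blk i (+) blk j) (+) p).
Proof. exact: (glmod_lie_par (glmodP M) (parity_delta k i j)). Qed.

Lemma pj_op M i j p v : pj M ((blk i (+) blk j) (+) p) (op M i j v) = op M i j (pj M p v).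
Proof.
rewrite [in LHS](pj_add p v) lfunD lfunD (pj_id (op_par i j (pj_par p v))).
have H : op M i j (pj M (~~ p) v) \in par M (~~ ((blk i (+) blk j) (+) p)).
  by rewrite -addbN op_par ?pj_par.
by rewrite (pj_neg H) addr0.
Qed.

Lemma pj_op_even M i j p v : blk i = blk j -> pj M p (op M i j v) = op M i j (pj M p v).
Proof. by move=> ij; rewrite -pj_op ij addbb. Qed.

Lemma hom_on_pj M N (S : pred 'M[k]_(m + n)) (U : {vspace M}) (f : 'Hom(M, N)) p u :
  par_stable U -> hom_on S U f -> u \in U -> f (pj M p u) = pj N p (f u).
Proof.
move=> hU [fp _ _] uU; rewrite [in RHS](pj_add p u) !lfunD.
by rewrite (pj_id (fp p _ (hU _ _ uU) (pj_par _ _))) (pj_neg (fp _ _ (hU _ _ uU) (pj_par _ _))) addr0.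
Qed.

(** [J] contains all positions where a matrix of [S] can be nonzero, so elementary matrices suffice;
    the group part follows from [ev_hom_grp]. *)
Lemma op_hom_on_gen M N (S : pred 'M[k]_(m + n)) (J : rel 'I_(m + n)) (U : {vspace M}) (f : 'Hom(M, N)) :
  ev_stable U -> (forall X i j, S X -> ~~ J i j -> X i j = 0) ->
  (forall i j, blk i = blk j -> J i j) ->
  (forall p u, u \in U -> u \in par M p -> f u \in par N p) ->
  (forall i j u, J i j -> u \in U -> f (op M i j u) = op N i j (f u)) ->
  hom_on S U f.
Proof.
move=> sU SJ evJ fp fop; split=> //.
  by apply: ev_hom_grp => // i j u /evJ; apply: fop.
move=> X u SX uU; rewrite !lieE lfun_sum; apply: eq_bigr => i _.
rewrite lfun_sum; apply: eq_bigr => j _; rewrite lfunZ.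
by have [/fop -> //|/(SJ _ _ _ SX) ->] := boolP (J i j); rewrite !scale0r.
Qed.

Lemma hom_on_op M N (U : {vspace M}) (f : 'Hom(M, N)) i j u :
  hom_on predT U f -> u \in U -> f (op M i j u) = op N i j (f u).
Proof. by case=> _ _ fl uU; rewrite /op fl. Qed.

Lemma op_hom_on M N (U : {vspace M}) (f : 'Hom(M, N)) : ev_stable U ->
  (forall p u, u \in U -> u \in par M p -> f u \in par N p) ->
  (forall i j u, u \in U -> f (op M i j u) = op N i j (f u)) ->
  hom_on predT U f.
Proof. by move=> sU fp fop; apply: (@op_hom_on_gen _ _ _ (fun _ _ => true)) => // i j u _; apply: fop. Qed.

Lemma op_hom_upper M N (U : {vspace M}) (f : 'Hom(M, N)) : ev_stable U ->
  (forall p u, u \in U -> u \in par M p -> f u \in par N p) ->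
  (forall i j u, blk i || ~~ blk j -> u \in U -> f (op M i j u) = op N i j (f u)) ->
  hom_on (upper_block k m n) U f.
Proof.
move=> sU fp fop; apply: (@op_hom_on_gen _ _ _ (fun i j => blk i || ~~ blk j)) => //.
  move=> X i j /eqP X0; rewrite negb_or negbK => /andP [bi bj].
  move: bi bj; case: (split_ordP i) => i' ->; case: (split_ordP j) => j' ->; rewrite !blkE // => _ _.
  by have := congr1 (fun Y : 'M_(_, _) => Y i' j') X0; rewrite !mxE.
by move=> i j ->; apply: orbN.
Qed.

Lemma hom_onS M N (S : pred 'M[k]_(m + n)) (U W : {vspace M}) (f : 'Hom(M, N)) :
  (W <= U)%VS -> hom_on S U f -> hom_on S W f.
Proof.
move=> /subvP WU [f1 f2 f3]; split=> [p u /WU|a u ga /WU|X u SX /WU]; [exact: f1|exact: f2|exact: f3].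
Qed.

Lemma hom_upper_op M N (U : {vspace M}) (f : 'Hom(M, N)) i j u :
  hom_on (upper_block k m n) U f -> blk i || ~~ blk j -> u \in U ->
  f (op M i j u) = op N i j (f u).
Proof.
case=> _ _ fl ij uU; rewrite /op fl // /upper_block /=; apply/eqP/matrixP => p q; rewrite !mxE.
case: (rshift m p =P i) => [pi|] //; case: (lshift n q =P j) => [qj|] //.
by move: ij; rewrite -pi -qj !blkE.
Qed.

Lemma op_is_hom M N (f : 'Hom(M, N)) :
  (forall p u, u \in par M p -> f u \in par N p) ->
  (forall i j u, f (op M i j u) = op N i j (f u)) -> is_hom f.
Proof. by move=> fp fop; apply: op_hom_on => [i j u _ _|p u _|i j u _] //; [apply: memvf|apply: fp]. Qed.

Lemma is_hom_op M N (f : 'Hom(M, N)) i j u : is_hom f -> f (op M i j u) = op N i j (f u).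
Proof. by move=> hf; apply: (hom_on_op i j hf); apply: memvf. Qed.

Lemma is_hom_par M N (f : 'Hom(M, N)) p u : is_hom f -> u \in par M p -> f u \in par N p.
Proof. by case=> fp _ _; apply: fp; apply: memvf. Qed.

Lemma par_stable_full M : par_stable (fullv : {vspace M}).
Proof. by move=> p u _; apply: memvf. Qed.

Lemma is_hom_pj M N (f : 'Hom(M, N)) p u : is_hom f -> f (pj M p u) = pj N p (f u).
Proof. by move=> hf; rewrite (hom_on_pj p (@par_stable_full M) hf) ?memvf. Qed.

Lemma submod_full M : submod (fullv : {vspace M}).
Proof. by apply: lie_stable_submod; [apply: par_stable_full|move=> i j u _; apply: memvf]. Qed.

Lemma submod0 M : submod (0 : {vspace M}).
Proof.
by apply: lie_stable_submod => [p u|i j u]; rewrite !memv0 => /eqP ->; rewrite lfun0.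
Qed.

Lemma submodI M (U W : {vspace M}) : submod U -> submod W -> submod (U :&: W)%VS.
Proof.
move=> sU sW; apply: lie_stable_submod => [p u|i j u]; rewrite !memv_cap => /andP [uU uW].
  by rewrite !(submod_parity _).
by rewrite !(submod_lie _).
Qed.

Lemma submodD M (U W : {vspace M}) : submod U -> submod W -> submod (U + W)%VS.
Proof.
move=> sU sW; apply: lie_stable_submod => [p u|i j u] /memv_addP [x xU [y yW ->]];
  rewrite lfunD memv_add //.
- exact: (submod_parity sU).
- exact: (submod_parity sW).
- exact: (submod_lie sU).
- exact: (submod_lie sW).
Qed.

Lemma submod_preim M N (U : {vspace M}) (f : 'Hom(M, N)) (Y : {vspace N}) :
  submod U -> hom_on predT U f -> submod Y -> submod (U :&: f @^-1: Y)%VS.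
Proof.
move=> sU hf sY; apply: lie_stable_submod => [p u|i j u]; rewrite !memv_cap -!memv_preim => /andP [uU fu].
  by rewrite (hom_on_pj p (submod_parity sU) hf uU) !(submod_parity _).
by rewrite (hom_on_op i j hf uU) !(submod_lie _).
Qed.

Lemma submod_img M N (U : {vspace M}) (f : 'Hom(M, N)) :
  submod U -> hom_on predT U f -> submod (f @: U)%VS.
Proof.
move=> sU hf; apply: lie_stable_submod => [p _|i j _] /memv_imgP [u uU ->].
  by rewrite -(hom_on_pj p (submod_parity sU) hf uU) memv_img // (submod_parity sU).
by rewrite -(hom_on_op i j hf uU) memv_img // (submod_lie sU).
Qed.

Lemma is_hom_comp M N (R : T) (f : 'Hom(M, N)) (g : 'Hom(N, R)) :
  is_hom f -> is_hom g -> is_hom (g \o f)%VF.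
Proof.
move=> hf hg; apply: op_is_hom => [p u up|i j u]; rewrite !comp_lfunE.
  by do 2!apply: is_hom_par => //.
by rewrite !is_hom_op.
Qed.

Lemma is_hom_id M : is_hom (\1%VF : 'End(M)).
Proof. by apply: op_is_hom => [p u|i j u]; rewrite !id_lfunE. Qed.

Lemma is_hom0 M N : is_hom (0 : 'Hom(M, N)).
Proof. by apply: op_is_hom => [p u|i j u]; rewrite !zero_lfunE ?mem0v ?lfun0. Qed.

End GlmodTheory.

(** * Subquotients *)

Section Subquotient.
Variables (k : fieldType) (hk : [pchar k] =i pred0) (m n : nat).
Notation T := (glmod k m n).
Implicit Types (M N X : T) (i j : 'I_(m + n)).

Section Construction.
Variables (M : T) (U W : {vspace M}) (sU : submod U) (sW : submod W).

Let C := (U :\: W)%VS.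

(** The quotient is carried by a linear complement [C]. As [W] is not assumed to lie in [U], it is
    the quotient of [U] by its intersection with [W]. *)
Definition sq_proj : 'Hom(M, subvs_of C) := linfun (vsproj C \o daddv_pi C W).
Definition sq_sect : 'Hom(subvs_of C, M) := linfun vsval.

Let CW0 : (C :&: W = 0)%VS. Proof. exact: capv_diff. Qed.

Let projE v : vsval (sq_proj v) = daddv_pi C W v.
Proof. by rewrite lfunE /= vsprojK // memv_pi. Qed.

Let sectE y : sq_sect y = vsval y. Proof. by rewrite lfunE. Qed.

Let proj_W v : v \in W -> sq_proj v = 0.
Proof.
move=> vW; apply: subvs_inj; rewrite projE linear0.
have := daddv_pi_add CW0 (subvP (addvSr C W) _ vW).
by rewrite (daddv_pi_id _ vW) 1?capvC // => /(canRL (addrK _)) ->; rewrite subrr.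
Qed.

Let sect_U y : sq_sect y \in U.
Proof. by rewrite sectE; apply: (subvP (diffvSl U W)); apply: subvsP. Qed.

Let sectK y : sq_proj (sq_sect y) = y.
Proof. by apply: subvs_inj; rewrite projE sectE daddv_pi_id // subvsP. Qed.

Let projK u : u \in U -> u - sq_sect (sq_proj u) \in W.
Proof.
move=> uU; rewrite sectE projE.
have uCW : u \in (C + W)%VS by rewrite /C addv_diff (subvP (addvSl _ _)).
by rewrite -{1}(daddv_pi_add CW0 uCW) addrC addKr memv_pi.
Qed.

Let ker_proj u : u \in U -> sq_proj u = 0 -> u \in W.
Proof. by move=> uU u0; have := projK uU; rewrite u0 linear0 subr0. Qed.

Let proj_stable (f : 'End(M)) : (forall w, w \in W -> f w \in W) ->
  forall u, u \in U -> sq_proj (f (sq_sect (sq_proj u))) = sq_proj (f u).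
Proof.
move=> fW u uU; apply/esym/eqP; rewrite -subr_eq0 -!lfunB.
by rewrite (proj_W (fW _ (projK uU))).
Qed.

Definition sq_par p : {vspace subvs_of C} := (sq_proj @: (U :&: par M p))%VS.
Definition sq_grp a : 'End(subvs_of C) := (sq_proj \o (grp M a \o sq_sect))%VF.
Definition sq_lie_fun (X : 'M[k]_(m + n)) : 'End(subvs_of C) := (sq_proj \o (lie M X \o sq_sect))%VF.

Lemma sq_lie_linear : linear sq_lie_fun.
Proof.
by move=> c X Y; rewrite /sq_lie_fun linearP comp_lfunDl comp_lfunDr -comp_lfunZl -comp_lfunZr.
Qed.

Definition sq_lie : {linear 'M[k]_(m + n) -> 'End(subvs_of C)} :=
  HB.pack sq_lie_fun (GRing.isLinear.Build _ _ _ _ _ sq_lie_linear).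

Let grpE a y : sq_grp a y = sq_proj (grp M a (sq_sect y)).
Proof. by rewrite /sq_grp !comp_lfunE. Qed.

Let lieEq (X : 'M[k]_(m + n)) y : sq_lie X y = sq_proj (lie M X (sq_sect y)).
Proof. by rewrite /= /sq_lie_fun !comp_lfunE. Qed.

Let lieW (X : 'M[k]_(m + n)) w : w \in W -> lie M X w \in W.
Proof. by case: sW => _ _; apply. Qed.

Let lieU (X : 'M[k]_(m + n)) w : w \in U -> lie M X w \in U.
Proof. by case: sU => _ _; apply. Qed.

Let proj_lie (X : 'M[k]_(m + n)) u : u \in U -> sq_proj (lie M X u) = sq_lie X (sq_proj u).
Proof. by move=> uU; rewrite lieEq proj_stable //; apply: lieW. Qed.

Let proj_grp a u : a \in G0 k m n -> u \in U -> sq_proj (grp M a u) = sq_grp a (sq_proj u).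
Proof. by case: sW => _ gW _ ga uU; rewrite grpE proj_stable // => w; apply: gW. Qed.

Let proj_par p u : u \in U -> u \in par M p -> sq_proj u \in sq_par p.
Proof. by move=> uU up; rewrite memv_img // memv_cap uU. Qed.

Lemma sq_axioms : glmod_axioms sq_par sq_grp sq_lie.
Proof.
have gU : grp_stable U by case: sU.
split.
- apply/eqP; rewrite -subv0; apply/subvP => y; rewrite memv_cap => /andP [].
  case/memv_imgP => u; rewrite memv_cap => /andP [uU u0] ->.
  case/memv_imgP => w; rewrite memv_cap => /andP [wU w1] E.
  have /(submod_parity sW) : u - w \in W by apply: ker_proj; rewrite ?memvB // lfunB E subrr.
  move=> /(_ false); rewrite lfunB (pj_id u0) (@pj_neg _ _ _ _ false) // subr0 => uW.
  by rewrite proj_W ?mem0v.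
- apply/eqP; rewrite eqEsubv subvf /=; apply/subvP => y _.
  rewrite -[y]sectK (pj_add false (sq_sect y)) lfunD memv_add // proj_par ?pj_par //.
    by rewrite (submod_parity sU).
  by rewrite (submod_parity sU).
- by apply/lfunP => y; rewrite grpE grp1 id_lfunE sectK.
- move=> a b ga gb; apply/lfunP => y; rewrite comp_lfunE grpE grpM // proj_grp ?gU //.
  by rewrite -grpE.
- move=> a p y ga /memv_imgP [u]; rewrite memv_cap => /andP [uU up] ->.
  rewrite -proj_grp // proj_par ?gU //.
  exact: (glmod_grp_par (glmodP M)).
- move=> X p q y Xp /memv_imgP [u]; rewrite memv_cap => /andP [uU uq] ->.
  rewrite -proj_lie // proj_par ?lieU //.
  exact: (glmod_lie_par (glmodP M)).
- move=> X Y p q y Xp Yq; rewrite -[y]sectK -!proj_lie ?lieU //.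
  by rewrite (glmod_bracket (glmodP M) _ Xp Yq) lfunB lfunZ.
- move=> a X y ga; rewrite -[y]sectK -proj_lie // -!proj_grp ?lieU //.
  by rewrite (glmod_Ad (glmodP M)) // proj_lie // gU.
- move=> phi y.
  have psi_linear : linear (phi \o sq_proj : M -> k^o) by move=> c u v; rewrite /= !linearP.
  pose psi : {linear M -> k^o} := HB.pack (phi \o sq_proj : M -> k^o)
    (GRing.isLinear.Build _ _ _ _ _ psi_linear).
  have [P [Pg Pl]] := glmod_alg (glmodP M) psi (sq_sect y).
  exists P; split=> [a ga|X eX]; first by rewrite -Pg // grpE.
  by rewrite -Pl // lieEq.
Qed.

Definition subquot : T := GLMod sq_axioms.

Definition subquot_proj : 'Hom(M, subquot) := sq_proj.

Lemma subquot_hom : hom_on predT U subquot_proj.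
Proof.
split=> [p u|a u ga|X u _].
- exact: proj_par.
- exact: proj_grp.
- exact: proj_lie.
Qed.

Lemma subquot_surj (y : subquot) : exists2 u, u \in U & subquot_proj u = y.
Proof. by exists (sq_sect y); [apply: sect_U|apply: sectK]. Qed.

Lemma subquot_ker u : u \in U -> subquot_proj u = 0 <-> u \in W.
Proof. by move=> uU; split; [apply: ker_proj|apply: proj_W]. Qed.

End Construction.

Definition is_subquot M N (U W : {vspace M}) (q : 'Hom(M, N)) :=
  [/\ hom_on predT U q, forall y, exists2 u, u \in U & q u = y &
      forall u, u \in U -> q u = 0 <-> u \in W].

Lemma subquot_exists M (U W : {vspace M}) : submod U -> submod W ->
  exists (N : T) (q : 'Hom(M, N)), is_subquot U W q.
Proof.
move=> sU sW; exists (subquot sU sW), (subquot_proj sU sW); split.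
- exact: subquot_hom.
- exact: subquot_surj.
- exact: subquot_ker.
Qed.

Lemma lfun_section (V V' : vectType k) (U : {vspace V}) (f : 'Hom(V, V')) :
  exists s : 'Hom(V', V), (forall y, s y \in U) /\ (forall u, u \in U -> f (s (f u)) = f u).
Proof.
pose g := (f \o projv U)%VF; exists (projv U \o g^-1)%VF; split=> [y|u uU].
  by rewrite comp_lfunE memv_proj.
have fu : f u = g u by rewrite comp_lfunE projv_id.
have E y : f ((projv U \o g^-1)%VF y) = g (g^-1%VF y) by rewrite !comp_lfunE.
by rewrite E fu limg_lfunVK // memv_img // memvf.
Qed.

Lemma subquot_factor M N X (U W : {vspace M}) (q : 'Hom(M, N)) (g : 'Hom(M, X)) :
  submod U -> is_subquot U W q -> hom_on predT U g -> (forall w, w \in W -> g w = 0) ->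
  exists2 h : 'Hom(N, X), is_hom h & forall u, u \in U -> h (q u) = g u.
Proof.
move=> sU [hq surj ker] hg gW; have [s [sUin sK]] := lfun_section U q.
have hE u : u \in U -> (g \o s)%VF (q u) = g u.
  move=> uU; rewrite comp_lfunE; apply/eqP; rewrite -subr_eq0 -lfunB gW //.
  by apply/ker; rewrite ?memvB // lfunB sK // subrr.
exists (g \o s)%VF => //; apply: (op_is_hom hk) => [p y|i j y].
  have [u uU <-] := surj y => yp; rewrite hE //.
  have yE : q u = q (pj M p u) by rewrite (hom_on_pj p (submod_parity sU) hq uU) pj_id.
  rewrite -hE // yE hE ?(submod_parity sU) //; case: hg => gp _ _.
  by rewrite gp ?(submod_parity sU) ?pj_par.
have [u uU <-] := surj y.
rewrite -(hom_on_op i j hq uU) !hE ?(submod_lie sU) //.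
exact: hom_on_op hg uU.
Qed.

End Subquotient.

(** * Degrees *)

Section Degree.
Variables (k : fieldType) (hk : [pchar k] =i pred0) (m n : nat).
Notation T := (glmod k m n).
Implicit Types (M N K Q X : T) (i j : 'I_(m + n)) (c d : int).

(** The grading element: central in the even part, with g_1 in degree 1 and the odd lower matrices
    in degree -1; on a vector of weight [lam] its eigenvalue is [deg lam]. *)
Definition zop M : 'End(M) := \sum_(i | blk i) op M i i.

Lemma zopE M v : zop M v = \sum_(i | blk i) op M i i v.
Proof. exact: sum_lfunE. Qed.

Definition isdeg M c (v : M) := zop M v = c%:~R *: v.

Definition dsp M c : {vspace M} := lker (zop M - c%:~R *: \1%VF).

Lemma dspP M c v : v \in dsp M c <-> isdeg c v.
Proof.
rewrite memv_ker add_lfunE opp_lfunE scale_lfunE id_lfunE subr_eq0.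
by split=> /eqP.
Qed.

Lemma zop_op M i j v :
  zop M (op M i j v) = op M i j (zop M v) + ((blk i)%:R - (blk j)%:R) *: op M i j v.
Proof.
rewrite !zopE lfun_sum.
under eq_bigr => p _ do rewrite op_bracket_even // -addrA.
rewrite big_split sumrB /= scalerBl; congr (_ + (_ - _)).
  have [bi|bi] := boolP (blk i).
    rewrite (bigD1 i) //= eqxx big1 ?addr0 // => p /andP [_ /negPf ->].
    by rewrite scale0r.
  rewrite scale0r big1 // => p bp.
  by rewrite (_ : (p == i) = false) ?scale0r //; apply: contraNF bi => /eqP <-.
have [bj|bj] := boolP (blk j).
  rewrite (bigD1 j) //= eqxx big1 ?addr0 // => p /andP [_].
  by rewrite eq_sym => /negPf ->; rewrite scale0r.
rewrite scale0r big1 // => p bp.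
by rewrite (_ : (j == p) = false) ?scale0r //; apply: contraNF bj => /eqP ->.
Qed.

Lemma isdeg_op M c i j v : isdeg c v -> isdeg (c + ((blk i)%:R - (blk j)%:R)) (op M i j v).
Proof.
by move=> cv; rewrite /isdeg zop_op cv lfunZ -scalerDl rmorphD rmorphB !rmorph_nat.
Qed.

Lemma isdeg_hom M N (U : {vspace M}) (f : 'Hom(M, N)) c v :
  hom_on predT U f -> ev_stable U -> v \in U -> isdeg c v -> isdeg c (f v).
Proof.
move=> hf sU vU cv; rewrite /isdeg zopE -lfunZ -cv zopE lfun_sum.
by apply: eq_bigr => i _; rewrite (hom_on_op i i hf vU).
Qed.

Lemma isdeg_is_hom M N (f : 'Hom(M, N)) c v : is_hom f -> isdeg c v -> isdeg c (f v).
Proof. by move=> hf; apply: isdeg_hom hf _ (memvf _) => i j u _ _; apply: memvf. Qed.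

Lemma deg_indep M c (x : M) : isdeg c x ->
  x \in spanv (fun v => exists2 c', c' != c & isdeg c' v) -> x = 0.
Proof.
move=> cx xS; apply: (@eigen_indep _ _ unit (fun=> zop M) _ (fun=> c%:~R)) => //.
apply: (subvP (spanvS _) _ xS) => v [c' cc' cv]; exists tt, c'%:~R; split=> //.
by rewrite (inj_eq (intr_inj_pchar0 hk)).
Qed.

Lemma op_even_comm M i j p q (v : M) : blk i == blk j -> blk p == blk q ->
  op M i j (op M p q v) = op M p q (op M i j v) + (j == p)%:R *: op M i q v
    - (q == i)%:R *: op M p j v.
Proof. by move=> /eqP ij _; apply: op_bracket_even. Qed.

Lemma isdeg_wt M (l : 'I_(m + n) -> int) v : is_wt (op M) l v -> isdeg (\sum_(i | blk i) l i) v.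
Proof.
move=> lv; rewrite /isdeg zopE rmorph_sum scaler_suml.
by apply: eq_bigr => i _; rewrite lv.
Qed.

Lemma deg_span M (U : {vspace M}) u : ev_stable U -> u \in U ->
  u \in spanv (fun v => v \in U /\ exists c, isdeg c v).
Proof.
move=> sU uU; have [B HB] := torus_diag hk M.
have := wt_span (@op_even_comm M) HB (fun i v => sU i i v (erefl _)) uU.
apply: subvP; apply: spanvS => v [vU [l lv]]; split=> //.
by exists (\sum_(i | blk i) l i); apply: isdeg_wt.
Qed.

Lemma deg_bound M : exists B : nat, forall c (v : M), isdeg c v -> v != 0 -> `|c| <= B%:Z.
Proof.
have [B HB] := torus_diag hk M; exists ((m + n) * `|B|)%N => c v cv v0.
rewrite leNgt; apply/negP => cB; case/eqP: v0; apply: (deg_indep cv).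
have := wt_span (@op_even_comm M) HB (fun i v _ => memvf _) (memvf v).
apply: subvP; apply: spanv_sub => w [_ [l lw]]; have [->|w0] := eqVneq w 0; first exact: mem0v.
apply: spanv_in; exists (\sum_(i | blk i) l i); last exact: isdeg_wt.
apply: contraTneq cB => <-; rewrite -leNgt.
apply: le_trans (ler_norm_sum _ _ _) _.
apply: (@le_trans _ _ (\sum_(i < m + n) `|B|)).
  rewrite big_mkcond /=; apply: ler_sum => i _.
  have := wt_bound hk HB i lw w0.
  by case: ifP => _ lB; [apply: le_trans lB _; rewrite ler_norm|rewrite normr_ge0].
by rewrite sumr_const card_ord -mulr_natl; lia.
Qed.

Lemma deg_decomp M (U : {vspace M}) u c : ev_stable U -> u \in U -> exists x y,
  [/\ u = x + y, x \in U /\ isdeg c x, y \in U &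
      y \in spanv (fun v => v \in U /\ exists2 c', c' != c & isdeg c' v)].
Proof.
move=> sU uU; set D := (fun v => v \in U /\ exists2 c', c' != c & isdeg c' v).
have /subvP H : (spanv (fun v => v \in U /\ exists c, isdeg c v) <= (U :&: dsp M c) + spanv D)%VS.
  apply: spanv_sub => v [vU [c' cv]]; have [E|cc'] := eqVneq c' c.
    by apply: (subvP (addvSl _ _)); rewrite memv_cap vU; apply/dspP; rewrite -E.
  by apply: (subvP (addvSr _ _)); apply: spanv_in; split=> //; exists c'.
have /memv_addP [x] := H _ (deg_span sU uU).
rewrite memv_cap => /andP [xU /dspP cx] [y yD uE]; exists x, y; split=> //.
by apply: (subvP (spanv_sub _) _ yD) => v [].
Qed.

Lemma ev_stable_dsp M c : ev_stable (dsp M c).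
Proof.
move=> i j u ij /dspP cu; apply/dspP; have := isdeg_op i j cu.
by rewrite ij subrr addr0.
Qed.

Lemma par_stable_dsp M c : par_stable (dsp M c).
Proof.
move=> p u /dspP cu; apply/dspP; rewrite /isdeg -lfunZ -cu !zopE lfun_sum.
by apply: eq_bigr => i _; rewrite pj_op_even.
Qed.

(** The intrinsic version of a sum of Kac modules of degree [d]: the inducing space is the whole
    eigenspace, so no decomposition is chosen. *)
Definition pure d Q :=
  (forall i j v, blk i -> ~~ blk j -> isdeg d v -> op Q i j v = 0) /\
  induced_from (dsp Q d).

Lemma hom_on_upper_is_hom M N (L : {vspace M}) (f : 'Hom(M, N)) :
  is_hom f -> hom_on (upper_block k m n) L f.
Proof.
case=> f1 f2 f3; split=> [p u _|a u ga _|X u _ _]; [exact/f1/memvf|exact/f2/memvf|].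
by apply: f3; rewrite ?memvf.
Qed.

Lemma induced_unique K X (L : {vspace K}) (g g' : 'Hom(K, X)) :
  induced_from L -> is_hom g -> is_hom g' -> {in L, g =1 g'} -> g = g'.
Proof.
move=> iL hg hg' gg'; have [g0 [_ g0U]] := iL X g (hom_on_upper_is_hom L hg).
by rewrite -(g0U g) // -(g0U g') //; split=> // u /gg'.
Qed.

(** The projection to the quotient by [Y] and the zero map agree on [L], hence are equal. *)
Lemma induced_gen K (L Y : {vspace K}) : induced_from L -> submod Y -> (L <= Y)%VS -> Y = fullv.
Proof.
move=> iL sY /subvP LY; have [Q [q [hq _ ker]]] := subquot_exists (@submod_full k hk m n K) sY.
have q0 : q = 0.
  apply: (induced_unique iL hq); first exact: is_hom0.
  by move=> u /LY uY; rewrite zero_lfunE; apply/ker; rewrite ?memvf.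
apply/eqP; rewrite eqEsubv subvf; apply/subvP => u _.
by apply/(ker u (memvf u)); rewrite q0 zero_lfunE.
Qed.

(** By triangularity, the odd lower matrices applied to [L] already yield a submodule, which is
    everything by [induced_gen]; each of them lowers the degree by one. *)
Lemma induced_low K (L : {vspace K}) d : induced_from L -> par_stable L -> ev_stable L ->
  (forall i j v, blk i -> ~~ blk j -> v \in L -> op K i j v = 0) -> (L <= dsp K d)%VS ->
  (fullv <= L + spanv (fun v => exists2 c, (c < d)%R & isdeg c v))%VS.
Proof.
move=> iL pL eL uL Ld; pose rop (p : 'I_(m + n) * 'I_(m + n)) := op K p.1 p.2.
pose low (p : 'I_(m + n) * 'I_(m + n)) := ~~ blk p.1 && blk p.2.
pose Z := clos rop low (fun v => v \in L).
have ZL : lie_stable Z.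
  move=> i j v vZ; rewrite -[op K i j]/(rop (i, j)).
  apply: (@clos_low_stable _ _ _ rop low (fun v => v \in L)) => // [[a b] w|[a b] [p q] w _ _].
    rewrite /low /rop negb_and negbK /= => ab wL.
    have [ev|nev] := eqVneq (blk a) (blk b); first by apply: clos_in; apply: eL.
    rewrite uL ?mem0v //; first by move: ab nev; case: (blk a); case: (blk b).
    by move: ab nev; case: (blk a); case: (blk b).
  pose sgn : k := (-1) ^+ ((blk a (+) blk b) && (blk p (+) blk q)).
  exists sgn, (a, q), (b == p)%:R, (p, b), (- (sgn * (q == a)%:R)).
  by rewrite /rop /= op_bracket scaleNr.
have ZP : par_stable Z.
  have [Y HY] : exists Y : {vspace K}, forall v, v \in Y <-> v \in Z /\ forall p, pj K p v \in Z.
    apply: vspace_of_pred => [|a u v [uZ uP] [vZ vP]].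
      by split=> [|p]; rewrite ?lfun0 mem0v.
    by split=> [|p]; rewrite ?lfunD ?lfunZ memvD ?memvZ.
  suff /subvP ZY : (Z <= Y)%VS by move=> p u /ZY /HY [].
  apply: clos_sub => [v vL|[i j] lij v /HY [vZ vP]]; apply/HY.
    by split=> [|p]; apply: clos_in => //; apply: pL.
  split=> [|p]; first exact: clos_op.
  by rewrite -[p](addKb (blk i (+) blk j)) pj_op -[op K i j]/(rop (i, j)) clos_op.
have ZE : Z = fullv.
  by apply: (induced_gen iL (lie_stable_submod hk ZP ZL)); apply/subvP => v; apply: clos_in.
rewrite -ZE; apply: clos_sub => [v|[i j] /andP [/= bi bj] v /memv_addP [x xL [y yS ->]]].
  exact: (subvP (addvSl _ _)).
rewrite lfunD; apply: (subvP (addvSr _ _)); apply: memvD.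
  apply: spanv_in; exists (d - 1); first by lia.
  have := isdeg_op i j (iffLR (dspP _ _) (subvP Ld _ xL)).
  by rewrite bj (negPf bi) sub0r.
move: y yS; apply: spanv_img => y [c cd cy]; apply: spanv_in; exists (c - 1); first by lia.
by have := isdeg_op i j cy; rewrite bj (negPf bi) sub0r.
Qed.

Lemma pure_span d Q : pure d Q ->
  (fullv <= dsp Q d + spanv (fun v => exists2 c, (c < d)%R & isdeg c v))%VS.
Proof.
move=> [uQ iQ]; apply: induced_low => //.
- exact: par_stable_dsp.
- exact: ev_stable_dsp.
- by move=> i j v bi bj /dspP; apply: uQ.
Qed.

Lemma pure_deg d Q c v : pure d Q -> isdeg c v -> (d < c)%R -> v = 0 :> Q.
Proof.
move=> /pure_span /subvP /(_ v (memvf v)) vS cv dc; apply: (deg_indep cv).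
apply: (subvP _ _ vS); rewrite subv_add; apply/andP; split.
  apply/subvP => w /dspP dw; apply: spanv_in; exists d => //; lia.
by apply: spanvS => w [c' cc' cw]; exists c' => //; lia.
Qed.

Lemma pure_gen d Q (Y : {vspace Q}) : pure d Q -> submod Y -> (dsp Q d <= Y)%VS -> Y = fullv.
Proof. by case=> _; apply: induced_gen. Qed.

Lemma kac_pure (lam : weight m n) K : is_kac lam K -> pure (deg lam) K.
Proof.
move=> [domlam [L [p [Lp [L0 gL Lirr] [v vL [v0 vlam vhw]] g1L iL]]]].
have eL := grp_stable_ev hk gL.
have uL i j w : blk i -> ~~ blk j -> w \in L -> op K i j w = 0.
  move=> bi bj wL; apply: g1L => //; apply/andP; split.
    by have := parity_delta k i j; rewrite bi (negPf bj).
  apply/eqP/matrixP => a b; rewrite !mxE.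
  case: (rshift m a =P i) => [ai|] //; case: (lshift n b =P j) => [bj'|] //.
  by move: bj; rewrite -bj' blkE.
have degv : isdeg (deg lam) v.
  have := @isdeg_wt K lam v vlam; rewrite /deg.
  rewrite big_split_ord /= [X in _ + X]big1 ?addr0 => [|i]; last by rewrite blkE.
  by rewrite (eq_bigl xpredT) // => i; rewrite blkE.
(* Irreducibility: the part of [L] of degree [deg lam] is stable and contains [v]. *)
have Ld : (L <= dsp K (deg lam))%VS.
  have [||E|E] := Lirr (L :&: dsp K (deg lam))%VS.
  - exact: capvSl.
  - apply: (ev_stable_grp hk) => i j u ij; rewrite !memv_cap => /andP [uL' ud].
    by rewrite eL // ev_stable_dsp.
  - case/eqP: v0; apply/eqP; rewrite -memv0 -E memv_cap vL; exact/dspP.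
  - by rewrite -E capvSr.
have pL : par_stable L.
  move=> q u uL'; have up := subvP Lp _ uL'.
  have [->|qp] := eqVneq q p; first by rewrite pj_id.
  rewrite pj_neg ?mem0v //; move: up; rewrite (_ : p = ~~ q) //.
  by move: qp; case: (q); case: (p).
have /subvP LS := induced_low iL pL eL uL Ld.
(* By [LS] the module is [L] plus vectors of smaller degree, so [L] is the full eigenspace. *)
suff LE : L = dsp K (deg lam).
  split; last by rewrite -LE.
  by move=> i j w bi bj /dspP; rewrite -LE; apply: uL.
apply/eqP; rewrite eqEsubv Ld; apply/subvP => w wd.
have /memv_addP [x xL [y yS wE]] := LS w (memvf w).
suff y0 : y = 0 by rewrite wE y0 addr0.
apply: (@deg_indep _ (deg lam)).
  apply/dspP; have -> : y = w - x by rewrite wE addrC addKr.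
  by rewrite memvB // (subvP Ld).
by apply: (subvP (spanvS _) _ yS) => s [c cd cs]; exists c => //; lia.
Qed.

End Degree.

(** * Pure modules *)

Section Pure.
Variables (k : fieldType) (hk : [pchar k] =i pred0) (m n : nat).
Notation T := (glmod k m n).
Implicit Types (M N Q X : T) (c d : int).

(** The grading element is diagonalisable, so the degree [c] component of [u] is a lift; the other
    components go to other degrees. *)
Lemma subquot_deg_lift M N (U : {vspace M}) (q : 'Hom(M, N)) c u :
  hom_on predT U q -> ev_stable U -> u \in U -> isdeg c (q u) ->
  exists x, [/\ x \in U, isdeg c x & q x = q u].
Proof.
move=> hq sU uU cqu; have [x [y [uE [xU cx] yU yS]]] := deg_decomp hk c sU uU.
exists x; split=> //; suff qy : q y = 0 by rewrite uE lfunD qy addr0.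
apply: (@deg_indep _ hk _ _ _ c).
  have -> : q y = q u - q x by rewrite uE lfunD addrC addKr.
  by apply/dspP; rewrite memvB //; apply/dspP => //; apply: isdeg_hom hq sU xU cx.
move: y yS {uE yU}; apply: spanv_img => v [vU [c' cc' cv]].
by apply: spanv_in; exists c' => //; apply: isdeg_hom hq sU vU cv.
Qed.

(** The universal property of [Q] extends [f \o t], and composing with [s] gives the extension of
    [f]; uniqueness is tested on [Q], where [t] is onto. *)
Lemma pure_retract d Q Q' (s : 'Hom(Q', Q)) (t : 'Hom(Q, Q')) :
  is_hom s -> is_hom t -> (forall v, t (s v) = v) -> pure d Q -> pure d Q'.
Proof.
move=> hs ht ts [uQ iQ]; split=> [i j v bi bj dv|X f hf].
  by rewrite -[v]ts -(is_hom_op i j _ ht) uQ ?linear0 //; apply: isdeg_is_hom.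
have td v : v \in dsp Q d -> t v \in dsp Q' d.
  by move=> /dspP dv; apply/dspP; apply: isdeg_is_hom.
have hft : hom_on (upper_block k m n) (dsp Q d) (f \o t)%VF.
  apply: (op_hom_upper hk) => [|p u ud up|i j u ij ud]; first exact: ev_stable_dsp.
    by rewrite comp_lfunE; case: hf => hf1 _ _; apply: hf1; [apply: td|apply: is_hom_par].
  by rewrite !comp_lfunE (is_hom_op i j _ ht) (hom_upper_op hf) ?td.
have [g [[hg gft] _]] := iQ X _ hft; exists (g \o s)%VF; split.
  split=> [|v /dspP vd]; first exact: is_hom_comp.
  by rewrite comp_lfunE gft ?comp_lfunE ?ts //; apply/dspP; apply: isdeg_is_hom.
move=> h [hh hf']; have E : g = (h \o t)%VF.
  apply: (induced_unique iQ hg); first exact: is_hom_comp.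
  by move=> v vd; rewrite gft // !comp_lfunE hf' ?td.
by apply/lfunP => v; rewrite E !comp_lfunE ts.
Qed.

Section Sum.
Variables (J : finType) (K : J -> T) (Q : T) (q : forall j, 'Hom(Q, K j)) (d : int).
Hypothesis hq : forall j, is_hom (q j).
Hypothesis surj : forall y : (forall j, K j), exists u, forall j, q j u = y j.
Hypothesis inj : forall u, (forall j, q j u = 0) -> u = 0.

Let S j : {vspace Q} := (\bigcap_(i | i != j) lker (q i))%VS.

Let SP j u : u \in S j <-> forall i, i != j -> q i u = 0.
Proof.
rewrite memvE; split=> [/subv_bigcapP uS i ij|uS].
  by have := uS i ij; rewrite -memvE memv_ker => /eqP.
by apply/subv_bigcapP => i ij; rewrite -memvE memv_ker uS.
Qed.

Let S_surj j y : exists2 u, u \in S j & q j u = y.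
Proof.
(* The family equal to [y] at [j] and zero elsewhere; the transport is needed because the types
   [K i] vary. *)
pose y' i : K i := if i =P j is ReflectT e then eq_rect_r (fun i => K i) y e else 0.
have [u uE] := surj y'; exists u.
  by apply/SP => i /eqP ij; rewrite uE /y'; case: (i =P j).
rewrite uE /y'; case: (j =P j) => // e.
by rewrite (eq_axiomK e).
Qed.

Let section_exists j : exists s : 'Hom(K j, Q), is_hom s /\
  forall y, q j (s y) = y /\ forall i, i != j -> q i (s y) = 0.
Proof.
have [s [sS sK]] := lfun_section (S j) (q j).
have qs y : q j (s y) = y /\ forall i, i != j -> q i (s y) = 0.
  by split; [have [u uS <-] := S_surj y; rewrite sK|apply/SP].
exists s; split=> //.
have sE u y : q j u = y -> (forall i, i != j -> q i u = 0) -> s y = u.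
  move=> uy u0; apply/eqP; rewrite -subr_eq0; apply/eqP; apply: inj => i; rewrite lfunB.
  have [->|ij] := eqVneq i j; first by rewrite (qs y).1 uy subrr.
  by rewrite (qs y).2 // u0 // subrr.
apply: (op_is_hom hk) => [p y yp|a b y].
  rewrite (sE (pj Q p (s y)) y) ?pj_par // => [|i ij].
    by rewrite is_hom_pj // (qs y).1 pj_id.
  by rewrite is_hom_pj // (qs y).2 // linear0.
apply: sE => [|i ij]; first by rewrite is_hom_op // (qs y).1.
by rewrite is_hom_op // (qs y).2 // linear0.
Qed.

Lemma pure_sum : (forall j, pure d (K j)) -> pure d Q.
Proof.
move=> pK; pose s j := sval (constructive_indefinite_description _ (section_exists j)).
have hs j : is_hom (s j) by case: (svalP (constructive_indefinite_description _ (section_exists j))).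
have qs j y : q j (s j y) = y /\ forall i, i != j -> q i (s j y) = 0.
  by case: (svalP (constructive_indefinite_description _ (section_exists j))).
have sumE u : u = \sum_j s j (q j u).
  apply/eqP; rewrite -subr_eq0; apply/eqP; apply: inj => j.
  rewrite lfunB lfun_sum (bigD1 j) //= (qs j _).1 big1 ?addr0 ?subrr // => i ij.
  by rewrite (qs i _).2 // eq_sym.
split=> [i j v bi bj dv|X f hf].
  apply: inj => a; rewrite is_hom_op //; case: (pK a) => uK _; apply: uK => //.
  exact: isdeg_is_hom.
have sd j y : y \in dsp (K j) d -> s j y \in dsp Q d.
  by move=> /dspP dy; apply/dspP; apply: isdeg_is_hom.
have hfs j : hom_on (upper_block k m n) (dsp (K j) d) (f \o s j)%VF.
  apply: (op_hom_upper hk) => [|p u ud up|a b u ab ud]; first exact: ev_stable_dsp.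
    by rewrite comp_lfunE; case: hf => hf1 _ _; apply: hf1; [apply: sd|apply: is_hom_par].
  by rewrite !comp_lfunE (is_hom_op a b _ (hs j)) (hom_upper_op hf) ?sd.
have gex j : exists g : 'Hom(K j, X), is_hom g /\ {in dsp (K j) d, g =1 (f \o s j)%VF}.
  by have [_ iK] := pK j; have [g [Hg _]] := iK X _ (hfs j); exists g.
pose g j := sval (constructive_indefinite_description _ (gex j)).
have hg j : is_hom (g j) by case: (svalP (constructive_indefinite_description _ (gex j))).
have gE j : {in dsp (K j) d, g j =1 (f \o s j)%VF}.
  by case: (svalP (constructive_indefinite_description _ (gex j))).
have GE v : (\sum_j (g j \o q j)%VF) v = \sum_j g j (q j v).
  by rewrite sum_lfunE; apply: eq_bigr => j _; rewrite comp_lfunE.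
exists (\sum_j (g j \o q j)%VF); split.
  split=> [|v /dspP dv]; last first.
    rewrite GE [v in RHS]sumE lfun_sum; apply: eq_bigr => j _.
    by rewrite gE ?comp_lfunE //; apply/dspP; apply: isdeg_is_hom.
  apply: (op_is_hom hk) => [p u up|a b u]; rewrite !GE.
    by apply: rpred_sum => j _; do 2![apply: is_hom_par => //].
  by rewrite lfun_sum; apply: eq_bigr => j _; rewrite !is_hom_op.
move=> h [hh hE]; apply/lfunP => v; rewrite GE [v in RHS]sumE lfun_sum.
apply: eq_bigr => j _; rewrite -[h _](comp_lfunE h (s j)); congr (fun_of_lfun _ _).
have [_ iK] := pK j; apply: (induced_unique iK (hg j)); first exact: is_hom_comp.
by move=> y yd; rewrite gE // !comp_lfunE hE ?sd.
Qed.

End Sum.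

Definition pure_subquot M d (U W : {vspace M}) :=
  exists (N : T) (q : 'Hom(M, N)), is_subquot U W q /\ pure d N.

Lemma sum_pure_subquot M d (U W : {vspace M}) (J : finType) (K : J -> T) :
  submod U -> submod W -> quotient_iso_sum U W K -> (forall j, pure d (K j)) ->
  pure_subquot d U W.
Proof.
move=> sU sW [r [hr rS rK]] pK; have [N [q qUW]] := subquot_exists sU sW.
exists N, q; split=> //; have [hq qS qK] := qUW.
have fac j : exists h : 'Hom(N, K j), is_hom h /\ forall u, u \in U -> h (q u) = r j u.
  have [|h hh hE] := subquot_factor hk sU qUW (hr j); last by exists h.
  by move=> w /rK [_].
pose h j := sval (constructive_indefinite_description _ (fac j)).
have hh j : is_hom (h j) by case: (svalP (constructive_indefinite_description _ (fac j))).
have hE j u : u \in U -> h j (q u) = r j u.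
  by case: (svalP (constructive_indefinite_description _ (fac j))) => _; apply.
apply: (@pure_sum J K N h) => // [y|y].
  by have [u uU uE] := rS y; exists (q u) => j; rewrite hE.
have [u uU <-] := qS y => h0; apply/(qK u uU)/rK; split=> // j.
by rewrite -hE.
Qed.

End Pure.

(** * Complete reducibility over the even part *)

Section EvenReductive.
Variables (k : fieldType) (hk : [pchar k] =i pred0) (m n : nat).
Notation T := (glmod k m n).
Variable M : T.
Implicit Types U S C : {vspace M}.

Lemma ev_stable_estable U : ev_stable U <-> estable (@blk m n) (op M) U.
Proof.
split=> sU i j u ij uU.
  by move/eqP: ij => ij; apply: sU.
apply: (sU i j u _ uU); rewrite ij; exact: eqxx.
Qed.

Lemma ev_stable_par p : ev_stable (par M p).
Proof. by move=> i j u ij /(op_par i j); rewrite ij addbb. Qed.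

(** Complements are taken separately in each parity, so that their sum is a graded subspace. *)
Lemma ev_complement S U : ev_stable S -> ev_stable U -> par_stable S -> par_stable U ->
  (S <= U)%VS -> exists C, [/\ ev_stable C, par_stable C, (S :&: C = 0)%VS & (S + C = U)%VS].
Proof.
move=> eS eU pS pU SU; have [B HB] := torus_diag hk M.
have evI V p : ev_stable V -> estable (@blk m n) (op M) (V :&: par M p)%VS.
  move=> eV; apply/ev_stable_estable => i j u ij; rewrite !memv_cap => /andP [uV up].
  by rewrite eV // ev_stable_par.
have compl p : exists C, [/\ ev_stable C, (S :&: par M p :&: C = 0)%VS &
    (S :&: par M p + C = U :&: par M p)%VS].
  have [C [eC C0 CE]] := complement_exists hk (@op_even_comm k m n M) HB (evI S p eS) (evI U p eU)
    (capvS SU (subvv _)).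
  by exists C; split=> //; apply/ev_stable_estable.
have [C0 [eC0 C00 C0E]] := compl false; have [C1 [eC1 C10 C1E]] := compl true.
have C0P u : u \in C0 -> u \in U /\ u \in par M false.
  move=> uC; have : u \in (U :&: par M false)%VS by rewrite -C0E (subvP (addvSr _ _)).
  by rewrite memv_cap => /andP [].
have C1P u : u \in C1 -> u \in U /\ u \in par M true.
  move=> uC; have : u \in (U :&: par M true)%VS by rewrite -C1E (subvP (addvSr _ _)).
  by rewrite memv_cap => /andP [].
have pjC u v : u \in C0 -> v \in C1 -> pj M false (u + v) = u /\ pj M true (u + v) = v.
  move=> /C0P [_ u0] /C1P [_ v1]; rewrite !lfunD (pj_id u0) (pj_id v1).
  by rewrite (@pj_neg _ _ _ _ false) // (@pj_neg _ _ _ _ true) // addr0 add0r.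
exists (C0 + C1)%VS; split.
- move=> i j _ ij /memv_addP [u uC [v vC ->]].
  by rewrite lfunD memv_add ?eC0 ?eC1.
- move=> p _ /memv_addP [u uC [v vC ->]]; have [E0 E1] := pjC u v uC vC.
  case: p; rewrite ?E0 ?E1; first exact: (subvP (addvSr _ _)).
  exact: (subvP (addvSl _ _)).
- apply/eqP; rewrite -subv0; apply/subvP => w; rewrite memv_cap => /andP [wS].
  case/memv_addP => u uC [v vC wE]; have [E0 E1] := pjC u v uC vC.
  have u0 : u = 0.
    apply/eqP; rewrite -memv0 -C00 !memv_cap uC andbT -{1}E0 -wE pS //=.
    by have [] := C0P u uC.
  have v0 : v = 0.
    apply/eqP; rewrite -memv0 -C10 !memv_cap vC andbT -{1}E1 -wE pS //=.
    by have [] := C1P v vC.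
  by rewrite wE u0 v0 addr0 mem0v.
apply/eqP; rewrite eqEsubv !subv_add SU /=; apply/andP; split.
  by apply/andP; split; apply/subvP => u; [case/C0P|case/C1P].
apply/subvP => u uU; rewrite (pj_add false u) memvD //.
  have : pj M false u \in (S :&: par M false + C0)%VS by rewrite C0E memv_cap pU ?pj_par.
  by apply: subvP; rewrite addvS ?capvSl ?addvSl.
have : pj M true u \in (S :&: par M true + C1)%VS by rewrite C1E memv_cap pU ?pj_par.
by apply: subvP; rewrite addvS ?capvSl ?addvSr.
Qed.

Definition ev_simple (L : {vspace M}) := exists p l w,
  [/\ (L <= par M p)%VS, ev_stable L, w \in L /\ w != 0,
      is_wt (op M) l w /\
        forall i j : 'I_(m + n), (i < j)%N -> blk i = blk j -> op M i j w = 0 &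
      forall X : {vspace M}, ev_stable X -> (X <= L)%VS -> X = 0%VS \/ X = L].

Lemma ev_simple_exists U : ev_stable U -> par_stable U -> U != 0%VS ->
  exists2 L, (L <= U)%VS & ev_simple L.
Proof.
move=> eU pU U0; have [B HB] := torus_diag hk M.
have [p Up0] : exists p, (U :&: par M p != 0)%VS.
  have : vpick U != 0 by rewrite vpick0.
  rewrite {1}(pj_add false (vpick U)) => n0.
  have pk q : pj M q (vpick U) \in (U :&: par M q)%VS by rewrite memv_cap pU ?pj_par ?memv_pick.
  case: (eqVneq (pj M false (vpick U)) 0) n0 => [-> n0|n0 _].
    exists true; apply: contraNneq n0 => U1; have := pk true; rewrite U1 memv0 => /eqP ->.
    by rewrite addr0.
  by exists false; apply: contraNneq n0 => U1; have := pk false; rewrite U1 memv0.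
have eUp : estable (@blk m n) (op M) (U :&: par M p)%VS.
  apply/ev_stable_estable => i j u ij; rewrite !memv_cap => /andP [uU up].
  by rewrite eU // ev_stable_par.
have [L [l [w [[LU eL wL w0 [lw hw]] simp]]]] :=
  simple_submodule hk (@op_even_comm k m n M) HB eUp Up0.
exists L; first exact: subv_trans LU (capvSl _ _).
exists p, l, w; split=> //.
- exact: subv_trans LU (capvSr _ _).
- exact/ev_stable_estable.
- by split=> // i j ij eij; apply/eqP; rewrite -memv0 hw // eij eqxx.
- by move=> X /ev_stable_estable; apply: simp.
Qed.

(** A simple summand is split off at each step. The decomposition is recorded by orthogonal
    idempotents because these, unlike subspaces, extend along the universal property in
    [pure_decomp]. *)
Lemma ev_decomp U : ev_stable U -> par_stable U -> exists (r : nat) (p : 'I_r -> 'End(M)),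
  [/\ forall a u, u \in U -> p a u \in U,
      forall a q u, u \in U -> u \in par M q -> p a u \in par M q,
      forall a i j u, blk i = blk j -> u \in U -> p a (op M i j u) = op M i j (p a u) &
      [/\ forall a b u, u \in U -> p a (p b u) = if a == b then p a u else 0,
      forall u, u \in U -> \sum_a p a u = u & forall a, ev_simple (p a @: U)%VS]].
Proof.
have [d] := ubnP (\dim U); elim: d U => // d IHd U dU eU pU.
have [U0|U0] := eqVneq U 0%VS.
  exists 0%N, (fun a => 0); rewrite U0; split; [by move=> [] ..|split; last by move=> []].
    by move=> [].
  by move=> u; rewrite memv0 big_ord0 => /eqP.
have [L LU sL] := ev_simple_exists eU pU U0.
have [q0 [l [w [Lp eL [wL w0] _ _]]]] := sL.
have pL : par_stable L.
  move=> q u uL; have [->|qp] := eqVneq q q0; first by rewrite pj_id ?(subvP Lp).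
  rewrite pj_neg ?mem0v //; have := subvP Lp _ uL; rewrite (_ : q0 = ~~ q) //.
  by move: qp; case: (q); case: (q0).
have [C [eC pC LC0 LCU]] := ev_complement eL eU pL pU LU.
have CU : (C <= U)%VS by rewrite -LCU addvSr.
have [||//|r [p [p1 p2 p3 [p4 p5 p6]]]] := IHd C.
  have := dimv_disjoint_sum LC0; rewrite LCU => dE.
  have : (0 < \dim L)%N.
    by rewrite lt0n dimv_eq0; apply: contraNneq w0 => L0; rewrite -memv0 -L0.
  by move: dU; rewrite dE; lia.
- exact: eC.
have CL0 : (C :&: L = 0)%VS by rewrite capvC.
pose pL' := daddv_pi L C; pose pC' := daddv_pi C L.
have pLE x y : x \in L -> y \in C -> pL' (x + y) = x /\ pC' (x + y) = y.
  move=> xL yC; have xy : x + y \in (L + C)%VS by rewrite memv_add.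
  have E : pL' (x + y) + pC' (x + y) = x + y by apply: daddv_pi_add.
  have EL : pL' (x + y) = x.
    apply/eqP; rewrite -subr_eq0 -memv0 -LC0 memv_cap memvB ?memv_pi //=.
    have -> : pL' (x + y) - x = y - pC' (x + y).
      by apply/eqP; rewrite subr_eq addrAC eq_sym subr_eq E addrC.
    by rewrite memvB ?memv_pi.
  by split=> //; apply: (@addrI _ x); rewrite -{1}EL E.
have UP u : u \in U -> exists x y, [/\ u = x + y, x \in L & y \in C].
  by rewrite -LCU => /memv_addP [x xL [y yC ->]]; exists x, y.
pose P (a : 'I_r.+1) : 'End(M) := if unlift ord0 a is Some b then (p b \o pC')%VF else pL'.
have P0 x y : x \in L -> y \in C -> P ord0 (x + y) = x.
  by move=> xL yC; rewrite /P unlift_none (pLE x y xL yC).1.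
have PS b x y : x \in L -> y \in C -> P (lift ord0 b) (x + y) = p b y.
  by move=> xL yC; rewrite /P liftK comp_lfunE (pLE x y xL yC).2.
have P0L x : x \in L -> P ord0 x = x.
  by move=> xL; rewrite -{1}[x]addr0 P0 ?mem0v.
have P0C y : y \in C -> P ord0 y = 0.
  by move=> yC; rewrite -[y]add0r P0 ?mem0v.
have PSL b x : x \in L -> P (lift ord0 b) x = 0.
  by move=> xL; rewrite -[x]addr0 PS ?mem0v // lfun0.
have PSC b y : y \in C -> P (lift ord0 b) y = p b y.
  by move=> yC; rewrite -{1}[y]add0r PS ?mem0v.
exists r.+1, P; split.
- move=> a u /UP [x [y [-> xL yC]]]; case: (unliftP ord0 a) => [b|] ->.
    by rewrite PS // (subvP CU) // p1.
  by rewrite P0 // (subvP LU).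
- move=> a q u /UP [x [y [uE xL yC]]] uq.
  have xq : x = pj M q x /\ y = pj M q y.
    have := pLE _ _ (pL q x xL) (pC q y yC); rewrite -lfunD -uE (pj_id uq) uE => -[<- <-].
    by have [-> ->] := pLE _ _ xL yC.
  case: (unliftP ord0 a) => [b|] ->; rewrite uE; last by rewrite P0 // xq.1 pj_par.
  by rewrite PS // p2 // xq.2 pj_par.
- move=> a i j u ij /UP [x [y [-> xL yC]]]; rewrite lfunD.
  case: (unliftP ord0 a) => [b|] ->; last by rewrite !P0 ?eL ?eC.
  by rewrite !PS ?eL ?eC // p3.
split.
- move=> a b u /UP [x [y [-> xL yC]]].
  case: (unliftP ord0 a) => [a'|] ->; case: (unliftP ord0 b) => [b'|] ->.
  + by rewrite (inj_eq lift_inj) !PS // PSC ?p1 // p4.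
  + by rewrite P0 // PSL // eq_sym (negPf (neq_lift _ _)).
  + by rewrite PS // P0C ?p1 // (negPf (neq_lift _ _)).
  by rewrite eqxx !P0 // P0L.
- move=> u /UP [x [y [-> xL yC]]]; rewrite big_ord_recl P0 //; congr (_ + _).
  by rewrite -[RHS]p5 //; apply: eq_bigr => b _; rewrite PS.
move=> a; case: (unliftP ord0 a) => [b|] ->.
  suff -> : (P (lift ord0 b) @: U = p b @: C)%VS by apply: p6.
  apply/eqP; rewrite eqEsubv; apply/andP; split; apply/subvP => _ /memv_imgP [u uU ->].
    by have [x [y [-> xL yC]]] := UP u uU; rewrite PS // memv_img.
  by rewrite -(PSC b u) // memv_img // (subvP CU).
suff -> : (P ord0 @: U = L)%VS by [].
apply/eqP; rewrite eqEsubv; apply/andP; split; apply/subvP => x.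
  by move=> /memv_imgP [u /UP [y [z [-> yL zC]]] ->]; rewrite P0.
by move=> xL; rewrite -(P0L x) // memv_img // (subvP LU).
Qed.

End EvenReductive.

(** * The degree filtration *)

Section Filtration.
Variables (k : fieldType) (hk : [pchar k] =i pred0) (m n : nat).
Notation T := (glmod k m n).
Implicit Types (M N K Q X : T) (c d : int).

(** [None] stands for a parity projection, so that closed subspaces are graded. *)
Definition genop M (o : option ('I_(m + n) * 'I_(m + n))) : 'End(M) :=
  if o is Some p then op M p.1 p.2 else pj M false.

Definition gen M (P : M -> Prop) : {vspace M} := clos (genop M) (fun=> True) P.

Lemma gen_submod M (P : M -> Prop) : submod (gen P).
Proof.
apply: (lie_stable_submod hk) => [p u uG|i j u uG]; last first.
  by rewrite -[op M i j]/(genop M (Some (i, j))); apply: clos_op.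
have H : pj M false u \in gen P by rewrite -[pj M false]/(genop M None); apply: clos_op.
case: p => //; have -> : pj M true u = u - pj M false u.
  by rewrite [X in X - _](pj_add false u) addrC addKr.
by rewrite memvB.
Qed.

Lemma gen_sub M (P : M -> Prop) (U : {vspace M}) :
  submod U -> (forall v, P v -> v \in U) -> (gen P <= U)%VS.
Proof.
move=> sU PU; apply: clos_sub => // -[[i j]|] _ v; first exact: (submod_lie sU).
exact: (submod_parity sU).
Qed.

Lemma gen_in M (P : M -> Prop) v : P v -> v \in gen P.
Proof. exact: clos_in. Qed.

Definition degfil M (U : {vspace M}) d : {vspace M} :=
  gen (fun v => v \in U /\ exists2 c, (d <= c)%R & isdeg c v).

Section Degfil.
Variables (M : T).
Implicit Types U E W : {vspace M}.

Lemma degfil_submod U d : submod (degfil U d).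
Proof. exact: gen_submod. Qed.

Lemma degfil_in U d c v : (d <= c)%R -> v \in U -> isdeg c v -> v \in degfil U d.
Proof. by move=> dc vU cv; apply: gen_in; split=> //; exists c. Qed.

Lemma degfil_sub U d : submod U -> (degfil U d <= U)%VS.
Proof. by move=> sU; apply: gen_sub => // v []. Qed.

Lemma degfilS U E d : (E <= U)%VS -> (degfil E d <= degfil U d)%VS.
Proof.
move=> /subvP EU; apply: gen_sub => [|v [/EU vU [c dc cv]]]; first exact: degfil_submod.
exact: degfil_in cv.
Qed.

Lemma degfil_le U d d' : (d' <= d)%R -> (degfil U d <= degfil U d')%VS.
Proof.
move=> dd; apply: gen_sub => [|v [vU [c dc cv]]]; first exact: degfil_submod.
by apply: (degfil_in _ vU cv); apply: le_trans dc.
Qed.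

Lemma degfil_large : exists B : nat, forall d, (B%:Z < d)%R -> forall U, degfil U d = 0%VS.
Proof.
have [B HB] := deg_bound hk M; exists B => d Bd U; apply/eqP; rewrite -subv0.
apply: gen_sub => [|v [_ [c dc cv]]]; first exact: submod0.
have [->|v0] := eqVneq v 0; first exact: mem0v.
by have := HB c v cv v0; lia.
Qed.

Lemma degfil_small : exists B : nat, forall d, (d < - B%:Z)%R ->
  degfil (fullv : {vspace M}) d = fullv.
Proof.
have [B HB] := deg_bound hk M; exists B => d Bd; apply/eqP; rewrite eqEsubv subvf.
apply/subvP => u uf; have := deg_span hk (submod_ev (submod_full hk M)) uf.
apply: subvP; apply: spanv_sub => v [_ [c cv]].
have [->|v0] := eqVneq v 0; first exact: mem0v.
by apply: (degfil_in _ (memvf v) cv); have := HB c v cv v0; lia.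
Qed.

(* An even complement of E in degree c lifts the top of K; the universal       *)
(* property of K then splits U / W -> K.                                       *)
Lemma pure_split U E W K (q : 'Hom(M, K)) c :
  submod U -> submod E -> submod W -> (W <= E)%VS -> (E <= U)%VS ->
  is_subquot U E q -> pure c K -> (U :&: dsp M (c + 1) <= W)%VS ->
  exists K' : {vspace M}, [/\ submod K', (W <= K')%VS, (K' <= U)%VS,
    (K' :&: E = W)%VS & (K' + E = U)%VS].
Proof.
move=> sU sE sW WE EU [hq qS qK] [uK iK] top.
have evU := submod_ev sU; have evE := submod_ev sE.
have EU' := subvP EU; have WE' := subvP WE.
(* [C] is a lift, stable under the even part, of the degree [c] part of [K]. *)
have [||||| C [evC pC EC0 ECU]] := @ev_complement k hk m n M (E :&: dsp M c)%VS (U :&: dsp M c)%VS.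
- by move=> i j u ij; rewrite !memv_cap => /andP [uE ud]; rewrite evE // ev_stable_dsp.
- by move=> i j u ij; rewrite !memv_cap => /andP [uU ud]; rewrite evU // ev_stable_dsp.
- by move=> p u; rewrite !memv_cap => /andP [uE ud]; rewrite (submod_parity sE) // par_stable_dsp.
- by move=> p u; rewrite !memv_cap => /andP [uU ud]; rewrite (submod_parity sU) // par_stable_dsp.
- by rewrite capvS.
have CU u : u \in C -> u \in U /\ isdeg c u.
  move=> uC; have : u \in (U :&: dsp M c)%VS by rewrite -ECU (subvP (addvSr _ _)).
  by rewrite memv_cap => /andP [uU /dspP].
have qC y : y \in dsp K c -> exists2 u, u \in C & q u = y.
  move=> /dspP yd; have [u uU quy] := qS y; move: yd; rewrite -quy => /(subquot_deg_lift hk hq evU uU).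
  move=> [x [xU xd <-]]; have : x \in (U :&: dsp M c)%VS by rewrite memv_cap xU; apply/dspP.
  rewrite -ECU => /memv_addP [a]; rewrite memv_cap => /andP [aE _] [b bC xE].
  by exists b => //; rewrite xE lfunD (iffRL (qK a (EU' _ aE))) ?add0r.
have injC u : u \in C -> q u = 0 -> u = 0.
  move=> uC qu; have [uU ud] := CU u uC; apply/eqP; rewrite -memv0 -EC0 !memv_cap uC andbT.
  by apply/andP; split; [apply/qK|apply/dspP].
have [s [sC sK]] := lfun_section C q.
have qs y : y \in dsp K c -> q (s y) = y by move=> /qC [u uC <-]; rewrite sK.
have sE' y u : y \in dsp K c -> u \in C -> q u = y -> s y = u.
  move=> yd uC quy; apply/eqP; rewrite -subr_eq0; apply/eqP/injC; first by rewrite memvB.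
  by rewrite lfunB qs // quy subrr.
have [N [p pUW]] := subquot_exists sU sW; have [hp pS pK] := pUW.
have hf : hom_on (upper_block k m n) (dsp K c) (p \o s)%VF.
  apply: (op_hom_upper hk) => [|a y yd ya|i j y ij yd]; first exact: ev_stable_dsp.
    have [sU' _] := CU _ (sC y); rewrite comp_lfunE; case: hp => hp1 _ _; apply: hp1 => //.
    rewrite (sE' y (pj M a (s y))) ?pj_par ?pC //.
    by rewrite (hom_on_pj a (submod_parity sU) hq sU') qs // pj_id.
  have [sU' sd] := CU _ (sC y); rewrite !comp_lfunE.
  have [bij|nbij] := eqVneq (blk i) (blk j).
    rewrite (sE' _ (op M i j (s y))) ?(hom_on_op i j hp) //.
    - exact: ev_stable_dsp.
    - exact: evC.
    - by rewrite (hom_on_op i j hq) // qs.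
  (* For g_1, one side vanishes by purity of [K], the other since [s y] is moved to degree [c + 1]
     in [U], hence into [W]. *)
  have [bi bj] : blk i /\ ~~ blk j by move: ij nbij; case: (blk i); case: (blk j).
  rewrite uK // ?linear0; last exact/dspP.
  rewrite -(hom_on_op i j hp) //; apply/esym/pK; first exact: (submod_lie sU).
  apply: (subvP top); rewrite memv_cap (submod_lie sU) //; apply/dspP.
  by have := isdeg_op i j sd; rewrite bi (negPf bj) subr0.
have [g [[hg gE] _]] := iK N _ hf.
have [|h hh hE] := @subquot_factor _ hk _ _ _ _ _ _ _ _ q sU pUW hq.
  by move=> w /WE' wE; apply/qK; [apply: EU'|].
have hgK y : h (g y) = y.
  rewrite -[h (g y)](comp_lfunE h g) -[RHS]id_lfunE; congr (fun_of_lfun _ _).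
  apply: (induced_unique iK (is_hom_comp hk hg hh) (is_hom_id hk K)) => v vd.
  rewrite comp_lfunE gE // comp_lfunE hE ?qs ?id_lfunE //.
  by have [] := CU _ (sC v).
(* [g] splits the map [h] from [N] to [K]; [K'] is the preimage in [U] of the copy of [K] so
   obtained. *)
pose K' := (U :&: p @^-1: limg g)%VS.
have K'P u : u \in K' <-> u \in U /\ exists y, p u = g y.
  rewrite memv_cap -memv_preim; split=> [/andP [uU /memv_imgP [y _ Ey]]|[uU [y ->]]].
    by split=> //; exists y.
  by rewrite uU memv_img ?memvf.
have WK' : (W <= K')%VS.
  apply/subvP => w wW; have wU := EU' _ (WE' _ wW); apply/K'P; split=> //.
  by exists 0; rewrite linear0; apply/pK.
exists K'; split=> //.
- apply: submod_preim => //; apply: submod_img => //; exact: submod_full.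
- exact: capvSl.
- apply/eqP; rewrite eqEsubv subv_cap WK' WE !andbT; apply/subvP => u.
  rewrite memv_cap => /andP [/K'P [uU [y puy]] uE].
  have y0 : y = 0 by rewrite -(hgK y) -puy hE //; apply/qK.
  by apply/(pK u uU); rewrite puy y0 linear0.
apply/eqP; rewrite eqEsubv subv_add capvSl EU /=; apply/subvP => u uU.
have [u' u'U pu'] := pS (g (q u)).
have u'K : u' \in K' by apply/K'P; split=> //; exists (q u).
have -> : u = u' + (u - u') by rewrite addrC subrK.
rewrite memv_add //; apply/(qK (u - u')); first by rewrite memvB.
by rewrite lfunB -[q u'](hE u' u'U) pu' hgK subrr.
Qed.

Lemma extend_hom (A C : {vspace M}) K (r : 'Hom(M, K)) : submod A -> submod C ->
  hom_on predT A r -> (forall u, u \in (A :&: C)%VS -> r u = 0) ->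
  exists r' : 'Hom(M, K), hom_on predT (A + C)%VS r' /\
    forall a b, a \in A -> b \in C -> r' (a + b) = r a.
Proof.
move=> sA sC hr r0; pose r' := (r \o addv_pi1 A C)%VF.
have rE a b : a \in A -> b \in C -> r' (a + b) = r a.
  move=> aA bC; rewrite comp_lfunE; set u := a + b.
  have uAC : u \in (A + C)%VS by rewrite memv_add.
  have E := addv_pi1_pi2 uAC; apply/eqP; rewrite -subr_eq0 -lfunB; apply/eqP/r0.
  rewrite memv_cap memvB ?memv_pi1 //=.
  have -> : addv_pi1 A C u - a = b - addv_pi2 A C u.
    by apply/eqP; rewrite subr_eq addrAC eq_sym subr_eq E addrC.
  by rewrite memvB ?memv_pi2.
exists r'; split=> //; apply: (op_hom_on hk).
- exact: (submod_ev (submodD hk sA sC)).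
- move=> p _ /memv_addP [a aA [b bC ->]] up; rewrite -(pj_id up) lfunD rE.
  + by case: hr => hr1 _ _; apply: hr1; [apply: (submod_parity sA)|apply: pj_par].
  + exact: (submod_parity sA).
  + exact: (submod_parity sC).
move=> i j _ /memv_addP [a aA [b bC ->]]; rewrite lfunD !rE //.
- exact: (hom_on_op i j hr).
- exact: (submod_lie sA).
- exact: (submod_lie sC).
Qed.

End Degfil.

End Filtration.

(** * Graded pieces along a Kac flag and under retracts *)

Section GradedPieces.
Variables (k : fieldType) (hk : [pchar k] =i pred0) (m n : nat).
Notation T := (glmod k m n).
Implicit Types (M N K Q X : T) (c d : int).

Definition kac_graded M (U : {vspace M}) := forall d, exists (J : finType) (K : J -> T),
  (forall j, exists2 lam, is_kac lam (K j) & deg lam = d) /\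
  quotient_iso_sum (degfil U d) (degfil U (d + 1)) K.

Lemma quotient_iso_unit M (U W : {vspace M}) K (q : 'Hom(M, K)) : (W <= U)%VS ->
  is_subquot U W q -> quotient_iso_sum U W (fun _ : unit => K).
Proof.
move=> /subvP WU [hq qS qK]; exists (fun=> q); split=> // [y|u].
  by have [u uU qu] := qS (y tt); exists u => // -[].
split=> [uW|[uU /(_ tt) q0]]; last exact/(qK u uU).
by have uU := WU _ uW; split=> // _; apply/(qK u uU).
Qed.

Lemma unit_subquot M (U W : {vspace M}) K : quotient_iso_sum U W (fun _ : unit => K) ->
  (W <= U)%VS /\ exists q : 'Hom(M, K), is_subquot U W q.
Proof.
move=> [q [hq qS qK]]; split; first by apply/subvP => u /qK [].
exists (q tt); split=> // [y|u uU].
  by have [u uU qu] := qS (fun=> y); exists u.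
by split=> [u0|/qK [_]//]; apply/qK; split=> // -[].
Qed.

(** Only the piece of degree [c = deg lam] changes, and it gains the summand [K]: the filtrations of
    [U] and [E] agree above [c], while from [c] downwards that of [U] is that of [E] plus the
    submodule [K'] of [pure_split]. *)
Lemma kac_graded_insert M (U E : {vspace M}) (lam : weight m n) K :
  submod U -> submod E -> is_kac lam K -> quotient_iso_sum U E (fun _ : unit => K) ->
  kac_graded E -> kac_graded U.
Proof.
move=> sU sE kK /unit_subquot [EU [q qUE]] gE; have pK := kac_pure hk kK.
set c := deg lam in pK; have [hq qS qK] := qUE.
pose W := degfil E (c + 1); have sW : submod W := degfil_submod hk E (c + 1).
have WE : (W <= E)%VS := degfil_sub (c + 1) sE.
have evU := submod_ev sU; have EU' := subvP EU; have WE' := subvP WE.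
have high d : (c < d)%R -> degfil U d = degfil E d.
  move=> cd; apply/eqP; rewrite eqEsubv (degfilS hk d EU) andbT.
  apply: (gen_sub (degfil_submod hk _ _)) => v [vU [c' dc' cv]].
  apply: (degfil_in dc') => //; apply/(qK v vU).
  by apply: (pure_deg hk pK (isdeg_hom hq evU vU cv)); apply: lt_le_trans dc'.
have top : (U :&: dsp M (c + 1) <= W)%VS.
  apply/subvP => u; rewrite memv_cap => /andP [uU /dspP ud].
  by rewrite /W -high ?ltzD1 //; apply: degfil_in ud.
have [K' [sK' WK' K'U K'E K'EU]] := pure_split hk sU sE sW WE EU qUE pK top.
have K'U' := subvP K'U; have evK' := submod_ev sK'.
have WcE d : (d <= c)%R -> (W <= degfil E d)%VS.
  by move=> dc; apply: degfil_le; rewrite // (le_trans dc) // lerDl.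
(* [K] is generated in degree [c], and degree [c] vectors of [K] lift to [K']; so [K'] is [Y] up to
   its intersection with [E], which is [W]. *)
have K'low : (K' <= degfil U c)%VS.
  pose Y := (K' :&: degfil U c)%VS.
  have sY : submod Y by apply: submodI => //; apply: degfil_submod.
  have hqY : hom_on predT Y q by apply: hom_onS hq; apply: subv_trans (capvSl _ _) K'U.
  have qY : (q @: Y)%VS = fullv.
    apply: (pure_gen hk pK); first exact: submod_img.
    apply/subvP => y /dspP yd; have [u] := qS y; rewrite -K'EU.
    case/memv_addP => x xK' [e eE ->] quy.
    have qx : q x = y by rewrite -quy lfunD (iffRL (qK e (EU' _ eE))) ?addr0.
    have [|x1 [x1K' x1d qx1]] := subquot_deg_lift hk (hom_onS K'U hq) evK' xK' (c := c).
      by rewrite qx.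
    by rewrite -qx -qx1 memv_img // memv_cap x1K' (degfil_in (lexx c)) // K'U'.
  apply/subvP => x xK'; have : q x \in (q @: Y)%VS by rewrite qY memvf.
  case/memv_imgP => y; rewrite memv_cap => /andP [yK' yU] qxy.
  rewrite -[x](subrK y) memvD //; apply: (subvP (degfilS hk c EU)).
  apply: (subvP (WcE c (lexx c))); rewrite -K'E memv_cap memvB //=.
  by apply/qK; rewrite ?memvB ?K'U' // lfunB qxy subrr.
have low d : (d <= c)%R -> degfil U d = (degfil E d + K')%VS.
  move=> dc; apply/eqP; rewrite eqEsubv; apply/andP; split; last first.
    rewrite subv_add (degfilS hk d EU) /=; apply: subv_trans K'low _.
    exact: degfil_le.
  apply: gen_sub => [|v [vU [c' dc' cv]]].
    by apply: submodD => //; apply: degfil_submod.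
  have : v \in (K' + E)%VS by rewrite K'EU.
  case/memv_addP => x xK' [e eE vE].
  have [x1 [x2 [xE' [x1K' x1d] x2K' x2S]]] := deg_decomp hk c' evK' xK'.
  have [e1 [e2 [eE' [e1E e1d] e2E e2S]]] := deg_decomp hk c' (submod_ev sE) eE.
  have z : v - (x1 + e1) = 0.
    apply: (@deg_indep _ hk _ _ _ c').
      by apply/dspP; rewrite memvB ?memvD //; apply/dspP.
    have -> : v - (x1 + e1) = x2 + e2.
      by rewrite vE xE' eE' opprD addrACA [x1 + x2]addrC addrK [e1 + e2]addrC addrK.
    by rewrite memvD //; [move: x2S|move: e2S]; apply: subvP; apply: spanvS => w [].
  have -> : v = e1 + x1 by apply/eqP; rewrite addrC -subr_eq0 z.
  by rewrite memv_add // (degfil_in dc').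
move=> d; have [cd|dc] := ltP c d.
  have [J [K0 [kK0 qK0]]] := gE d; exists J, K0; split=> //.
  by rewrite !high // (lt_trans cd) // ltzD1.
have [J [K0 [kK0 [r [hr rS rK]]]]] := gE d.
pose A := degfil E d; have sA : submod A := degfil_submod hk E d.
have AE : (A <= E)%VS := degfil_sub d sE.
have W1 : (W <= degfil E (d + 1))%VS by apply: degfil_le => //; rewrite lerD2r.
have AK' u : u \in (A :&: K')%VS -> u \in W.
  by rewrite -K'E !memv_cap => /andP [uA ->]; rewrite (subvP AE).
have ext j : exists r' : 'Hom(M, K0 j), hom_on predT (A + K')%VS r' /\
    forall a b, a \in A -> b \in K' -> r' (a + b) = r j a.
  apply: (extend_hom hk sA sK' (hr j)) => u /AK' uW.
  by have [_ ->] := iffLR (rK u) (subvP W1 _ uW).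
pose r' j := sval (constructive_indefinite_description _ (ext j)).
have hr' j : hom_on predT (A + K')%VS (r' j).
  by case: (svalP (constructive_indefinite_description _ (ext j))).
have r'E j a b : a \in A -> b \in K' -> r' j (a + b) = r j a.
  by case: (svalP (constructive_indefinite_description _ (ext j))) => _; apply.
(* Below degree [c] the summand [K'] occurs in both terms of the quotient and cancels; in degree [c]
   it occurs in the larger one only. *)
move: (dc); rewrite le_eqVlt => /orP [/eqP dE|ltdc]; last first.
  exists J, K0; split=> //; rewrite !low ?lezD1 //.
  exists r'; split=> // [y|u].
    have [a aA aE] := rS y; exists a; first exact: (subvP (addvSl _ _)).
    by move=> j; rewrite -[a]addr0 r'E ?mem0v.
  split=> [/memv_addP [a /rK [aA ra] [b bK' ->]]|[/memv_addP [a aA [b bK' ->]] r0]].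
    by split=> [|j]; rewrite ?memv_add // r'E.
  by rewrite memv_add //; apply/rK; split=> // j; rewrite -(r'E j a b).
(* [None] indexes the new summand. *)
pose K1 (o : option J) := if o is Some j then K0 j else K.
pose r1 (o : option J) : 'Hom(M, K1 o) :=
  match o return 'Hom(M, K1 o) with Some j => r' j | None => q end.
have AKU : (A + K' <= U)%VS by rewrite subv_add K'U andbT; apply: subv_trans EU.
have qA a b : a \in A -> q (a + b) = q b.
  by move=> aA; rewrite lfunD (iffRL (qK a (EU' _ (subvP AE _ aA)))) ?add0r ?(subvP AE).
exists (option J : finType), K1; split.
  by case=> [j|]; [apply: kK0|exists lam].
have WEd : degfil E (d + 1) = W by rewrite /W dE.
rewrite low // -/A high; last by rewrite dE ltzD1.
rewrite WEd.
exists r1; split.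
- by case=> [j|] /=; [apply: hr'|apply: hom_onS hq].
- move=> y; have [a aA aE] := rS (fun j => y (Some j)).
  have [x xK' qx] : exists2 x, x \in K' & q x = y None.
    have [u] := qS (y None); rewrite -K'EU => /memv_addP [x xK' [e eE ->]] <-.
    by exists x => //; rewrite lfunD (iffRL (qK e (EU' _ eE))) ?addr0.
  exists (a + x); first by rewrite memv_add.
  by case=> [j|] /=; [rewrite r'E ?aE|rewrite qA ?qx].
move=> u; split=> [uW|[/memv_addP [a aA [b bK' ->]] r0]].
  have [uA ru] := iffLR (rK u) (subvP W1 _ uW).
  split=> [|[j|] /=]; first exact: (subvP (addvSl _ _)).
    by rewrite -[u]addr0 r'E ?mem0v ?ru.
  by apply/qK; [apply: EU'|]; apply: WE'.
have aW : a \in W.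
  by rewrite -WEd; apply/rK; split=> // j; rewrite -(r'E j a b) //; apply: (r0 (Some j)).
have qb : q b = 0 by rewrite -(qA a b aA); apply: (r0 None).
rewrite memvD // -K'E memv_cap bK' /=.
by apply/qK => //; apply: K'U'.
Qed.

Lemma kac_flag_graded M (U : {vspace M}) : kac_flag U -> kac_graded U.
Proof.
move=> [r [E [E0 Er sE stepE]]]; rewrite -Er.
suff H s : (s <= r)%N -> kac_graded (E s) by apply: H.
elim: s => [|s IHs] sr.
  rewrite E0 => d; exists void, (fun x : void => match x with end); split; first by case.
  have z d' : degfil (0 : {vspace M}) d' = 0%VS.
    by apply/eqP; rewrite -subv0; apply: degfil_sub => //; apply: submod0.
  rewrite !z; exists (fun x : void => match x with end); split; [by case|..].
    by move=> y; exists 0; [apply: mem0v|case].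
  by move=> u; split=> [u0|[]] //; split=> // -[].
have [_ [lam [K [kK qK]]]] := stepE s sr.
by apply: kac_graded_insert kK qK (IHs (ltnW sr)); apply: sE => //; apply: ltnW.
Qed.

(** The form of membership in T_+ that visibly passes to retracts. *)
Definition pure_graded M :=
  forall d, pure_subquot d (degfil (fullv : {vspace M}) d) (degfil fullv (d + 1)).

Lemma Tplus_graded M : in_Tplus M -> pure_graded M.
Proof.
move=> /kac_flag_graded gM d; have [J [K [kK qK]]] := gM d.
apply: (sum_pure_subquot hk _ _ qK) => [||j]; [exact: degfil_submod|exact: degfil_submod|].
by have [lam kj <-] := kK j; apply: kac_pure.
Qed.

Lemma degfil_hom M N (f : 'Hom(M, N)) d : is_hom f ->
  (f @: degfil fullv d <= degfil fullv d)%VS.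
Proof.
move=> hf; apply/subvP => _ /memv_imgP [u uF ->]; rewrite memv_preim; move: u uF.
apply/subvP; apply: gen_sub => [|v [_ [c dc cv]]].
  rewrite -[(f @^-1: _)%VS]capfv.
  by apply: submod_preim hf _ => //; [apply: submod_full|apply: degfil_submod].
by rewrite -memv_preim; apply: (degfil_in dc (memvf _)); apply: isdeg_is_hom.
Qed.

(** [s] and [t] preserve the filtrations, so they induce maps [s'] and [t'] that make each graded
    piece of [N] a retract of that of [M]. *)
Lemma graded_retract M N (s : 'Hom(N, M)) (t : 'Hom(M, N)) : retract s t ->
  pure_graded M -> pure_graded N.
Proof.
move=> [hs ht ts] gM d; have tsE v : t (s v) = v by rewrite -comp_lfunE ts id_lfunE.
have sF (P : T) e : submod (degfil (fullv : {vspace P}) e) by apply: degfil_submod.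
have FS (P : T) e : (degfil (fullv : {vspace P}) (e + 1) <= degfil fullv e)%VS.
  by apply: degfil_le => //; rewrite lerDl.
have [Q [q [qM pQ]]] := gM d.
have [Q' [q' qN]] := subquot_exists (sF N d) (sF N (d + 1)).
have [hq qS qK] := qM; have [hq' qS' qK'] := qN.
have tF e u : u \in degfil fullv e -> t u \in degfil fullv e.
  by move=> uF; apply: (subvP (degfil_hom e ht)); apply: memv_img.
have sF' e u : u \in degfil fullv e -> s u \in degfil fullv e.
  by move=> uF; apply: (subvP (degfil_hom e hs)); apply: memv_img.
have comp_hom (P P' R : T) (f : 'Hom(P, P')) (g : 'Hom(P', R)) (U : {vspace P}) (V : {vspace P'}) :
    is_hom f -> submod U -> (forall u, u \in U -> f u \in V) -> hom_on predT V g ->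
    hom_on predT U (g \o f)%VF.
  move=> hf sU fU hg; apply: (op_hom_on hk (submod_ev sU)) => [p u uU up|i j u uU]; rewrite !comp_lfunE.
    by case: hg => hg1 _ _; apply: hg1; [apply: fU|apply: is_hom_par].
  by rewrite (is_hom_op i j u hf) (hom_on_op i j hg) ?fU.
have [|s' hs' s'E] := subquot_factor hk (sF N d) qN (comp_hom _ _ _ s q _ _ hs (sF N d) (sF' d) hq).
  move=> w wF; rewrite comp_lfunE; apply/qK; last exact: sF'.
  by apply: sF'; apply: (subvP (FS N d)).
have [|t' ht' t'E] := subquot_factor hk (sF M d) qM (comp_hom _ _ _ t q' _ _ ht (sF M d) (tF d) hq').
  move=> w wF; rewrite comp_lfunE; apply/qK'; last exact: tF.
  by apply: tF; apply: (subvP (FS M d)).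
exists Q', q'; split=> //; apply: (pure_retract hk hs' ht' _ pQ) => v.
have [u uF <-] := qS' v.
by rewrite s'E // comp_lfunE t'E ?sF' // comp_lfunE tsE.
Qed.

End GradedPieces.

(** * Pure modules as sums of Kac modules *)

Section Decomposition.
Variables (k : fieldType) (hk : [pchar k] =i pred0) (m n : nat).
Notation T := (glmod k m n).
Implicit Types (M N K Q X : T) (c d : int).

Lemma dom_dominant (l : weight m n) : dom (@blk m n) l -> dominant l.
Proof.
move=> dl; split=> i j; rewrite leq_eqVlt => /orP [/eqP ij|ij].
- by rewrite (val_inj ij).
- by apply: dl; rewrite ?blkE.
- by rewrite (val_inj ij).
- by apply: dl; rewrite ?blkE //= ltn_add2l.
Qed.

(* The image K of P is the submodule generated by the simple summand P(Q_d) of *)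
(* Q_d, and a homomorphism on Q restricts to one on K. *)
Lemma ev_simple_kac Q K d (P : 'End(Q)) (q : 'Hom(Q, K)) : pure d Q -> is_hom P ->
  (forall u, P (P u) = P u) -> is_subquot (limg P) 0%VS q -> ev_simple (P @: dsp Q d)%VS ->
  exists2 lam, is_kac lam K & deg lam = d.
Proof.
move=> [uQ iQ] hP PP qP [p [l [w [Lp eL [wL w0] [lw hw] simp]]]].
have [hq qS qK] := qP; set L := (P @: dsp Q d)%VS in Lp eL wL simp.
have Pim u : P u \in limg P by rewrite memv_img ?memvf.
have PL u : u \in L -> P u = u by move=> /memv_imgP [v _ ->].
have Lim u : u \in L -> u \in limg P by move=> /PL <-.
have Ld u : u \in L -> u \in dsp Q d.
  by move=> /memv_imgP [v /dspP vd ->]; apply/dspP; apply: isdeg_is_hom.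
have injq u : u \in limg P -> q u = 0 -> u = 0.
  by move=> uP /(qK u uP); rewrite memv0 => /eqP.
have wd : isdeg d w by apply/dspP/Ld.
have El : \sum_(i | blk i) l i = d.
  apply: (intr_inj_pchar0 hk); apply/eqP; rewrite -subr_eq0.
  have := isdeg_wt lw; rewrite /isdeg wd => /eqP.
  by rewrite eq_sym -subr_eq0 -scalerBl scaler_eq0 (negPf w0) orbF.
have hqP : is_hom (q \o P)%VF.
  apply: (op_is_hom hk) => [a u ua|i j u]; rewrite !comp_lfunE.
    by case: hq => hq1 _ _; apply: hq1; [apply: Pim|apply: is_hom_par].
  by rewrite (is_hom_op i j u hP) (hom_on_op i j hq).
have dl : dom (@blk m n) l.
  have [B HB] := torus_diag hk Q.
  apply: (@hw_dom _ _ _ _ (op Q) hk (@op_even_comm k m n Q) B HB 0%VS l w).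
  - exact: estable0.
  - by rewrite memv0.
  - by split=> // i j ij eij; rewrite memv0 (hw i j ij (eqP eij)).
have opL i j u : blk i -> ~~ blk j -> u \in L -> op Q i j u = 0.
  by move=> bi bj /Ld /dspP; apply: uQ.
have qop i j u : u \in L -> q (op Q i j u) = op K i j (q u).
  by move=> uL; apply: (hom_on_op i j hq); apply: Lim.
exists l; last first.
  rewrite -El /deg [RHS]big_split_ord /= [X in _ = _ + X]big1 ?addr0 => [|i]; last by rewrite blkE.
  by apply: eq_big => // i; rewrite blkE.
split; first exact: dom_dominant.
exists (q @: L)%VS, p; split.
- apply/subvP => _ /memv_imgP [u uL ->]; case: hq => hq1 _ _.
  by apply: hq1; [apply: Lim|apply: (subvP Lp)].
- split.
  + move=> L0; have : q w \in (q @: L)%VS by rewrite memv_img.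
    by rewrite L0 memv0 => /eqP /(injq _ (Lim _ wL)) /eqP; rewrite (negPf w0).
  + apply: (ev_stable_grp hk) => i j _ ij /memv_imgP [u uL ->].
    by rewrite -qop // memv_img // eL.
  (* A stable subspace of the image of [L] is pulled back to the simple [L]. *)
  move=> X XL /(grp_stable_ev hk) eX; pose Y := (L :&: q @^-1: X)%VS.
  have [||Y0|YL] := simp Y.
  + move=> i j u ij; rewrite !memv_cap -!memv_preim => /andP [uL qu].
    by rewrite eL // qop // eX.
  + exact: capvSl.
  + left; apply/eqP; rewrite -subv0; apply/subvP => x xX.
    have /memv_imgP [u uL xE] := subvP XL _ xX.
    have : u \in Y by rewrite memv_cap uL -memv_preim -xE.
    by rewrite Y0 memv0 => /eqP u0; rewrite xE u0 lfun0 mem0v.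
  + right; apply/eqP; rewrite eqEsubv XL; apply/subvP => _ /memv_imgP [u uL ->].
    by move: uL; rewrite -{1}YL memv_cap -memv_preim => /andP [].
- exists (q w); first by rewrite memv_img.
  split=> [|i|i j ij].
  + by apply: contraNneq w0 => /(injq _ (Lim _ wL)) ->.
  + by rewrite -[lie K _]/(op K i i) -qop // lw lfunZ.
  + rewrite -[lie K _]/(op K i j) -qop //.
    have [bij|bij] := eqVneq (blk i) (blk j); first by rewrite hw // lfun0.
    by rewrite opL ?lfun0 //; move: bij ij; rewrite /blk; lia.
- move=> X _ /andP [/parity_mxP oX /eqP X0] /memv_imgP [u uL ->].
  rewrite lieE big1 // => i _; rewrite big1 // => j _.
  have [/andP [bi bj]|bij] := boolP (blk i && ~~ blk j).
    by rewrite -qop // opL // lfun0 scaler0.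
  have [b|b] := boolP (~~ blk i && blk j); last first.
    by rewrite oX ?scale0r //; move: b bij; case: (blk i); case: (blk j).
  suff -> : X i j = 0 by rewrite scale0r.
  move: b; case: (split_ordP i) => i' ->; case: (split_ordP j) => j' ->; rewrite !blkE // => _.
  by have := congr1 (fun Y : 'M_(_, _) => Y i' j') X0; rewrite !mxE.
(* Precomposed with [q \o P], [f] is defined on the whole degree [d] part of [Q] and extends to [G];
   on the image of [P], [G] factors through [q] and gives the map on [K]. Uniqueness holds since
   [q \o P] is onto. *)
move=> X f hf.
have qPL u : u \in dsp Q d -> q (P u) \in (q @: L)%VS by move=> ud; rewrite !memv_img.
have hF : hom_on (upper_block k m n) (dsp Q d) (f \o (q \o P))%VF.
  apply: (op_hom_upper hk) => [|a u ud ua|i j u ij ud]; first exact: ev_stable_dsp.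
    rewrite comp_lfunE; case: hf => hf1 _ _; apply: hf1; first by rewrite comp_lfunE qPL.
    exact: is_hom_par hqP ua.
  rewrite !(comp_lfunE f) (is_hom_op i j u hqP) (hom_upper_op hf) //.
  by rewrite comp_lfunE qPL.
have [G [[hG GE] _]] := iQ X _ hF.
have sP : submod (limg P) by apply: submod_img => //; apply: submod_full.
have [|h hh hE] := subquot_factor hk sP qP (hom_onS (subvf _) hG).
  by move=> u; rewrite memv0 => /eqP ->; rewrite lfun0.
have hL : {in (q @: L)%VS, h =1 f}.
  move=> _ /memv_imgP [u uL ->]; rewrite hE ?Lim // GE ?Ld // !comp_lfunE.
  by rewrite PL.
exists h; split=> // h' [hh' h'L].
have E : (h \o (q \o P))%VF = (h' \o (q \o P))%VF.
  apply: (induced_unique iQ); [exact: is_hom_comp|exact: is_hom_comp|].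
  by move=> u ud; rewrite !(comp_lfunE _ (q \o P)%VF) comp_lfunE hL ?h'L ?qPL.
apply/lfunP => y; have [_ /memv_imgP [u _ ->] <-] := qS y.
by have := congr1 (fun g : 'Hom(Q, X) => g u) E; rewrite !comp_lfunE.
Qed.

(** The idempotents that split the degree [d] part are linear over the parabolic, so they extend to
    endomorphisms of [Q]; by uniqueness of extensions these remain orthogonal idempotents with sum
    1, and their images are Kac modules by [ev_simple_kac]. *)
Lemma pure_decomp Q d : pure d Q -> exists (r : nat) (K : 'I_r -> T),
  (forall j, exists2 lam, is_kac lam (K j) & deg lam = d) /\
  quotient_iso_sum (fullv : {vspace Q}) 0%VS K.
Proof.
move=> pQ; have [uQ iQ] := pQ.
have [r [p [p1 p2 p3 [p4 p5 p6]]]] := ev_decomp hk (@ev_stable_dsp k m n Q d) (@par_stable_dsp k m n Q d).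
have hp a : hom_on (upper_block k m n) (dsp Q d) (p a).
  apply: (op_hom_upper hk) => [|q u ud uq|i j u ij ud]; [exact: ev_stable_dsp|exact: p2|].
  have [bij|nbij] := eqVneq (blk i) (blk j); first exact: p3.
  have [bi bj] : blk i /\ ~~ blk j by move: ij nbij; case: (blk i); case: (blk j).
  by rewrite !uQ ?lfun0 //; apply/dspP; rewrite ?p1.
have ext a : exists P : 'End(Q), is_hom P /\ {in dsp Q d, P =1 p a}.
  by have [P [HP _]] := iQ Q (p a) (hp a); exists P.
pose P a := sval (constructive_indefinite_description _ (ext a)).
have hP a : is_hom (P a) by case: (svalP (constructive_indefinite_description _ (ext a))).
have PE a : {in dsp Q d, P a =1 p a}.
  by case: (svalP (constructive_indefinite_description _ (ext a))).
have PP a b u : P a (P b u) = if a == b then P a u else 0.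
  have E : (P a \o P b)%VF = if a == b then P a else 0.
    apply: (induced_unique iQ); first exact: is_hom_comp.
      by case: eqP => _; [apply: hP|apply: is_hom0].
    move=> v vd; rewrite comp_lfunE !PE ?p1 // p4 //.
    by case: eqP => _; rewrite ?PE ?zero_lfunE.
  by rewrite -comp_lfunE E; case: eqP => _; rewrite ?zero_lfunE.
have Psum u : \sum_a P a u = u.
  have E : \sum_a P a = \1%VF.
    apply: (induced_unique iQ); last 2 first.
    - exact: is_hom_id.
    - by move=> v vd; rewrite sum_lfunE id_lfunE -[RHS]p5 //; apply: eq_bigr => a _; rewrite PE.
    apply: (op_is_hom hk) => [q v vq|i j v]; rewrite !sum_lfunE.
      by apply: rpred_sum => a _; apply: is_hom_par.
    by rewrite lfun_sum; apply: eq_bigr => a _; rewrite is_hom_op.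
  by rewrite -sum_lfunE E id_lfunE.
(* The module and its map are chosen together, as the type of the map depends on the module. *)
have sub a : exists Kq : {K : T & 'Hom(Q, K)}, is_subquot (limg (P a)) 0%VS (projT2 Kq).
  have [||K [q qP]] := @subquot_exists _ _ _ Q (limg (P a)) 0%VS.
  - exact: (submod_img hk (submod_full hk Q) (hP a)).
  - exact: submod0.
  by exists (existT _ K q).
pose Kq a := sval (constructive_indefinite_description _ (sub a)).
have qP a : is_subquot (limg (P a)) 0%VS (projT2 (Kq a)).
  exact: (svalP (constructive_indefinite_description _ (sub a))).
pose K a := projT1 (Kq a); pose q a : 'Hom(Q, K a) := projT2 (Kq a).
have imP a u : P a u \in limg (P a) by rewrite memv_img ?memvf.
exists r, K; split=> [a|].
  apply: (ev_simple_kac pQ (hP a) _ (qP a)) => [u|]; first by rewrite PP eqxx.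
  suff -> : (P a @: dsp Q d)%VS = (p a @: dsp Q d)%VS by apply: p6.
  by apply: eq_in_limg => u ud; rewrite PE.
exists (fun a => (q a \o P a)%VF); split.
- move=> a; have [hq _ _] := qP a; apply: (op_is_hom hk) => [b u ub|i j u]; rewrite !comp_lfunE.
    by case: hq => hq1 _ _; apply: hq1; [apply: imP|apply: is_hom_par].
  by rewrite (is_hom_op i j u (hP a)) (hom_on_op i j hq).
- move=> y; have lift_y a : exists u, P a u = u /\ q a u = y a.
    have [_ qS _] := qP a; have [_ /memv_imgP [u _ ->] qu] := qS (y a).
    by exists (P a u); rewrite PP eqxx.
  pose x a := sval (constructive_indefinite_description _ (lift_y a)).
  have xE a : P a (x a) = x a /\ q a (x a) = y a.
    exact: (svalP (constructive_indefinite_description _ (lift_y a))).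
  exists (\sum_a x a) => [|a]; first exact: memvf.
  rewrite comp_lfunE lfun_sum (bigD1 a) //= (xE a).1 big1 ?addr0; first exact: (xE a).2.
  by move=> b ba; rewrite -(xE b).1 PP eq_sym (negPf ba).
move=> u; rewrite memv0; split=> [/eqP ->|[_ u0]].
  by split=> [|a]; rewrite ?memvf ?lfun0.
apply/eqP; rewrite -(Psum u) big1 // => a _; have [_ _ qK] := qP a.
by apply/eqP; rewrite -memv0; apply/(qK _ (imP a u)); rewrite -comp_lfunE u0.
Qed.

Lemma pure_subquot_sum M d (U W : {vspace M}) : (W <= U)%VS -> pure_subquot d U W ->
  exists (r : nat) (K : 'I_r -> T),
    (forall j, exists2 lam, is_kac lam (K j) & deg lam = d) /\ quotient_iso_sum U W K.
Proof.
move=> /subvP WU [N [q [[hq qS qK] pN]]].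
have [r [K [kK [p [hp pS pK]]]]] := pure_decomp pN; exists r, K; split=> //.
exists (fun j => (p j \o q)%VF); split.
- move=> j; have hpj : is_hom (p j) := hp j.
  split=> [a u uU ua|a u ga uU|X u _ uU]; rewrite !comp_lfunE.
  + by apply: is_hom_par hpj _; case: hq => hq1 _ _; apply: hq1.
  + by case: hq => _ -> // _; case: hpj => _ -> //; rewrite memvf.
  + by case: hq => _ _ -> //; case: hpj => _ _ -> //; rewrite memvf.
- move=> y; have [v _ vy] := pS y; have [u uU qu] := qS v.
  by exists u => // j; rewrite comp_lfunE qu.
move=> u; split=> [uW|[uU u0]].
  have uU := WU _ uW; split=> // j; rewrite comp_lfunE.
  by rewrite (iffRL (qK u uU)) ?lfun0.
apply/(qK u uU)/eqP; rewrite -memv0; apply/pK; split=> [|j]; first exact: memvf.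
by rewrite -(u0 j) comp_lfunE.
Qed.

(** * Kac flags *)

Inductive kac_chain M : {vspace M} -> Prop :=
| KacChain0 : kac_chain 0%VS
| KacChainS U W lam K of kac_chain W & submod U & (W <= U)%VS & is_kac lam K &
    quotient_iso_sum U W (fun _ : unit => K) : kac_chain U.

Lemma kac_chain_flag M (U : {vspace M}) : kac_chain U -> kac_flag U.
Proof.
elim=> [|{}U W lam K _ [r [E [E0 Er sE stepE]]] sU WU kK qK].
  exists 0%N, (fun=> 0%VS); split=> // i _; exact: submod0.
exists r.+1, (fun i => if (i <= r)%N then E i else U); split.
- by [].
- by rewrite ltnn.
- by move=> i _; case: ifP => // ir; apply: sE.
move=> i; rewrite ltnS => ir; rewrite ir; have [ltir|geir] := ltnP i r; first exact: stepE.
have -> : i = r by apply/eqP; rewrite eqn_leq ir.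
by rewrite Er; split=> //; exists lam, K.
Qed.

(** [E s] is the common kernel in [U] of the [q j] with [j >= s], so that consecutive terms differ
    by one summand. *)
Lemma kac_chain_sum M (U W : {vspace M}) r (K : 'I_r -> T) : submod U -> kac_chain W ->
  (forall j, exists lam, is_kac lam (K j)) -> quotient_iso_sum U W K -> kac_chain U.
Proof.
move=> sU cW kK [q [hq qS qK]].
have [E HE] : exists E : nat -> {vspace M}, forall s u, u \in E s <->
    u \in U /\ forall j : 'I_r, (s <= j)%N -> q j u = 0.
  have ex s : exists E : {vspace M}, forall u, u \in E <->
      u \in U /\ forall j : 'I_r, (s <= j)%N -> q j u = 0.
    apply: vspace_of_pred => [|a u v [uU u0] [vU v0]].
      by split=> [|j _]; rewrite ?mem0v ?lfun0.
    split=> [|j js]; first by rewrite memvD ?memvZ.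
    by rewrite lfunD lfunZ u0 // v0 // scaler0 addr0.
  exists (fun s => sval (constructive_indefinite_description _ (ex s))) => s.
  exact: (svalP (constructive_indefinite_description _ (ex s))).
have sE s : submod (E s).
  apply: (lie_stable_submod hk) => [p u|i j u] /HE [uU u0]; apply/HE.
    split=> [|a sa]; first exact: (submod_parity sU).
    by rewrite (hom_on_pj p (submod_parity sU) (hq a) uU) u0 // lfun0.
  split=> [|a sa]; first exact: (submod_lie sU).
  by rewrite (hom_on_op i j (hq a) uU) u0 // lfun0.
have ES s : (E s <= E s.+1)%VS.
  by apply/subvP => u /HE [uU u0]; apply/HE; split=> // j js; apply: u0; apply: ltnW.
have -> : U = E r.
  apply/vspaceP => u; apply/idP/idP => [uU|/HE [] //].
  by apply/HE; split=> // j rj; have := ltn_ord j; rewrite ltnNge rj.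
have E0 : E 0%N = W.
  apply/vspaceP => u; apply/idP/idP => [/HE [uU u0]|/qK [uU u0]].
    by apply/qK; split=> // j; apply: u0.
  by apply/HE; split.
suff H s : (s <= r)%N -> kac_chain (E s) by apply: H.
elim: s => [_|s IHs sr]; first by rewrite E0.
have [lam klam] := kK (Ordinal sr); set j0 := Ordinal sr in klam.
have EsU : (E s.+1 <= U)%VS by apply/subvP => u /HE [].
apply: (KacChainS (IHs (ltnW sr)) (sE s.+1) (ES s) klam).
apply: (@quotient_iso_unit _ _ _ _ _ _ _ (q j0) (ES s)); split.
- exact: hom_onS (hq j0).
- move=> y; pose y' j : K j := if j =P j0 is ReflectT e then eq_rect_r (fun i => K i) y e else 0.
  have [u uU uE] := qS y'; exists u.
    apply/HE; split=> // j sj; rewrite uE /y'; case: (j =P j0) => // e.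
    by exfalso; move: sj; rewrite e /= ltnn.
  by rewrite uE /y'; case: (j0 =P j0) => // e; rewrite (eq_axiomK e).
move=> u /HE [uU u0]; split=> [q0|/HE [_ ->] //].
apply/HE; split=> // j; rewrite leq_eqVlt => /orP [/eqP sj|]; last exact: u0.
have -> : j = j0 by apply: val_inj.
exact: q0.
Qed.

(** Descending induction on [d], from beyond the largest degree, where the filtration is zero. *)
Lemma graded_chain M : pure_graded M -> forall d, kac_chain (degfil (fullv : {vspace M}) d).
Proof.
move=> gM d; have [B HB] := degfil_large hk M.
have [s Bs] : exists s : nat, B%:Z < d + s%:Z by exists (absz (B%:Z + 1 - d)%R); lia.
elim: s d Bs => [|s IHs] d Bs; first by rewrite HB; [apply: KacChain0|lia].
have [r [K [kK qK]]] : exists (r : nat) (K : 'I_r -> T),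
    (forall j, exists2 lam, is_kac lam (K j) & deg lam = d) /\
    quotient_iso_sum (degfil (fullv : {vspace M}) d) (degfil fullv (d + 1)) K.
  by apply: pure_subquot_sum (gM d); apply: degfil_le => //; rewrite lerDl.
apply: (kac_chain_sum (degfil_submod hk _ _) (IHs (d + 1) _) _ qK); first by lia.
by move=> j; have [lam klam _] := kK j; exists lam.
Qed.

Lemma graded_Tplus M : pure_graded M -> in_Tplus M.
Proof.
move=> gM; have [B HB] := degfil_small hk M; rewrite /in_Tplus -(HB (- B%:Z - 1)); last by lia.
exact/kac_chain_flag/graded_chain.
Qed.

Lemma degfil_filtration M : pure_graded M ->
  degree_filtration (fun i => degfil (fullv : {vspace M}) (- i)).
Proof.
move=> gM; split.
- move=> i; split; first exact: degfil_submod.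
  exact/kac_chain_flag/graded_chain.
- by move=> i; apply: degfil_le => //; lia.
- by have [B HB] := degfil_large hk M; exists (- B%:Z - 1) => i iB; apply: HB; lia.
- by have [B HB] := degfil_small hk M; exists (B%:Z + 1) => i iB; apply: HB; lia.
move=> i; have -> : - (i - 1) = - i + 1 by rewrite opprB addrC.
have [|r [K [kK qK]]] := pure_subquot_sum _ (gM (- i)).
  by apply: degfil_le => //; rewrite lerDl.
have lamP j : exists lam, is_kac lam (K j) /\ deg lam = - i.
  by have [lam klam dlam] := kK j; exists lam.
exists r, (fun j => sval (constructive_indefinite_description _ (lamP j))), K; split=> // j.
exact: (svalP (constructive_indefinite_description _ (lamP j))).
Qed.

(** The quotient of [F i] by [F (i - 1)] is generated in degree [- i], so induction from below puts
    [F i] into [degfil]. Conversely, a vector of degree at least [- i] dies in the quotient of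
    [F (i + 1)] by [F i], which has no degree above [- (i + 1)]; so it descends from [F i1] to
    [F i]. *)
Lemma filtration_unique M (F : int -> {vspace M}) :
  degree_filtration F -> forall i, F i = degfil (fullv : {vspace M}) (- i).
Proof.
move=> [sF FS [i0 Fi0] [i1 Fi1] FK].
have pF j : pure_subquot (- j) (F j) (F (j - 1)).
  have [r [lam [K [kK qK]]]] := FK j.
  apply: (sum_pure_subquot hk (sF j).1 (sF (j - 1)).1 qK) => a.
  by have [ka <-] := kK a; apply: kac_pure.
move=> i; apply/eqP; rewrite eqEsubv; apply/andP; split.
  have [s si] : exists s : nat, i <= i0 + s%:Z by exists (absz (i - i0)%R); lia.
  elim: s i si => [|s IHs] i si; first by rewrite Fi0 ?sub0v //; lia.
  have [N [q [[hq qS qK] pN]]] := pF i.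
  have IH : (F (i - 1) <= degfil fullv (- i))%VS.
    by apply: subv_trans (IHs (i - 1) _) _; [lia|apply: degfil_le => //; lia].
  pose Y := (F i :&: degfil fullv (- i))%VS.
  have sY : submod Y by apply: submodI => //; [exact: (sF i).1|exact: degfil_submod].
  have qY : (q @: Y)%VS = fullv.
    apply: (pure_gen hk pN).
      by apply: submod_img => //; apply: hom_onS hq; apply: capvSl.
    apply/subvP => y /dspP yd; have [u uF quy] := qS y; rewrite -quy in yd *.
    have [x [xF xd <-]] := subquot_deg_lift hk hq (submod_ev (sF i).1) uF yd.
    by rewrite memv_img // memv_cap xF (degfil_in (lexx _) (memvf _) xd).
  apply/subvP => u uF; have : q u \in (q @: Y)%VS by rewrite qY memvf.
  case/memv_imgP => y; rewrite memv_cap => /andP [yF yd] quy.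
  rewrite -[u](subrK y) memvD // (subvP IH) //.
  by apply/qK; rewrite ?memvB // lfunB quy subrr.
apply: gen_sub => [|v [_ [c ic cv]]]; first exact: (sF i).1.
have [s si] : exists s : nat, i1 - s%:Z <= i by exists (absz (i1 - i)%R); lia.
elim: s i si ic => [|s IHs] i si ic; first by rewrite Fi1 ?memvf //; lia.
have vF : v \in F (i + 1) by apply: IHs; lia.
have [N [q [[hq qS qK] pN]]] := pF (i + 1).
have := qK v vF; rewrite addrK => -[+ _]; apply.
apply: (pure_deg hk pN (isdeg_hom hq (submod_ev (sF (i + 1)).1) vF cv)); lia.
Qed.

End Decomposition.

Theorem lemma14p1 (k : closedFieldType) (hk : [pchar k] =i pred0)
    (m n : nat) (hmn : (n <= m)%N) :
  exists F : forall M : glmod k m n, int -> {vspace M},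
    [/\ forall M : glmod k m n, in_Tplus M ->
          degree_filtration (F M) /\
          (forall F' : int -> {vspace M}, degree_filtration F' -> F' =1 F M),
        forall (M N : glmod k m n) (s : 'Hom(N, M)) (t : 'Hom(M, N)),
          in_Tplus M -> retract s t ->
          in_Tplus N /\
          forall i, (s @: F N i)%VS = (limg s :&: F M i)%VS &
        forall (M N : glmod k m n) (f : 'Hom(M, N)),
          in_Tplus M -> in_Tplus N -> is_hom f ->
          forall i, (f @: F M i <= F N i)%VS].
Proof.
(* The sign makes the filtration increasing, since [degfil] decreases in the degree. *)
exists (fun (M : glmod k m n) i => degfil (fullv : {vspace M}) (- i)); split.
- move=> M TM; split; last exact: filtration_unique.
  exact/degfil_filtration/Tplus_graded.
- move=> M N s t TM rst; split.
    by apply: (graded_Tplus hk); apply: (graded_retract hk rst); apply: Tplus_graded.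
  (* Both inclusions come from functoriality, of [s] for the first and of [t] for the second, where
     [v = t (s v)]. *)
  have [hs ht ts] := rst; move=> i; apply/eqP; rewrite eqEsubv subv_cap limgS ?subvf //=.
  rewrite degfil_hom //=; apply/subvP => _ /memv_capP [/memv_imgP [v _ ->] svF].
  have -> : v = t (s v) by rewrite -comp_lfunE ts id_lfunE.
  by rewrite memv_img // (subvP (degfil_hom hk _ ht)) // memv_img.
by move=> M N f _ _ hf i; apply: degfil_hom.
Qed.
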